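(* Let $V$ be a finite dimensional vector space with ordered basis $v_1<\dots<v_d$ and dual basis $v_1^*,\dots,v_d^*$ of $V^*$, and let $\mathcal{B}$ be the set of Lyndon-Shirshov words in the alphabet $\{v_1,\dots,v_d\}$. Then the family $(\mathcal{L}\omega)_{\omega\in\mathcal{B}}$ is a vector space basis of the free Lie algebra $\mathrm{L}V$, the family $(\mathcal{G}\omega)_{\omega\in\mathcal{B}}$ is a vector space basis of the cofree conilpotent Lie coalgebra $\mathrm{E}V^*$, and these bases are dual under the configuration pairing: for all $\omega,\upsilon\in\mathcal{B}$, $\langle \mathcal{G}\omega,\mathcal{L}\upsilon\rangle = 1$ if $\omega=\upsilon$ and $0$ otherwise.
   Context: **Trees and graphs.** A tree is a finite rooted binary tree embedded in the upper half plane; a graph is a finite oriented, connected, acyclic graph (acyclic as an undirected graph). $\mathrm{Tr}(V)$ is the vector space spanned by trees whose leaves are labeled by elements of $V$, modulo multilinearity in the labels; $\mathrm{Gr}(V^* )$ is the vector space spanned by graphs whose vertices are labeled by elements of $V^*$, modulo multilinearity in the labels. For trees $\tau_1,\tau_2$, $[\tau_1,\tau_2]$ is the tree whose root has left branch $\tau_1$ and right branch $\tau_2$. $\mathrm{L}V$, the free Lie algebra on $V$, is $\mathrm{Tr}(V)$ modulo the (local) anti-symmetry and Jacobi relations. $\mathrm{E}V^*$, the cofree conilpotent Lie coalgebra on $V^*$, is $\mathrm{Gr}(V^* )$ modulo the local relations: (arrow-reversing) reversing the direction of one edge multiplies a graph by $-1$; (Arnold) for vertices $a,b,c$, the sum of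 three graphs which agree except that they contain respectively the edges $\{a\to b,\ b\to c\}$, $\{b\to c,\ c\to a\}$, $\{c\to a,\ a\to b\}$ is zero (all other edges and labels fixed). **Configuration pairing.** For a graph $G$, a tree $T$ and a bijection $\sigma:\mathrm{Vertices}(G)\to\mathrm{Leaves}(T)$, let $\beta_\sigma$ send an edge $a\to b$ of $G$ to the internal vertex of $T$ closest to the root on the path from leaf $\sigma(a)$ to leaf $\sigma(b)$, with sign $+1$ if $\sigma(a)$ is left of $\sigma(b)$ in the planar embedding and $-1$ if it is to the right. Set $\langle G,T\rangle_\sigma$ to be the product of these signs over all edges if $\beta_\sigma:\mathrm{Edges}(G)\to\{\text{internal vertices of }T\}$ is surjective, and $0$ otherwise. For labeled $\gamma=(G,l_G)$, $\tau=(T,l_T)$ set $\langle\gamma,\tau\rangle=\sum_\sigma\langle G,T\rangle_\sigma\prod_{v}\langle l_G(v),l_T(\sigma(v))\rangle$, summing over all bijections $\sigma$ and taking the product over vertices $v$ of $G$ ($0$ if there are no bijections); extend bilinearly. This pairing descends to a pairing of $\mathrm{E}V^*$ with $\mathrm{L}V$. **Words.** $\mathcal{A}$ is the set of finite nonempty words in the ordered alphabet $v_1<\dots<v_d$, with lexicographic order (a proper prefix is smaller). $\mathcal{B}\subset\mathcal{A}$ is the set of words strictly smaller than all their nontrivial cyclic rotations. A simple word in an alphabet is a word $x^k y_1\cdots y_\ell$ with $k,\ell>0$ and $y_i\ne x$ for all $i$; two simple words are compatible if their initial letters $x$ coincide. $\mathcal{A}_0$ is the set of one-letter words, $\mathcal{A}_1$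 the set of simple words, and, for $m>1$, $\mathcal{A}_m$ is the set of words which are simple words in an alphabet of mutually compatible elements of $\mathcal{A}_{m-1}$. The $\mathcal{A}_m$ are disjoint, and for $m\ge1$ an element of $\mathcal{A}_m$ is uniquely of the form $\omega^k\psi_1\cdots\psi_\ell$ with $\omega,\psi_i\in\mathcal{A}_{m-1}$ (mutually compatible if $m>1$), $\psi_i\neq\omega$, $k,\ell>0$. Put $\mathcal{B}_m=\mathcal{B}\cap\mathcal{A}_m$; every word of $\mathcal{B}$ lies in exactly one $\mathcal{B}_m$, and if $\omega^k\psi_1\cdots\psi_\ell\in\mathcal{B}_m$ then $\omega,\psi_i\in\mathcal{B}_{m-1}$. **The maps $\mathcal{L}$ and $\mathcal{G}$.** $\mathcal{L}v_i=v_i$; $\mathcal{G}v_i$ is the graph with a single vertex labeled $v_i^*$, which is its pivot vertex. For $\omega^k\psi_1\cdots\psi_\ell\in\mathcal{B}_m$ ($m\ge1$, written in its unique decomposition with $\omega,\psi_i\in\mathcal{A}_{m-1}$, mutually compatible if $m>1$, $\psi_i\neq\omega$, $k,\ell>0$), $\mathcal{L}(\omega^k\psi_1\cdots\psi_\ell)$ is the left-normed bracket $$[[\cdots[[[\cdots[\mathcal{L}\psi_1,\mathcal{L}\omega],\cdots],\mathcal{L}\omega],\mathcal{L}\psi_2],\cdots],\mathcal{L}\psi_\ell]$$ with $\mathcal{L}\omega$ occurring $k$ times. $\mathcal{G}(\omega^k\psi_1\cdots\psi_\ell)$ is obtained from the disjoint union of $k$ copies of $\mathcal{G}\omega$ and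 of $\mathcal{G}\psi_1,\dots,\mathcal{G}\psi_\ell$ by adding edges between pivot vertices: $\mathcal{G}\psi_1\to\mathcal{G}\omega\to\mathcal{G}\omega\to\cdots\to\mathcal{G}\omega$ (a chain through the $k$ copies) and $\mathcal{G}\psi_1\to\mathcal{G}\psi_2\to\cdots\to\mathcal{G}\psi_\ell$; its pivot vertex is the pivot vertex of $\mathcal{G}\psi_1$.
   Formalization: The base field is assumed to have characteristic 0; in characteristic p > 0 (with V nonzero) the claim fails, since the chain graph on p vertices all labelled v_1* is a nonzero class of EV* outside the span of the Gω. *)

(* Defs.v *)
From HB Require Import structures.
From mathcomp Require Import all_boot all_order all_algebra perm.
From mathcomp Require Import boolp classical_sets.
From mathcomp Require Import freeg.

Set Implicit Arguments.
Unset Strict Implicit.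
Unset Printing Implicit Defensive.

Import Order.TTheory GRing.Theory.
Local Open Scope ring_scope.
Local Open Scope quotient_scope.

Section QuotientModule.
Variables (K : nzRingType) (U : lmodType K) (rel : U -> Prop).

Inductive in_span : U -> Prop :=
| in_span0 : in_span 0
| in_span_scale_add c u v of rel u & in_span v : in_span (c *: u + v).

Lemma in_spanD u v : in_span u -> in_span v -> in_span (u + v).
Proof.
elim=> [|c u1 u2 ru1 _ IH] sv; first by rewrite add0r.
by rewrite -addrA; apply: in_span_scale_add => //; apply: IH.
Qed.

Lemma in_spanZ c u : in_span u -> in_span (c *: u).
Proof.
elim=> [|b u1 u2 ru1 _ IH]; first by rewrite scaler0; apply: in_span0.
by rewrite scalerDr scalerA; apply: in_span_scale_add.
Qed.

Definition span_pred : {pred U} := fun u => `[< in_span u >].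

Lemma span_pred_zmod_closed : zmod_closed span_pred.
Proof.
split=> [|u v /asboolP su /asboolP sv]; apply/asboolP; first exact: in_span0.
by rewrite -scaleN1r; apply/in_spanD/in_spanZ.
Qed.

HB.instance Definition _ :=
  GRing.isZmodClosed.Build U span_pred span_pred_zmod_closed.

Definition quotmod : Type := Quotient.quot (span_pred : zmodClosed U).

HB.instance Definition _ := GRing.Zmodule.on quotmod.
HB.instance Definition _ := EqQuotient.on quotmod.

Definition quotmod_scale (c : K) (x : quotmod) : quotmod :=
  \pi_quotmod (c *: repr x).

Lemma quotmod_piP (u v : U) :
  (\pi_quotmod u = \pi_quotmod v) <-> in_span (u - v).
Proof.
have E : (u - v \in span_pred) = (\pi_quotmod u == \pi_quotmod v).
  exact: (Quotient.idealrBE (span_pred : zmodClosed U)).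
split=> [/eqP|suv]; first by rewrite -E => /asboolP.
by apply/eqP; rewrite -E; apply/asboolP.
Qed.

Lemma quotmod_piD (u v : U) :
  \pi_quotmod (u + v) = \pi_quotmod u + \pi_quotmod v.
Proof. exact: (Quotient.pi_add (span_pred : zmodClosed U)). Qed.

Lemma quotmod_piZ c (u : U) :
  \pi_quotmod (c *: u) = quotmod_scale c (\pi_quotmod u).
Proof.
apply/quotmod_piP; rewrite -scalerBr; apply/in_spanZ/quotmod_piP.
by rewrite reprK.
Qed.

Lemma quotmod_scaleA a b x :
  quotmod_scale a (quotmod_scale b x) = quotmod_scale (a * b) x.
Proof.
by elim/quotW: x => u; rewrite -[in LHS](quotmod_piZ b u) -!quotmod_piZ scalerA.
Qed.

Lemma quotmod_scale1 : left_id 1 quotmod_scale.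
Proof. by elim/quotW => u; rewrite -quotmod_piZ scale1r. Qed.

Lemma quotmod_scaleDr : right_distributive quotmod_scale +%R.
Proof.
move=> c; elim/quotW=> u; elim/quotW=> w.
by rewrite -quotmod_piD -!quotmod_piZ scalerDr quotmod_piD.
Qed.

Lemma quotmod_scaleDl x : {morph quotmod_scale^~ x : a b / a + b}.
Proof.
by elim/quotW: x => u a b; rewrite -!quotmod_piZ scalerDl quotmod_piD.
Qed.

HB.instance Definition _ := GRing.Zmodule_isLmodule.Build K quotmod
  quotmod_scaleA quotmod_scale1 quotmod_scaleDr quotmod_scaleDl.

End QuotientModule.

Definition is_family_basis (K : nzRingType) (M : lmodType K) (I : choiceType)
    (b : I -> M) : Prop :=
  (forall (s : seq I) (c : I -> K), uniq s ->
     \sum_(i <- s) c i *: b i = 0 -> forall i, i \in s -> c i = 0) /\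
  (forall x : M, exists (s : seq I) (c : I -> K), x = \sum_(i <- s) c i *: b i).

Inductive tree (W : Type) : Type :=
| Leaf of W
| Node of tree W & tree W.

Section TreeChoice.
Variable W : Type.

Fixpoint gentree_of_tree (t : tree W) : GenTree.tree W :=
  match t with
  | Leaf x => GenTree.Leaf x
  | Node l r => GenTree.Node 0 [:: gentree_of_tree l; gentree_of_tree r]
  end.

Fixpoint tree_of_gentree (g : GenTree.tree W) : option (tree W) :=
  match g with
  | GenTree.Leaf x => Some (Leaf x)
  | GenTree.Node _ [:: l; r] =>
      if (tree_of_gentree l, tree_of_gentree r) is (Some l', Some r')
      then Some (Node l' r') else None
  | _ => None
  end.

Lemma gentree_of_treeK : pcancel gentree_of_tree tree_of_gentree.
Proof. by elim=> //= l -> r ->. Qed.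
End TreeChoice.

HB.instance Definition _ (W : eqType) :=
  Equality.copy (tree W) (pcan_type (@gentree_of_treeK W)).
HB.instance Definition _ (W : choiceType) :=
  Choice.copy (tree W) (pcan_type (@gentree_of_treeK W)).

Section LieAlgebra.
Variables (K : nzRingType) (V : lmodType K).

(* One-hole contexts: a local relation may be applied at any place of a tree.
   Multilinearity in the labels and the local relations are divided out in a
   single quotient, here and for graphs. *)
Inductive tree_ctx : Type :=
| Hole
| CtxL of tree_ctx & tree V
| CtxR of tree V & tree_ctx.

Fixpoint plug (C : tree_ctx) (t : tree V) : tree V :=
  match C with
  | Hole => t
  | CtxL C' r => Node (plug C' t) r
  | CtxR l C' => Node l (plug C' t)
  end.

Definition tree_gen (t : tree V) : {freeg (tree V) / K} := << t >>.

Inductive tree_rel : {freeg (tree V) / K} -> Prop :=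
| tree_multilinear C (a : K) x y :
    tree_rel (tree_gen (plug C (Leaf (a *: x + y)))
              - a *: tree_gen (plug C (Leaf x)) - tree_gen (plug C (Leaf y)))
| tree_antisym C s t :
    tree_rel (tree_gen (plug C (Node s t)) + tree_gen (plug C (Node t s)))
| tree_jacobi C r s t :
    tree_rel (tree_gen (plug C (Node (Node r s) t))
              + tree_gen (plug C (Node (Node s t) r))
              + tree_gen (plug C (Node (Node t r) s))).

Definition free_lie : lmodType K := quotmod tree_rel.

Definition tree_class (t : tree V) : free_lie :=
  \pi_(quotmod tree_rel) (tree_gen t).
End LieAlgebra.

Definition adjacent n (E : {set 'I_n * 'I_n}) : rel 'I_n :=
  fun a b => ((a, b) \in E) || ((b, a) \in E).

(* The pair (a, b) is the edge a -> b. The second condition excludes loops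
   (a = b) and undirected cycles of length two, which [adjacent] cannot see; a
   simple cycle has at most n vertices, hence the bound on its length k. *)
Definition is_graph n (E : {set 'I_n * 'I_n}) : bool :=
  [&& (0 < n)%N,
      [forall a, forall b, ((a, b) \in E) ==> ((b, a) \notin E)],
      [forall a, forall b, connect (adjacent E) a b] &
      [forall k : 'I_n.+1, forall p : k.-tuple 'I_n,
         ucycleb (adjacent E) p ==> (k <= 2)%N]].

Record graph (n : nat) : Type :=
  Graph { edges :> {set 'I_n * 'I_n}; graphP : is_graph edges }.

HB.instance Definition _ n := [isSub for @edges n].
HB.instance Definition _ n := [Choice of graph n by <:].

Definition lgraph (W : choiceType) : choiceType :=
  {n : nat & (graph n * {ffun 'I_n -> W})%type}.

Definition LGraph (W : choiceType) n (G : graph n) (l : {ffun 'I_n -> W}) :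
  lgraph W := Tagged (fun n => (graph n * {ffun 'I_n -> W})%type) (G, l).

Section LieCoalgebra.
Variables (K : nzRingType) (W : lmodType K).

Definition graph_gen (g : lgraph W) : {freeg (lgraph W) / K} := << g >>.

Definition relabel n (l : {ffun 'I_n -> W}) (i : 'I_n) (x : W) :
  {ffun 'I_n -> W} := [ffun j => if j == i then x else l j].

(* Abstract vertices are numbered by 'I_n, so renumbering them must not change
   the class of a graph: this is [graph_iso]. *)
Inductive graph_rel : {freeg (lgraph W) / K} -> Prop :=
| graph_iso n (G G' : graph n) (l l' : {ffun 'I_n -> W}) (s : {perm 'I_n}) of
    (forall a b, ((a, b) \in edges G) = ((s a, s b) \in edges G')) &
    (forall a, l a = l' (s a)) :
    graph_rel (graph_gen (LGraph G l) - graph_gen (LGraph G' l'))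
| graph_multilinear n (G : graph n) (l : {ffun 'I_n -> W}) i (c : K) x y :
    graph_rel (graph_gen (LGraph G (relabel l i (c *: x + y)))
               - c *: graph_gen (LGraph G (relabel l i x))
               - graph_gen (LGraph G (relabel l i y)))
| graph_reverse n (G G' : graph n) (l : {ffun 'I_n -> W}) a b of
    (a, b) \in edges G & edges G' = ((b, a) |: (edges G :\ (a, b)))%SET :
    graph_rel (graph_gen (LGraph G l) + graph_gen (LGraph G' l))
| graph_arnold n (G1 G2 G3 : graph n) (l : {ffun 'I_n -> W})
    (F : {set 'I_n * 'I_n}) a b c of
    edges G1 = (F :|: [set (a, b); (b, c)])%SET &
    edges G2 = (F :|: [set (b, c); (c, a)])%SET &
    edges G3 = (F :|: [set (c, a); (a, b)])%SET :
    graph_rel (graph_gen (LGraph G1 l) + graph_gen (LGraph G2 l)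
               + graph_gen (LGraph G3 l)).

Definition cofree_lie : lmodType K := quotmod graph_rel.

Definition graph_class (g : lgraph W) : cofree_lie :=
  \pi_(quotmod graph_rel) (graph_gen g).
End LieCoalgebra.

Section TreeShape.
Variable W : Type.

Fixpoint leaf_labels (t : tree W) : seq W :=
  match t with
  | Leaf x => [:: x]
  | Node l r => leaf_labels l ++ leaf_labels r
  end.

(* The vertices of a tree are given by their addresses: the sequence of
   left (false) and right (true) turns on the path from the root. *)
Fixpoint leaf_addresses (t : tree W) : seq (seq bool) :=
  match t with
  | Leaf _ => [:: [::]]
  | Node l r => map (cons false) (leaf_addresses l)
                ++ map (cons true) (leaf_addresses r)
  end.

Fixpoint internal_addresses (t : tree W) : seq (seq bool) :=
  match t with
  | Leaf _ => [::]
  | Node l r => [::] :: map (cons false) (internal_addresses l)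
                ++ map (cons true) (internal_addresses r)
  end.

Definition nleaves (t : tree W) : nat := size (leaf_addresses t).

Definition leaf_address (t : tree W) (i : 'I_(nleaves t)) : seq bool :=
  tnth (in_tuple (leaf_addresses t)) i.
End TreeShape.

Fixpoint common_prefix (p q : seq bool) : seq bool :=
  match p, q with
  | a :: p', b :: q' => if a == b then a :: common_prefix p' q' else [::]
  | _, _ => [::]
  end.

Section GraphTreePairing.
Variables (K : nzRingType) (W : Type) (n : nat) (G : graph n) (t : tree W).
Variable s : 'I_n -> 'I_(nleaves t).

(* The vertex closest to the root on the path between two leaves is their
   deepest common ancestor. *)
Definition beta (e : 'I_n * 'I_n) : seq bool :=
  common_prefix (leaf_address (s e.1)) (leaf_address (s e.2)).

Definition beta_sign (e : 'I_n * 'I_n) : K :=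
  if (s e.1 < s e.2)%N then 1 else -1.

Definition shape_pairing : K :=
  if all (fun p => [exists e in edges G, beta e == p]) (internal_addresses t)
  then \prod_(e in edges G) beta_sign e else 0.
End GraphTreePairing.

Section ConfigurationPairing.
Variables (K : fieldType) (V : vectType K).

Definition dual_space : vectType K := 'Hom(V, K^o).

Definition leaf_label (t : tree V) (i : 'I_(nleaves t)) : V :=
  nth 0 (leaf_labels t) i.

(* A map 'I_n -> 'I_m is bijective iff it is injective and n = m. *)
Definition gen_pairing (g : lgraph dual_space) (t : tree V) : K :=
  let G := (tagged g).1 in
  let l := (tagged g).2 in
  \sum_(s : {ffun 'I_(tag g) -> 'I_(nleaves t)}
        | injectiveb s && (tag g == nleaves t))
    shape_pairing K G s * \prod_(i < tag g) (l i (leaf_label (s i)) : K).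

Definition free_pairing (x : {freeg (lgraph dual_space) / K})
    (y : {freeg (tree V) / K}) : K :=
  \sum_(g <- dom x) \sum_(t <- dom y) coeff g x * coeff t y * gen_pairing g t.

(* [free_pairing] descends to the quotients, so that the choice of
   representatives is immaterial. *)
Definition conf_pairing (x : cofree_lie dual_space) (y : free_lie V) : K :=
  free_pairing (repr (x : quotmod (@graph_rel K dual_space)))
               (repr (y : quotmod (@tree_rel K V))).
End ConfigurationPairing.

Section Words.
Variable d : nat.

Definition word : choiceType := seq 'I_d.

(* [Order.SeqLexiOrder] compares sequences lexicographically, a proper prefix
   being smaller. *)
Definition lyndon (w : word) : bool :=
  (w != [::]) &&
  all (fun i => ((w : seqlexi 'I_d) < (rot i w : seqlexi 'I_d))%O)
      (iota 1 (size w).-1).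

Definition lyndon_word : choiceType := {w : word | lyndon w}.

(* w is the simple word x ^ k y_1 ... y_l in the alphabet C. *)
Definition simple_in (C : word -> Prop) (x : word) (k : nat) (ys : seq word)
    (w : word) : Prop :=
  [/\ (0 < k)%N, (0 < size ys)%N, x \notin ys,
      forall u, u \in x :: ys -> C u & w = flatten (nseq k x ++ ys)].

(* [factors m x k ys w]: w is in A_(m+1), with decomposition x ^ k ys. For
   m > 0 the alphabet consists of the elements of A_m whose initial letter is
   some z in A_(m-1); these are mutually compatible. *)
Fixpoint factors (m : nat) : word -> nat -> seq word -> word -> Prop :=
  match m with
  | 0 => simple_in (fun u => size u = 1%N)
  | m'.+1 => fun x k ys w => exists z,
      simple_in (fun u => exists j us, factors m' z j us u) x k ys w
  end.

Definition in_level (m : nat) (w : word) : Prop :=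
  match m with
  | 0 => size w = 1%N
  | m'.+1 => exists x k ys, factors m' x k ys w
  end.

(* The level and the decomposition are unique when they exist (they do for
   all Lyndon words); [xget] returns a default value otherwise. *)
Definition level (w : word) : nat := xget 0%N (fun m => in_level m w).

Definition decomposition (m : nat) (w : word) : word * nat * seq word :=
  xget ([::], 0%N, [::]) (fun f => factors m f.1.1 f.1.2 f.2 w).
End Words.

Section LieOfWord.
Variables (V : nmodType) (d : nat) (v : 'I_d -> V).

Definition letter_label (w : word d) : V := if w is i :: _ then v i else 0.

Fixpoint lie_rec (m : nat) (w : word d) : tree V :=
  match m with
  | 0 => Leaf (letter_label w)
  | m'.+1 =>
      let: (x, k, ys) := decomposition m' w in
      if map (lie_rec m') ys is t :: ts
      then foldl (@Node V) t (nseq k (lie_rec m' x) ++ ts)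
      else Leaf 0
  end.

Definition lie_of_word (w : word d) : tree V := lie_rec (level w) w.
End LieOfWord.

Section Graft.
Variables (n1 n2 : nat) (G1 : graph n1) (G2 : graph n2) (p1 : 'I_n1) (p2 : 'I_n2).

(* Disjoint union of G1 and G2 with the additional edge p1 -> p2. *)
Definition graft_edges : {set 'I_(n1 + n2) * 'I_(n1 + n2)} :=
  [set e | match split e.1, split e.2 with
           | inl a, inl b => (a, b) \in edges G1
           | inr a, inr b => (a, b) \in edges G2
           | inl a, inr b => (a == p1) && (b == p2)
           | inr _, inl _ => false
           end]%SET.

Local Notation adj := (adjacent graft_edges).
Local Notation L := (@lshift n1 n2).
Local Notation R := (@rshift n1 n2).

Lemma graft_adj_ll a b : adj (L a) (L b) = adjacent (edges G1) a b.
Proof. by rewrite /adjacent !inE /= !(unsplitK (inl _)). Qed.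

Lemma graft_adj_rr a b : adj (R a) (R b) = adjacent (edges G2) a b.
Proof. by rewrite /adjacent !inE /= !(unsplitK (inr _)). Qed.

Lemma graft_adj_lr a b : adj (L a) (R b) = (a == p1) && (b == p2).
Proof.
by rewrite /adjacent !inE /= (unsplitK (inr _)) (unsplitK (inl _)) orbF.
Qed.

Lemma graft_adj_rl a b : adj (R b) (L a) = (a == p1) && (b == p2).
Proof. by rewrite -graft_adj_lr /adjacent orbC. Qed.

Lemma graft_ordP (i : 'I_(n1 + n2)) : (exists a, i = L a) + (exists b, i = R b).
Proof.
by rewrite -[i]splitK; case: (split i) => a /=; [left|right]; exists a.
Qed.

Definition is_left (i : 'I_(n1 + n2)) : bool := (i < n1)%N.

Lemma is_left_l a : is_left (L a). Proof. exact: (ltn_ord a). Qed.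

Lemma is_left_r b : is_left (R b) = false.
Proof. by apply/negbTE; rewrite /is_left /= -leqNgt leq_addr. Qed.

Lemma acyclicP n (G : graph n) p : ucycleb (adjacent (edges G)) p -> (size p <= 2)%N.
Proof.
case: G => E /= /and4P[_ _ _ /forallP acE] ucp.
have up : uniq p by case/andP: ucp.
have szp : (size p < n.+1)%N.
  by rewrite ltnS -[n in (_ <= n)%N]card_ord -(card_uniqP up) max_card.
by have /forallP/(_ (in_tuple p))/implyP := acE (Ordinal szp); apply.
Qed.

Lemma graft_stay_right q c : ~~ is_left c -> path adj c q ->
  R p2 \notin c :: q -> ~~ is_left (last c q).
Proof.
elim: q c => //= c' q IH c nLc /andP[cc' pq].
rewrite in_cons negb_or => /andP[cb bq]; apply: IH => //.
apply/negP => Lc'; move: nLc cc' cb Lc'.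
case: (graft_ordP c) => -[x ->]; first by rewrite is_left_l.
case: (graft_ordP c') => -[y ->] _; last by rewrite is_left_r.
by rewrite graft_adj_rl => /andP[_ /eqP ->]; rewrite eqxx.
Qed.

Lemma graft_acyclic p : ucycleb adj p -> (size p <= 2)%N.
Proof.
have side i : is_left i = ~~ ~~ is_left i by rewrite negbK.
move=> ucp; have [allL|] := boolP (all is_left p).
  have [q Dp] : exists q, p = map L q.
    elim: p allL {ucp} => [|i p IH] /=; first by exists [::].
    case/andP; case: (graft_ordP i) => -[a ->]; last by rewrite is_left_r.
    by move=> _ /IH[q ->]; exists (a :: q).
  rewrite Dp size_map; apply: (@acyclicP _ G1); move: ucp; rewrite Dp /ucycleb.
  rewrite (map_inj_uniq (@lshift_inj _ _)) => /andP[cq ->]; rewrite andbT.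
  move: cq; case: q {Dp} => //= a q.
  by rewrite -map_rcons path_map; apply: sub_path => x y /=; rewrite graft_adj_ll.
rewrite -has_predC => /hasP[r pr nLr].
have [allR|] := boolP (all (predC is_left) p).
  have [q Dp] : exists q, p = map R q.
    elim: p allR {ucp pr} => [|i p IH] /=; first by exists [::].
    case/andP; case: (graft_ordP i) => -[a ->]; first by rewrite is_left_l.
    by move=> _ /IH[q ->]; exists (a :: q).
  rewrite Dp size_map; apply: (@acyclicP _ G2); move: ucp; rewrite Dp /ucycleb.
  rewrite (map_inj_uniq (@rshift_inj _ _)) => /andP[cq ->]; rewrite andbT.
  move: cq; case: q {Dp} => //= a q.
  by rewrite -map_rcons path_map; apply: sub_path => x y /=; rewrite graft_adj_rr.
rewrite -has_predC => /hasP[l pl /= /negPn Ll].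
have [i s Ds] := rot_to pl.
have ucs : ucycleb adj (l :: s).
  by rewrite -Ds /ucycleb rot_uniq rot_cycle.
have sz : size p = (size s).+1 by rewrite -(size_rot i) Ds.
have rs : r \in s.
  have : r \in l :: s by rewrite -Ds mem_rot.
  by rewrite inE => /orP[/eqP rl|//]; move: nLr; rewrite /= rl Ll.
have hs : has (predC is_left) s by apply/hasP; exists r.
case: (split_find hs) ucs sz => c s1 s2 /= nLc nhs1 ucs sz.
have ls1 : is_left (last l s1).
  have : all is_left (l :: s1) by rewrite /= Ll -[all _ _]negbK -has_predC.
  by move/allP; apply; apply: mem_last.
set q := s2 ++ l :: s1.
have {}ucs : ucycleb adj (c :: q).
  move: ucs; rewrite cat_rcons -[l :: _]/((l :: s1) ++ c :: s2) -/(ucycle _ _).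
  by rewrite -(rot_ucycle (size (l :: s1))) rot_size_cat.
have {}sz : size p = (size q).+1.
  by rewrite sz /q !size_cat size_rcons /= addSn addnS addnC.
have lq : is_left (last c q) by rewrite /q last_cat.
have qn0 : q != [::] by rewrite /q; case: (s2).
case/andP: ucs => /=; rewrite rcons_path => /andP[pq ac] /andP[cNq uq].
have [a Da] : exists a, last c q = L a.
  by case: (graft_ordP (last c q)) lq => -[a ->]; [exists a | rewrite is_left_r].
have [b Db] : exists b, c = R b.
  by case: (graft_ordP c) nLc => -[b ->]; [rewrite /= is_left_l | exists b].
move: ac; rewrite Da {1}Db graft_adj_lr => /andP[/eqP Ea /eqP Eb].
rewrite Ea in Da; rewrite {a Ea}.
rewrite Eb in Db; rewrite {b Eb}.
case: q qn0 pq cNq uq lq Da sz => // e q _ /= /andP[ce pq] cNq /andP[eq uq] lq Da ->.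
have [x Dx] : exists x, e = L x.
  case: (graft_ordP e) => -[x Dx]; first by exists x.
  have := @graft_stay_right q e; rewrite lq {1}Dx is_left_r pq -Db cNq.
  by move=> /(_ isT isT isT).
move: ce; rewrite Db Dx graft_adj_rl => /andP[/eqP Ex _].
move: Da eq; rewrite Dx Ex; case: (q) => // y q' /= <-.
by rewrite mem_last.
Qed.

Lemma graft_connect i j : connect adj i j.
Proof.
have adjC : symmetric adj by move=> x y; rewrite /adjacent orbC.
have cC : connect_sym adj := sym_connect_sym adjC.
have conn n (G : graph n) a b : connect (adjacent (edges G)) a b.
  by case: G => E /= /and4P[_ _ /forallP/(_ a)/forallP/(_ b)].
have map_conn n (G : graph n) (f : 'I_n -> 'I_(n1 + n2)) a b :
    (forall x y, adjacent (edges G) x y -> adj (f x) (f y)) ->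
    connect adj (f a) (f b).
  move=> hf; have /connectP[p pp ->] := conn _ G a b; apply/connectP.
  by exists (map f p); rewrite ?last_map // (homo_path hf).
have cLL a b : connect adj (L a) (L b).
  by apply: (map_conn _ G1) => x y; rewrite graft_adj_ll.
have cRR a b : connect adj (R a) (R b).
  by apply: (map_conn _ G2) => x y; rewrite graft_adj_rr.
have cLR a b : connect adj (L a) (R b).
  apply: connect_trans (cLL a p1) (connect_trans _ (cRR p2 b)).
  by apply: connect1; rewrite graft_adj_lr !eqxx.
by case: (graft_ordP i) => -[a ->]; case: (graft_ordP j) => -[b ->] //; rewrite cC.
Qed.

Lemma graft_is_graph : is_graph graft_edges.
Proof.
have asym n (G : graph n) a b : (a, b) \in edges G -> (b, a) \notin edges G.
  by case: G => E /= /and4P[_ /forallP/(_ a)/forallP/(_ b)/implyP].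
apply/and4P; split.
- by rewrite addn_gt0 (leq_trans _ (ltn_ord p1)).
- apply/forallP=> i; apply/forallP=> j; apply/implyP; rewrite !inE /=.
  by case: (split i) => a; case: (split j) => b //; apply: asym.
- by apply/forallP=> i; apply/forallP=> j; apply: graft_connect.
- apply/forallP=> k; apply/forallP=> p; apply/implyP=> /graft_acyclic.
  by rewrite size_tuple.
Qed.
End Graft.

Lemma single_is_graph : @is_graph 1 finset.set0.
Proof.
apply/and4P; split=> //.
- by apply/forallP=> a; apply/forallP=> b; rewrite inE.
- by apply/forallP=> a; apply/forallP=> b; rewrite !ord1 connect0.
- apply/forallP=> k; apply/forallP=> p.
  by rewrite (leq_trans (leq_ord k)) ?implybT.
Qed.

Record pgraph (W : Type) : Type := PGraph {
  pg_size : nat;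
  pg_graph : graph pg_size;
  pg_label : {ffun 'I_pg_size -> W};
  pivot : 'I_pg_size
}.

Section GraphOfWord.
Variables (W : nmodType) (d : nat) (v : 'I_d -> W).

Definition single (x : W) : pgraph W :=
  PGraph (Graph single_is_graph) [ffun _ => x] ord0.

(* Disjoint union with the additional edge pivot g -> pivot h; the pivot is
   that of g. *)
Definition graft (g h : pgraph W) : pgraph W :=
  PGraph (Graph (graft_is_graph (pg_graph g) (pg_graph h) (pivot g) (pivot h)))
    [ffun i => match split i with
               | inl a => pg_label g a
               | inr b => pg_label h b
               end]
    (lshift (pg_size h) (pivot g)).

(* Edges between pivots g -> g_1 -> ... -> g_r, with the pivot of g. *)
Fixpoint chain (g : pgraph W) (gs : seq (pgraph W)) : pgraph W :=
  match gs with
  | [::] => g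
  | g1 :: gs' => graft g (chain g1 gs')
  end.

(* The inner chain is psi_1 -> omega -> ... -> omega; it keeps the pivot of
   psi_1, so the outer chain adds psi_1 -> psi_2 -> ... -> psi_l. *)
Fixpoint graph_rec (m : nat) (w : word d) : pgraph W :=
  match m with
  | 0 => single (letter_label v w)
  | m'.+1 =>
      let: (x, k, ys) := decomposition m' w in
      if map (graph_rec m') ys is g :: gs
      then chain (chain g (nseq k (graph_rec m' x))) gs
      else single 0
  end.

Definition graph_of_word (w : word d) : pgraph W := graph_rec (level w) w.
End GraphOfWord.

Definition lgraph_of_pgraph (W : choiceType) (g : pgraph W) : lgraph W :=
  LGraph (pg_graph g) (pg_label g).

Section Families.
Variables (K : fieldType) (V : vectType K) (d : nat) (v : d.-tuple V).

Definition dual_basis (i : 'I_d) : dual_space V := linfun (coord v i : V -> K^o).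

Definition Lyndon_tree (w : word d) : free_lie V :=
  tree_class (lie_of_word (tnth v) w).

Definition Lyndon_graph (w : word d) : cofree_lie (dual_space V) :=
  graph_class (lgraph_of_pgraph (graph_of_word dual_basis w)).
End Families.

(* Main.v *)
(* Every graph is, up to sign, a rooted one whose edges point away from the root.
   Against such a graph the sum over bijections of the configuration pairing
   becomes a recursion on the tree: for [l, r], a signed sum over the edges of the
   graph, whose removal leaves two components to be paired with l and r. This recursion is
   compatible with substituting the level m decompositions of the words in the
   graphs and the trees at once, which reduces duality to a single simple word
   in an alphabet, where it is an explicit count.

   L spans by elimination: modulo antisymmetry and Jacobi, a bracket over an
   alphabet with least letter z is a combination of brackets over the alphabet of
   the L(z^k y_1 ... y_l), k > 0, which has a larger level; the weight bounds the
   level.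

   G spans because the Arnold relation turns rooted graphs into linear chains, that
   is words modulo shuffles, on which the dual of the Dynkin operator, built from
   right-normed brackets, is multiplication by the length. In characteristic 0 an
   element of E killed by all trees thus vanishes, and subtracting its expansion in
   the G kills the pairing with each L, hence with all trees. *)
Require Import Defs.
From HB Require Import structures.
From mathcomp Require Import all_boot all_order all_algebra perm.
From mathcomp Require Import freeg.
From mathcomp Require classical_sets.
From mathcomp Require Import ring zify.

Set Implicit Arguments.
Unset Strict Implicit.
Unset Printing Implicit Defensive.

Import Order.TTheory GRing.Theory.
Local Open Scope ring_scope.

(** * Rooted graphs and their pairing with trees *)

(** A graph on n vertices has n - 1 edges and a tree with n leaves has n - 1 internal vertices. A
    bijection thus contributes only if exactly one edge goes to the root of the tree, namely the
    only edge between the vertices placed left and those placed right. So cuts at one edge suffice,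
    and an inductive type suits graphs: a cut leaves two rooted graphs, and attaching at the roots
    is grafting at the pivots.

    The obstacle for duality is that Lyndon words of different levels, or of one level but with
    different initial letters, are not words over one alphabet. Each word is therefore indexed by
    the list of its iterated initial letters. Words with equal lists are letters of one alphabet;
    words with different lists are unfolded down to the alphabet of the common end of their lists,
    where they do not have the same letters.

    Characteristic 0 enters twice: antisymmetry gives [a, a] = 0 through division by 2, and the
    Dynkin identity is divided by the length of the words. As E may be infinite-dimensional, the
    subtraction is made among words of a fixed length. *)

(* [Attach g h] is the disjoint union of g and h with an edge from the root of
   g, which remains the root, to the root of h; edges thus point away from the
   root. *)
Inductive rooted (X : Type) : Type :=
| Vertex of X
| Attach of rooted X & rooted X.

Section Rooted.
Variable X : Type.
Implicit Types g h : rooted X.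

Fixpoint verts g : seq X :=
  match g with Vertex x => [:: x] | Attach g h => verts g ++ verts h end.

Fixpoint root g : X :=
  match g with Vertex x => x | Attach g _ => root g end.

Fixpoint arcs g : seq (X * X) :=
  match g with
  | Vertex _ => [::]
  | Attach g h => (root g, root h) :: arcs g ++ arcs h
  end.

(* The two components left by the removal of each arc, the one containing the
   root first. *)
Fixpoint cuts g : seq (rooted X * rooted X) :=
  match g with
  | Vertex _ => [::]
  | Attach g h => (g, h) :: [seq (Attach c.1 h, c.2) | c <- cuts g]
                         ++ [seq (Attach g c.1, c.2) | c <- cuts h]
  end.

Lemma size_arcs g : (size (arcs g)).+1 = size (verts g).
Proof.
by elim: g => //= g IHg h IHh; rewrite !size_cat -IHg -IHh addSn addnS.
Qed.

Fixpoint long (x : X) (s : seq X) : rooted X :=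
  if s is y :: s' then Attach (Vertex x) (long y s') else Vertex x.

Fixpoint achain g (gs : seq (rooted X)) : rooted X :=
  match gs with [::] => g | g1 :: gs' => Attach g (achain g1 gs') end.

Lemma achain_vertex x s : achain (Vertex x) (map (@Vertex X) s) = long x s.
Proof. by elim: s x => //= y s IH x; rewrite IH. Qed.

Lemma verts_long x s : verts (long x s) = x :: s.
Proof. by elim: s x => //= y s IH x; rewrite IH. Qed.

Lemma root_long x s : root (long x s) = x.
Proof. by case: s. Qed.
End Rooted.

Section RootedEq.
Variable X : eqType.

Fixpoint gentree_of_rooted (g : rooted X) : GenTree.tree X :=
  match g with
  | Vertex x => GenTree.Leaf x
  | Attach g h => GenTree.Node 0 [:: gentree_of_rooted g; gentree_of_rooted h]
  end.

Fixpoint rooted_of_gentree (t : GenTree.tree X) : option (rooted X) :=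
  match t with
  | GenTree.Leaf x => Some (Vertex x)
  | GenTree.Node _ [:: t; u] =>
      if (rooted_of_gentree t, rooted_of_gentree u) is (Some g, Some h)
      then Some (Attach g h) else None
  | _ => None
  end.

Lemma gentree_of_rootedK : pcancel gentree_of_rooted rooted_of_gentree.
Proof. by elim=> //= g -> h ->. Qed.

HB.instance Definition _ :=
  Equality.copy (rooted X) (pcan_type gentree_of_rootedK).
End RootedEq.

Section RootedMap.
Variables (X Y : Type) (f : X -> Y).

Fixpoint rmap (g : rooted X) : rooted Y :=
  match g with
  | Vertex x => Vertex (f x)
  | Attach g h => Attach (rmap g) (rmap h)
  end.

Lemma verts_rmap g : verts (rmap g) = map f (verts g).
Proof. by elim: g => //= g -> h ->; rewrite map_cat. Qed.

Lemma root_rmap g : root (rmap g) = f (root g).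
Proof. by elim: g. Qed.

Lemma arcs_rmap g : arcs (rmap g) = [seq (f p.1, f p.2) | p <- arcs g].
Proof. by elim: g => //= g -> h ->; rewrite map_cat !root_rmap. Qed.

Lemma cuts_rmap g : cuts (rmap g) = [seq (rmap c.1, rmap c.2) | c <- cuts g].
Proof.
by elim: g => //= g -> h ->; rewrite map_cat -!map_comp.
Qed.

Lemma rmap_long x s : rmap (long x s) = long (f x) (map f s).
Proof. by elim: s x => //= y s IH x; rewrite IH. Qed.

Lemma rmap_achain g gs : rmap (achain g gs) = achain (rmap g) (map rmap gs).
Proof. by elim: gs g => //= h gs IH g; rewrite IH. Qed.
End RootedMap.

Lemma eq_rmap X Y (f1 f2 : X -> Y) : f1 =1 f2 -> rmap f1 =1 rmap f2.
Proof. by move=> ef; elim=> [x|g IHg h IHh] /=; rewrite ?ef // IHg IHh. Qed.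

Lemma rmap_comp X Y Z (f : Y -> Z) (f' : X -> Y) g :
  rmap f (rmap f' g) = rmap (f \o f') g.
Proof. by elim: g => //= g -> h ->. Qed.

Lemma eq_in_rmap (X : eqType) Y (f1 f2 : X -> Y) g :
  {in verts g, f1 =1 f2} -> rmap f1 g = rmap f2 g.
Proof.
elim: g => [x|g IHg h IHh] /= ef; first by rewrite ef ?inE.
rewrite IHg 1?IHh // => x xg; apply: ef; rewrite mem_cat xg ?orbT //.
Qed.

Section Cuts.
Variable X : eqType.
Implicit Types g : rooted X.

Lemma cuts_verts g c : c \in cuts g ->
  perm_eq (verts g) (verts c.1 ++ verts c.2).
Proof.
elim: g c => //= g IHg h IHh c; rewrite inE mem_cat => /or3P[/eqP->//||].
- case/mapP=> c' /IHg/seq.permP pg -> /=; apply/seq.permP=> a.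
  by move: (pg a); rewrite !count_cat; lia.
- by case/mapP=> c' /IHh pg -> /=; rewrite -catA perm_cat2l.
Qed.

Lemma mem_root g : root g \in verts g.
Proof. by elim: g => //= [x|g IHg h _]; rewrite ?inE // mem_cat IHg. Qed.

Lemma cuts_root g c : c \in cuts g -> root c.1 = root g.
Proof.
elim: g c => //= g IHg h _ c; rewrite inE mem_cat => /or3P[/eqP->//||].
- by case/mapP=> c' /IHg <- ->.
- by case/mapP=> c' _ ->.
Qed.

Lemma cuts_arcs g c : c \in cuts g ->
  exists p : X * X, [/\ p.1 \in verts c.1, p.2 \in verts c.2 &
    perm_eq (arcs g) (p :: arcs c.1 ++ arcs c.2)].
Proof.
elim: g c => //= g IHg h IHh c; rewrite inE mem_cat => /or3P[/eqP->/=||].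
- by exists (root g, root h); rewrite !mem_root.
- case/mapP=> c' c'g ->; have [p [p1 p2 /seq.permP pe]] := IHg _ c'g.
  exists p => /=; split; rewrite ?mem_cat ?p1 ?(cuts_root c'g) //.
  apply/seq.permP=> a; move: (pe a); rewrite /= !count_cat /= ?count_cat; lia.
- case/mapP=> c' c'h ->; have [p [p1 p2 /seq.permP pe]] := IHh _ c'h.
  exists p => /=; split; rewrite ?mem_cat ?p1 ?orbT ?(cuts_root c'h) //.
  apply/seq.permP=> a; move: (pe a); rewrite /= !count_cat /= ?count_cat; lia.
Qed.

Lemma arcs_verts g p : p \in arcs g -> (p.1 \in verts g) && (p.2 \in verts g).
Proof.
elim: g => //= g IHg h IHh; rewrite inE !mem_cat => /or3P[/eqP->|/IHg/andP[-> ->]|/IHh/andP[-> ->]] //.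
- by rewrite /= !mem_root orbT.
- by rewrite !orbT.
Qed.

Lemma perm_arcs_verts g p : p \in arcs g -> uniq (verts g) -> p.1 != p.2.
Proof.
elim: g => //= g IHg h IHh; rewrite cat_uniq inE mem_cat => pin /and3P[ug /hasPn gh uh].
case/or3P: pin => [/eqP->/=|/IHg|/IHh]; [|exact|exact].
by apply: contraNneq (gh _ (mem_root h)) => <-; apply: mem_root.
Qed.

Lemma cuts_long x (s : seq X) :
  cuts (long x s) =
  [seq (long x (take i s), long (head x (drop i s)) (behead (drop i s)))
    | i <- iota 0 (size s)].
Proof.
elim: s x => //= y s IH x; congr (_ :: _).
rewrite IH (iotaDl 1 0) -!map_comp /=.
apply/eq_in_map => i; rewrite mem_iota add0n /= => li.
congr (_, long _ _); rewrite /= -!nth0 !nth_drop addn0.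
by apply: set_nth_default.
Qed.
End Cuts.

Section RootedPairing.
Variables (K : pzRingType) (X Y : Type) (b : X -> Y -> K).

(** The arc removed by a cut [c] points from [c.1] to [c.2], whence the plus sign when [c.1] goes to
    the left branch. *)
Fixpoint rpair (g : rooted X) (T : tree Y) : K :=
  match T with
  | Leaf y => if g is Vertex x then b x y else 0
  | Node l r =>
      \sum_(c <- cuts g) (rpair c.1 l * rpair c.2 r - rpair c.2 l * rpair c.1 r)
  end.
End RootedPairing.

Fixpoint tmap X Y (f : X -> Y) (T : tree X) : tree Y :=
  match T with
  | Leaf x => Leaf (f x)
  | Node l r => Node (tmap f l) (tmap f r)
  end.

Lemma leaf_labels_tmap X Y (f : X -> Y) T :
  leaf_labels (tmap f T) = map f (leaf_labels T).
Proof. by elim: T => //= l -> r ->; rewrite map_cat. Qed.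

Lemma rpair_map (K : pzRingType) X Y X' Y' (f : X' -> X) (f' : Y' -> Y)
    (b : X -> Y -> K) g T :
  rpair b (rmap f g) (tmap f' T) = rpair (fun x y => b (f x) (f' y)) g T.
Proof.
elim: T g => [y|l IHl r IHr] g /=; first by case: g.
rewrite cuts_rmap big_map; apply: eq_bigr => c _ /=.
by rewrite !IHl !IHr.
Qed.

Lemma eq_in_rpair (K : pzRingType) (X Y : eqType) (b1 b2 : X -> Y -> K) g T :
  (forall x y, x \in verts g -> y \in leaf_labels T -> b1 x y = b2 x y) ->
  rpair b1 g T = rpair b2 g T.
Proof.
elim: T g => [y|l IHl r IHr] g /= eb.
  by case: g eb => //= x; apply; rewrite inE.
rewrite !big_seq; apply: eq_bigr => c /cuts_verts/perm_mem pc.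
have sub1 x : x \in verts c.1 -> x \in verts g by rewrite pc mem_cat => ->.
have sub2 x : x \in verts c.2 -> x \in verts g by rewrite pc mem_cat orbC => ->.
rewrite !IHl ?IHr // => x y xc yT; apply: eb;
  by rewrite ?mem_cat ?yT ?orbT //; auto.
Qed.

(** A node splits the leaves in two and a cut splits the vertices in two, so by induction only equal
    multisets of letters can pair. Duality of words with different lists of initial letters rests on
    this. *)
Lemma perm_eq_rpair (K : pzRingType) (X : eqType) g (T : tree X) :
  rpair (fun x y => (x == y)%:R : K) g T != 0 ->
  perm_eq (verts g) (leaf_labels T).
Proof.
have nzM (x y : K) : x * y != 0 -> x != 0 /\ y != 0.
  move=> xy; split; first by apply: contraNneq xy => ->; rewrite mul0r.
  by apply: contraNneq xy => ->; rewrite mulr0.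
elim: T g => [y|l IHl r IHr] g /=.
  by case: g => [x|g h]; rewrite ?eqxx //=; case: (x =P y) => [->|]; rewrite ?eqxx.
set P := rpair _ in IHl IHr *.
have [/hasP[c cg Fc] _|/hasPn F0] := boolP (has
    (fun c => P c.1 l * P c.2 r - P c.2 l * P c.1 r != 0) (cuts g)); last first.
  by rewrite big_seq big1 ?eqxx // => c /F0; rewrite negbK => /eqP.
rewrite (perm_trans (cuts_verts cg)) //.
have [z|/nzM[n1 n2]] := eqVneq (P c.1 l * P c.2 r) 0; last first.
  by apply: perm_cat; [apply: IHl|apply: IHr].
move: Fc; rewrite z sub0r oppr_eq0 => /nzM[n1 n2].
by rewrite perm_catC; apply: perm_cat; [apply: IHl|apply: IHr].
Qed.

(** * Permutations of leaves *)

Section Separation.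
Variable X : eqType.
Implicit Types (g : rooted X) (B : pred X).

Definition ncross B g := count (fun p => B p.1 != B p.2) (arcs g).

Definition separates B (g1 g2 : rooted X) :=
  all B (verts g1) && all (predC B) (verts g2).

Lemma ncross_attach B g h :
  ncross B (Attach g h)
  = ((B (root g) != B (root h)) + (ncross B g + ncross B h))%N.
Proof. by rewrite /ncross /= count_cat. Qed.

(** A rooted graph is connected, so a predicate that no arc crosses is constant on its vertices. *)
Lemma all_ncross B g : all B (verts g) = (ncross B g == 0%N) && B (root g).
Proof.
elim: g => [x|g IHg h IHh]; first by rewrite /= andbT.
by rewrite ncross_attach /= all_cat IHg IHh; case: (B (root g)); case: (B (root h)) => /=;
  rewrite ?andbT ?andbF ?add0n ?addn_eq0.
Qed.

Lemma ncrossC B g : ncross (predC B) g = ncross B g.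
Proof. by apply: eq_count => p /=; case: (B p.1); case: (B p.2). Qed.

(** Removing an arc separates B from its complement exactly when this arc is the only crossing one;
    B is then the side of the root, which [c.1] contains. *)
Lemma sum_separates B g :
  (\sum_(c <- cuts g) separates B c.1 c.2)%N
  = (ncross B g == 1%N) && B (root g).
Proof.
elim: g => [x|g IHg h IHh] /=; first by rewrite big_nil.
rewrite big_cons big_cat !big_map /=.
have -> : (\sum_(c <- cuts g) separates B (Attach c.1 h) c.2 =
    (\sum_(c <- cuts g) separates B c.1 c.2) * all B (verts h))%N.
  rewrite big_distrl /=; apply: eq_bigr => c _.
  by rewrite /separates /= all_cat mulnb andbAC.
have -> : (\sum_(c <- cuts h) separates B (Attach g c.1) c.2 =
    all B (verts g) * (\sum_(c <- cuts h) separates B c.1 c.2))%N.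
  rewrite big_distrr /=; apply: eq_bigr => c _.
  by rewrite /separates /= all_cat mulnb andbA.
rewrite IHg IHh /separates ncross_attach !all_ncross ncrossC /=.
by case: (B (root g)); case: (B (root h)); case: (ncross B g) => [|[|?]];
  case: (ncross B h) => [|[|?]].
Qed.

(** Arcs point away from the root, so a single crossing arc leaves the side of the root. *)
Lemma count_forward B g : ncross B g = 1%N ->
  count (fun p => B p.1 && ~~ B p.2) (arcs g) = B (root g).
Proof.
have le g' : (count (fun p => B p.1 && ~~ B p.2) (arcs g') <= ncross B g')%N.
  by apply: sub_count => p /=; case: (B p.1); case: (B p.2).
elim: g => [//|g IHg h IHh]; rewrite ncross_attach /= count_cat.
move: (le g) (le h) IHg IHh.
case: (B (root g)); case: (B (root h)); case: (ncross B g) => [|[|?]];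
  case: (ncross B h) => [|[|?]] //=; rewrite ?leqn0 => lg lh Hg Hh _;
  by rewrite ?(eqP lg) ?(eqP lh) ?Hg ?Hh.
Qed.
End Separation.

Section CrossSign.
Variables (K : pzRingType) (X : eqType).
Implicit Types (E : seq (X * X)) (t : seq X) (g : rooted X).

(* The sign of the only arc of E between t1 and t2, or 0 if there is no such
   arc or more than one. *)
Definition cross_sign E t1 t2 : K :=
  let f := count (fun p => (p.1 \in t1) && (p.2 \in t2)) E in
  let b := count (fun p => (p.1 \in t2) && (p.2 \in t1)) E in
  if (f + b == 1)%N then f%:R - b%:R else 0.

(** If exactly one arc joins [t1] and [t2], the cut at it is the only one with these components, and
    the direction of the arc tells which of them has the root; otherwise no cut has these
    components. *)
Lemma cross_sign_cuts g t1 t2 :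
  uniq (verts g) -> perm_eq (t1 ++ t2) (verts g) ->
  cross_sign (arcs g) t1 t2 =
  \sum_(c <- cuts g)
    ((perm_eq t1 (verts c.1) && perm_eq t2 (verts c.2))%:R
     - (perm_eq t1 (verts c.2) && perm_eq t2 (verts c.1))%:R).
Proof.
move=> ug pt; have memt := perm_mem pt.
have ut : uniq (t1 ++ t2) by rewrite (perm_uniq pt).
have /and3P[u1 /hasPn d12 u2] : [&& uniq t1, ~~ has (mem t1) t2 & uniq t2].
  by rewrite -cat_uniq.
pose B := mem t1 : pred X.
have nB x : x \in verts g -> (x \in t2) = ~~ B x.
  rewrite -memt mem_cat /B /=; case: (boolP (x \in t1)) => //= xt1 _.
  by apply/negbTE; apply: contraL xt1 => /d12.
have sepE g1 g2 : perm_eq (verts g) (verts g1 ++ verts g2) ->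
    perm_eq t1 (verts g1) && perm_eq t2 (verts g2) = separates B g1 g2.
  move=> pc; have memc := perm_mem pc.
  have /and3P[v1 /hasPn d v2] :
      [&& uniq (verts g1), ~~ has (mem (verts g1)) (verts g2) & uniq (verts g2)].
    by rewrite -cat_uniq -(perm_uniq pc).
  apply/andP/andP=> [[p1 p2]|[/allP a1 /allP a2]].
    split; apply/allP=> x; rewrite -?(perm_mem p1) // -(perm_mem p2) => xt2.
    by rewrite /= -nB // -memt mem_cat xt2 orbT.
  have E x : x \in verts g -> (x \in verts g1) = B x.
    rewrite memc mem_cat => /orP[x1|x2]; first by rewrite x1 a1.
    by rewrite (negbTE (a2 _ x2)); apply/negbTE/(d _ x2).
  split; apply: uniq_perm => // x.
    apply/idP/idP => [xt|xg]; last by apply: a1.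
    by rewrite E // -memt mem_cat xt.
  apply/idP/idP => [xt|xg].
    have xg : x \in verts g by rewrite -memt mem_cat xt orbT.
    by move: (xg); rewrite memc mem_cat E // -[B x]negbK -nB // xt.
  by rewrite nB; [apply: a2|rewrite memc mem_cat xg orbT].
have cntE (P P' : pred (X * X)) : {in arcs g, P =1 P'} ->
    count P (arcs g) = count P' (arcs g) by apply: eq_in_count.
rewrite /cross_sign.
rewrite (cntE _ (fun p => B p.1 && ~~ B p.2)); last first.
  by move=> p /arcs_verts/andP[_ p2] /=; rewrite nB.
rewrite (cntE (fun p => (p.1 \in t2) && _) (fun p => predC B p.1 && ~~ predC B p.2)); last first.
  by move=> p /arcs_verts/andP[p1 _] /=; rewrite nB // negbK.
have cr : ncross B g = (count (fun p => B p.1 && ~~ B p.2) (arcs g) +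
   count (fun p => predC B p.1 && ~~ predC B p.2) (arcs g))%N.
  rewrite /ncross -count_predUI [X in (_ = _ + X)%N](@eq_count _ _ pred0); last first.
    by move=> p /=; case: (B p.1); case: (B p.2).
  by rewrite count_pred0 addn0; apply: eq_count => p /=; case: (B p.1); case: (B p.2).
rewrite -cr big_split /= sumrN.
have natsum (F : rooted X * rooted X -> bool) : \sum_(c <- cuts g) (F c)%:R =
   (\sum_(c <- cuts g) F c)%N%:R :> K by rewrite natr_sum.
rewrite !natsum.
have -> : (\sum_(c <- cuts g) (perm_eq t1 (verts c.1) && perm_eq t2 (verts c.2)) =
   (ncross B g == 1%N) && B (root g))%N.
  by rewrite -sum_separates !big_seq; apply: eq_bigr => c /cuts_verts/sepE ->.
have -> : (\sum_(c <- cuts g) (perm_eq t1 (verts c.2) && perm_eq t2 (verts c.1)) =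
   (ncross B g == 1%N) && ~~ B (root g))%N.
  transitivity (\sum_(c <- cuts g) separates (predC B) c.1 c.2)%N; last first.
    by rewrite sum_separates ncrossC.
  rewrite !big_seq; apply: eq_bigr => c /cuts_verts pc.
  rewrite sepE; last by rewrite (perm_trans pc) // perm_catC.
  rewrite /separates andbC.
  by congr (nat_of_bool (_ && _)); apply: eq_all => x /=; rewrite negbK.
case: eqP => [cr1|_]; last by rewrite /= subrr.
rewrite (count_forward cr1) (@count_forward _ (predC B)) ?ncrossC //.
Qed.
End CrossSign.

Section OrderPairing.
Variables (K : comPzRingType) (X : eqType) (Y : Type) (b : X -> Y -> K).
Implicit Types (E : seq (X * X)) (t : seq X) (T : tree Y) (g : rooted X).

(* The contribution of the bijection sending the i-th vertex of t to the i-th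
   leaf of T. *)
Fixpoint order_pair E t T : K :=
  match T with
  | Leaf y => if t is [:: a] then b a y else 0
  | Node l r =>
      let t1 := take (nleaves l) t in let t2 := drop (nleaves l) t in
      cross_sign K E t1 t2 * (order_pair E t1 l * order_pair E t2 r)
  end.

Definition within t (p : X * X) := (p.1 \in t) && (p.2 \in t).

(** The recursion carries all of [E] along; this allows replacing it by the arcs of one component of
    a cut. *)
Lemma order_pair_local E E' t T :
  perm_eq (filter (within t) E) (filter (within t) E') ->
  order_pair E t T = order_pair E' t T.
Proof.
elim: T E E' t => [//|l IHl r IHr] E E' t pE /=.
set t1 := take _ _; set t2 := drop _ _.
have s1 x : x \in t1 -> x \in t by apply: mem_take.
have s2 x : x \in t2 -> x \in t by apply: mem_drop.
have filE t' : {subset t' <= t} -> perm_eq (filter (within t') E) (filter (within t') E').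
  move=> st; have fE F : filter (within t') F = filter (within t') (filter (within t) F).
    rewrite -filter_predI; apply: eq_filter => p /=; rewrite /within.
    by apply/idP/idP => [/andP[a1 a2]|/andP[]//]; rewrite a1 a2 !st.
  by rewrite (fE E) (fE E'); apply: perm_filter.
have cntE (a : pred (X * X)) : (forall p, a p -> within t p) -> count a E = count a E'.
  move=> st; have cE F : count a F = count a (filter (within t) F).
    rewrite count_filter; apply: eq_count => p /=.
    by apply/idP/idP => [ap|/andP[]//]; rewrite ap st.
  by rewrite (cE E) (cE E'); apply/seq.permP.
rewrite /cross_sign !(IHl E E' t1, IHr E E' t2) ?filE // !(cntE (fun p => _)) // => p;
  by rewrite /within => /andP[a1 a2]; rewrite ?(s1 _ a1) ?(s1 _ a2) ?(s2 _ a1) ?(s2 _ a2).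
Qed.

Lemma order_pair_size E t T : order_pair E t T != 0 -> size t = nleaves T.
Proof.
elim: T t => [y|l IHl r IHr] t /=; first by case: t => [|a [|? ?]]; rewrite ?eqxx.
have [-> | /IHl s1] := eqVneq (order_pair E (take (nleaves l) t) l) 0.
  by rewrite mul0r mulr0 eqxx.
have [-> | /IHr s2] := eqVneq (order_pair E (drop (nleaves l) t) r) 0.
  by rewrite !mulr0 eqxx.
rewrite -(cat_take_drop (nleaves l) t) size_cat s1 s2 => _.
by rewrite /nleaves /= size_cat !size_map.
Qed.

(** Orderings of s whose first k entries exhaust s1 are pairs of an ordering of s1 and one of s2. If
    s1 does not have k entries, both sides vanish by the assumption on F. *)
Lemma sum_split_permutations (s s1 s2 : seq X) (F G : seq X -> K) k :
  uniq s -> perm_eq s (s1 ++ s2) -> (forall t, size t != k -> F t = 0) ->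
  \sum_(t <- permutations s)
    (perm_eq (take k t) s1 && perm_eq (drop k t) s2)%:R * (F (take k t) * G (drop k t))
  = (\sum_(t <- permutations s1) F t) * (\sum_(t <- permutations s2) G t).
Proof.
move=> us ps F0; have [k1|nk1] := eqVneq (size s1) k; last first.
  rewrite [RHS](_ : _ = 0); last first.
    rewrite big_seq big1 ?mul0r // => t; rewrite mem_permutations => /perm_size st.
    by rewrite F0 // st.
  apply: big1 => t _; case: (boolP (perm_eq (take k t) s1)) => [/perm_size st|_] /=.
    by rewrite F0 ?mul0r ?mulr0 // st.
  by rewrite mul0r.
rewrite big_distrlr /=.
rewrite (eq_bigr (fun t => if perm_eq (take k t) s1 && perm_eq (drop k t) s2
   then F (take k t) * G (drop k t) else 0)); last first.
  by move=> t _; case: ifP; rewrite ?mul1r ?mul0r.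
rewrite -big_mkcond -big_filter /=.
transitivity (\sum_(t <- [seq u ++ v | u <- permutations s1, v <- permutations s2])
    F (take k t) * G (drop k t)); last first.
  rewrite big_allpairs_dep /= !big_seq; apply: eq_bigr => u; rewrite mem_permutations => pu.
  by apply: eq_bigr => v _; rewrite take_size_cat ?drop_size_cat // (perm_size pu).
apply: perm_big; apply: uniq_perm.
- by rewrite filter_uniq // permutations_uniq.
- apply: allpairs_uniq; rewrite ?permutations_uniq // => -[u v] [u' v'] /=.
  move=> /allpairsP[[? ?] /= [pu pv [-> ->]]] /allpairsP[[? ?] /= [pu' pv' [-> ->]]].
  move: pu pu'; rewrite !mem_permutations => /perm_size su /perm_size su' /eqP.
  by rewrite eqseq_cat ?su ?su' // => /andP[/eqP-> /eqP->].
- move=> t; rewrite mem_filter mem_permutations; apply/andP/allpairsP.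
    case=> /andP[p1 p2] pt; exists (take k t, drop k t) => /=.
    by rewrite !mem_permutations p1 p2 cat_take_drop.
  case=> -[u v] /= [pu pv ->]; move: pu pv; rewrite !mem_permutations => pu pv.
  rewrite take_size_cat ?drop_size_cat ?(perm_size pu) // pu pv.
  by rewrite (perm_trans (perm_cat pu pv)) // perm_sym.
Qed.

(** For each ordering, [cross_sign_cuts] turns the sign at the root of the tree into a sum over
    cuts. After exchanging the two sums, the orderings compatible with a given cut are pairs of
    orderings of its components. *)
Lemma sum_order_pair g T : uniq (verts g) ->
  \sum_(t <- permutations (verts g)) order_pair (arcs g) t T = rpair b g T.
Proof.
elim: T g => [y|l IHl r IHr] g ug.
  case: g ug => [x|g h] _.
    have px : permutations [:: x] = [:: [:: x]] by [].
    by rewrite /= px big_seq1.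
  rewrite /= big_seq big1 // => t; rewrite mem_permutations => /perm_size.
  rewrite /= size_cat -!size_arcs addSn addnS.
  by case: t => [|? [|? ?]].
rewrite /=; set k := nleaves l.
have F0 E t : size t != k -> order_pair E t l = 0.
  by apply: contraNeq => /order_pair_size ->.
pose F t := order_pair (arcs g) t l; pose G t := order_pair (arcs g) t r.
transitivity (\sum_(c <- cuts g) \sum_(t <- permutations (verts g))
   (((perm_eq (take k t) (verts c.1) && perm_eq (drop k t) (verts c.2))%:R
     - (perm_eq (take k t) (verts c.2) && perm_eq (drop k t) (verts c.1))%:R)
      * (F (take k t) * G (drop k t)))).
  rewrite exchange_big /= !big_seq; apply: eq_bigr => t; rewrite mem_permutations => pt.
  by rewrite cross_sign_cuts ?cat_take_drop // big_distrl.
rewrite !big_seq; apply: eq_bigr => c cg.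
have pc := cuts_verts cg.
have pc' : perm_eq (verts g) (verts c.2 ++ verts c.1) by rewrite (perm_trans pc) // perm_catC.
under eq_bigr do rewrite mulrBl.
rewrite sumrB /= !(sum_split_permutations _ _ pc) ?(sum_split_permutations _ _ pc') //;
  try exact: F0.
have /and3P[u1 /hasPn d u2] :
    [&& uniq (verts c.1), ~~ has (mem (verts c.1)) (verts c.2) & uniq (verts c.2)].
  by rewrite -cat_uniq -(perm_uniq pc).
have dd x : x \in verts c.2 -> x \notin verts c.1 by move=> /d.
have d' x : x \in verts c.1 -> x \notin verts c.2 by apply: contraL => /d.
have [p [p1 p2 pa]] := cuts_arcs cg.
(* An ordering of one component sees neither the cut arc, which has only one end there, nor the arcs
   of the other component. *)
have sub (c1 c2 : rooted X) t : perm_eq t (verts c1) ->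
    {in verts c2, forall x, x \notin verts c1} -> ~~ within t p ->
    perm_eq (arcs g) (p :: arcs c1 ++ arcs c2) ->
    forall T, order_pair (arcs g) t T = order_pair (arcs c1) t T.
  move=> pt dc wp pg T; apply: order_pair_local; apply: perm_trans (perm_filter _ pg) _.
  rewrite /= (negbTE wp) filter_cat [X in _ ++ X](_ : _ = [::]) ?cats0 //.
  apply/eqP; rewrite -size_eq0 size_filter -leqn0 leqNgt -has_count; apply/hasPn => q.
  by case/arcs_verts/andP=> /dc q1 _; rewrite /within (perm_mem pt) (negbTE q1).
have pa' : perm_eq (arcs g) (p :: arcs c.2 ++ arcs c.1).
  by apply: perm_trans pa _; rewrite perm_cons perm_catC.
have op1 T t : perm_eq t (verts c.1) -> order_pair (arcs g) t T = order_pair (arcs c.1) t T.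
  by move=> pt; apply: (sub c.1 c.2) => //; rewrite /within !(perm_mem pt) (negbTE (dd _ p2)) andbF.
have op2 T t : perm_eq t (verts c.2) -> order_pair (arcs g) t T = order_pair (arcs c.2) t T.
  by move=> pt; apply: (sub c.2 c.1) => //; rewrite /within !(perm_mem pt) (negbTE (d' _ p1)).
have sum1 T : \sum_(t <- permutations (verts c.1)) order_pair (arcs g) t T =
   \sum_(t <- permutations (verts c.1)) order_pair (arcs c.1) t T.
  by rewrite !big_seq; apply: eq_bigr => t; rewrite mem_permutations => /op1.
have sum2 T : \sum_(t <- permutations (verts c.2)) order_pair (arcs g) t T =
   \sum_(t <- permutations (verts c.2)) order_pair (arcs c.2) t T.
  by rewrite !big_seq; apply: eq_bigr => t; rewrite mem_permutations => /op2.
by rewrite /F /G !sum1 !sum2 -!IHl // -!IHr.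
Qed.
End OrderPairing.

(** * Internal vertices reached by an ordering of the vertices *)

Lemma size_internal_addresses W (T : tree W) :
  (size (internal_addresses T)).+1 = nleaves T.
Proof.
elim: T => //= l IHl r IHr.
by move: IHl IHr; rewrite /nleaves !size_cat !size_map => <- <-; rewrite addSn addnS.
Qed.

Lemma uniq_internal_addresses W (T : tree W) : uniq (internal_addresses T).
Proof.
elim: T => //= l IHl r IHr.
have ci (c : bool) : injective (cons c) by move=> p q [].
rewrite cat_uniq !map_inj_uniq // IHl IHr andbT mem_cat negb_or /=.
apply/andP; split; first by apply/andP; split; apply/mapP=> -[].
by apply/hasPn => _ /mapP[p _ ->]; apply/mapP=> -[].
Qed.

Lemma size_leaf_labels W (T : tree W) : size (leaf_labels T) = nleaves T.
Proof. by elim: T => //= l IHl r IHr; rewrite /nleaves /= !size_cat !size_map IHl IHr. Qed.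

Section ShapeOfOrder.
Variables (K : comPzRingType) (X : eqType) (Y : Type).
Implicit Types (E : seq (X * X)) (t : seq X) (T : tree Y).

Definition order_beta t T (e : X * X) : seq bool :=
  common_prefix (nth [::] (leaf_addresses T) (index e.1 t))
                (nth [::] (leaf_addresses T) (index e.2 t)).

Definition order_sign t (e : X * X) : K :=
  if (index e.1 t < index e.2 t)%N then 1 else -1.

(* [shape_pairing] for the bijection sending the i-th vertex of t to the i-th
   leaf of T. *)
Definition order_shape E t T : K :=
  if all (fun p => has (fun e => order_beta t T e == p) E) (internal_addresses T)
  then \prod_(e <- E) order_sign t e else 0.

Lemma order_shape_size E t T :
  order_shape E t T != 0 -> (nleaves T <= (size E).+1)%N.
Proof.
rewrite /order_shape; case: ifP => [/allP hit _|_]; last by rewrite eqxx.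
rewrite -size_internal_addresses ltnS -(size_map (order_beta t T)).
apply: uniq_leq_size; first exact: uniq_internal_addresses.
by move=> p /hit/hasP[e eE /eqP <-]; apply: map_f.
Qed.

Definition one_pair := order_pair (fun (_ : X) (_ : Y) => 1 : K).

Lemma size_within_cat E t1 t2 : uniq (t1 ++ t2) ->
  size (filter (within (t1 ++ t2)) E) =
  (count (fun p => (p.1 \in t1) && (p.2 \in t2)) E
   + count (fun p => (p.1 \in t2) && (p.2 \in t1)) E
   + (size (filter (within t1) E) + size (filter (within t2) E)))%N.
Proof.
rewrite cat_uniq => /and3P[_ /hasPn d _].
have d12 x : x \in t1 -> x \in t2 = false by move=> x1; apply: contraTF x1 => /d.
rewrite !size_filter; elim: E => //= e E ->; rewrite /within !mem_cat.
case: (boolP (e.1 \in t1)) => [/d12 ->|_]; case: (boolP (e.2 \in t1)) => [/d12 ->|_] /=;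
  case: (e.1 \in t2); case: (e.2 \in t2) => /=; lia.
Qed.

(** Each node contributes exactly one arc between its two branches, so there are as many arcs within
    [t] as internal vertices. *)
Lemma one_pair_size E t T : {in E, forall e, e.1 != e.2} -> uniq t ->
  one_pair E t T != 0 -> (size (filter (within t) E)).+1 = size t.
Proof.
move=> loopless; elim: T t => [y|l IHl r IHr] t ut.
  case: t ut => [|a [|? ?]] //=; rewrite /one_pair /= ?eqxx // => _ _.
  congr _.+1; apply/eqP; rewrite size_filter -leqn0 leqNgt -has_count; apply/hasPn=> e.
  move/loopless; rewrite /within !inE; apply: contra => /andP[/eqP-> /eqP->].
  by rewrite eqxx.
rewrite /one_pair /= -!/(one_pair _ _ _); have Dt := cat_take_drop (nleaves l) t.
move: (take _ t) (drop _ t) Dt => t1 t2 Dt; subst t.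
have [u1 u2] : uniq t1 /\ uniq t2 by move: ut; rewrite cat_uniq => /and3P[].
rewrite size_within_cat // size_cat /cross_sign.
have [->|/(IHl _ u1) <-] := eqVneq (one_pair E t1 l) 0.
  by rewrite mul0r mulr0 eqxx.
have [->|/(IHr _ u2) <-] := eqVneq (one_pair E t2 r) 0.
  by rewrite !mulr0 eqxx.
case: ifP => [/eqP-> _|_]; first by rewrite add1n addSn addnS.
by rewrite mul0r eqxx.
Qed.

Lemma order_pairE (b : X -> Y -> K) E t T : size t = nleaves T ->
  order_pair b E t T = one_pair E t T * \prod_(p <- zip t (leaf_labels T)) b p.1 p.2.
Proof.
elim: T t => [y|l IHl r IHr] t st /=.
  by case: t st => [|a [|? ?]] //= _; rewrite /one_pair /= big_seq1 mul1r.
rewrite {1}/nleaves /= size_cat !size_map -/(nleaves l) -/(nleaves r) in st.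
have s1 : size (take (nleaves l) t) = nleaves l by rewrite size_take st; case: ltnP; lia.
have s2 : size (drop (nleaves l) t) = nleaves r by rewrite size_drop st; lia.
rewrite IHl // IHr // /one_pair /=.
have -> : zip t (leaf_labels l ++ leaf_labels r) =
    zip (take (nleaves l) t) (leaf_labels l) ++ zip (drop (nleaves l) t) (leaf_labels r).
  by rewrite -zip_cat ?size_leaf_labels // cat_take_drop.
by rewrite big_cat /=; ring.
Qed.

Section Node.
Variables (E : seq (X * X)) (t1 t2 : seq X) (l r : tree Y).
Hypothesis ut : uniq (t1 ++ t2).
Hypothesis wE : {in E, forall e, within (t1 ++ t2) e}.
Hypothesis (s1 : size t1 = nleaves l) (s2 : size t2 = nleaves r).
Let t := t1 ++ t2.
Let crossing e := ~~ within t1 e && ~~ within t2 e.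

Let t12 x : x \in t1 -> x \in t2 = false.
Proof.
move=> x1; apply/negbTE/negP=> x2; move: ut; rewrite cat_uniq => /and3P[_ /hasPn/(_ x x2)].
by rewrite /= x1.
Qed.

Let a1 x : x \in t1 ->
  nth [::] (leaf_addresses (Node l r)) (index x t)
  = false :: nth [::] (leaf_addresses l) (index x t1).
Proof.
move=> xt; have ix : (index x t1 < size (leaf_addresses l))%N.
  by rewrite -/(nleaves l) -s1 index_mem.
by rewrite index_cat xt /= nth_cat size_map ix (nth_map [::]).
Qed.

Let a2 x : x \in t2 ->
  nth [::] (leaf_addresses (Node l r)) (index x t)
  = true :: nth [::] (leaf_addresses r) (index x t2).
Proof.
move=> xt; have ix : (index x t2 < size (leaf_addresses r))%N.
  by rewrite -/(nleaves r) -s2 index_mem.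
have xt1 : x \in t1 = false by apply: contraTF xt => /t12 ->.
rewrite index_cat xt1 /= nth_cat size_map s1 ltnNge leq_addr /=.
by rewrite addKn (nth_map [::]).
Qed.

Let inE e : e \in E -> [|| within t1 e, within t2 e | crossing e].
Proof. by rewrite /crossing; case: within; case: within. Qed.

Let crossP e : e \in E -> crossing e ->
  (e.1 \in t1) && (e.2 \in t2) \/ (e.1 \in t2) && (e.2 \in t1).
Proof.
move=> /wE; rewrite /crossing /within !mem_cat.
move: (@t12 e.1) (@t12 e.2).
case: (e.1 \in t1) => [/(_ isT)->|_]; case: (e.2 \in t1) => [/(_ isT)->|_];
  try case: (e.1 \in t2); try case: (e.2 \in t2); by [left|right].
Qed.

Let beta1 e : within t1 e -> order_beta t (Node l r) e = false :: order_beta t1 l e.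
Proof. by case/andP=> e1 e2; rewrite /order_beta !a1. Qed.

Let beta2 e : within t2 e -> order_beta t (Node l r) e = true :: order_beta t2 r e.
Proof. by case/andP=> e1 e2; rewrite /order_beta !a2. Qed.

Let beta0 e : e \in E -> crossing e -> order_beta t (Node l r) e = [::].
Proof.
move=> eE ce; rewrite /order_beta.
by case: (crossP eE ce) => /andP[e1 e2]; rewrite ?(a1 e1) ?(a1 e2) ?(a2 e1) ?(a2 e2).
Qed.

Let w12 e : within t1 e -> within t2 e = false.
Proof. by rewrite /within => /andP[/t12 ->]. Qed.

(** The root of the tree is reached exactly by the arcs between [t1] and [t2], and the internal
    vertices of a branch only by arcs within its side. *)
Lemma order_shape_node :
  order_shape E (t1 ++ t2) (Node l r)
  = (if has crossing E then \prod_(e <- E | crossing e) order_sign (t1 ++ t2) e else 0)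
    * (order_shape (filter (within t1) E) t1 l * order_shape (filter (within t2) E) t2 r).
Proof.
have has_fil (T : Type) (a b : pred T) s : has a (filter b s) = has (predI b a) s.
  by elim: s => //= x s <-; case: (b x).
rewrite /order_shape /= all_cat !all_map.
have -> : has (fun e => order_beta (t1 ++ t2) (Node l r) e == [::]) E = has crossing E.
  apply: eq_in_has => e eE; case/or3P: (inE eE) => [w|w|c]; last by rewrite beta0 ?c.
    by rewrite beta1 // /crossing w.
  by rewrite beta2 // /crossing w andbF.
have -> : all (preim (cons false) (fun p => has (fun e =>
    order_beta (t1 ++ t2) (Node l r) e == p) E)) (internal_addresses l)
    = all (fun p => has (fun e => order_beta t1 l e == p) (filter (within t1) E))
       (internal_addresses l).
  apply: eq_all => p /=; rewrite has_fil; apply: eq_in_has => e eE /=.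
  case/or3P: (inE eE) => [w|w|c]; first by rewrite beta1 // w.
    by rewrite beta2 //; case: (boolP (within t1 e)) => [/w12|//]; rewrite w.
  by rewrite beta0 //; case/andP: c => /negbTE->.
have -> : all (preim (cons true) (fun p => has (fun e =>
    order_beta (t1 ++ t2) (Node l r) e == p) E)) (internal_addresses r)
    = all (fun p => has (fun e => order_beta t2 r e == p) (filter (within t2) E))
       (internal_addresses r).
  apply: eq_all => p /=; rewrite has_fil; apply: eq_in_has => e eE /=.
  case/or3P: (inE eE) => [w|w|c]; first by rewrite beta1 // w12.
    by rewrite beta2 // w.
  by rewrite beta0 //; case/andP: c => _ /negbTE->.
case: (has crossing E); last by rewrite mul0r.
case: all => /=; last by rewrite mul0r mulr0.
case: all => /=; last by rewrite !mulr0.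
rewrite (bigID crossing) /=; congr (_ * _); rewrite !big_filter.
rewrite (bigID (within t1)) /=; congr (_ * _); rewrite big_seq_cond [RHS]big_seq_cond.
  apply: eq_big => e; first by rewrite /crossing; case: (within t1 e); rewrite ?andbF ?andbT.
  by case/andP=> _ /andP[_ /andP[e1 e2]]; rewrite /order_sign !index_cat e1 e2.
apply: eq_big => e.
  rewrite /crossing negb_and !negbK; case: (boolP (within t1 e)) => [/w12->|_] //=;
   by rewrite ?andbF ?andbT.
case/andP=> _ /andP[c n1].
have {c} /andP[e1 e2] : within t2 e by move: c; rewrite /crossing n1 negbK.
have n x : x \in t2 -> x \in t1 = false by move=> xt; apply: contraTF xt => /t12 ->.
by rewrite /order_sign !index_cat !n // ltn_add2l.
Qed.

Lemma prod_crossing_sign :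
  \prod_(e <- E | crossing e) order_sign (t1 ++ t2) e
  = (-1) ^+ count (fun p => (p.1 \in t2) && (p.2 \in t1)) E.
Proof.
rewrite -sum1_count -prodrXr big_mkcond [RHS]big_mkcond !big_seq.
apply: eq_bigr => e eE.
have n x : x \in t2 -> x \in t1 = false by move=> xt; apply: contraTF xt => /t12 ->.
case: ifP => [c|].
  rewrite /order_sign !index_cat; case: (crossP eE c) => /andP[e1 e2].
    by rewrite e1 (n _ e2) (t12 e1) ltn_addr // index_mem.
  by rewrite (n _ e1) e1 e2 ltnNge ltnW ?expr1 // ltn_addr // index_mem.
case: (boolP (_ && _)) => // /andP[e1 e2].
by rewrite /crossing /within (n _ e1) (t12 e2) !andbF.
Qed.
End Node.

Lemma has_crossing E t1 t2 : uniq (t1 ++ t2) ->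
  {in E, forall e, within (t1 ++ t2) e} ->
  has (fun e => ~~ within t1 e && ~~ within t2 e) E =
  (0 < count (fun p => (p.1 \in t1) && (p.2 \in t2)) E
      + count (fun p => (p.1 \in t2) && (p.2 \in t1)) E)%N.
Proof.
rewrite cat_uniq => /and3P[_ /hasPn d _] wE.
have d12 x : x \in t1 -> x \in t2 = false by move=> x1; apply: contraTF x1 => /d.
elim: E wE => //= e E IH wE.
rewrite IH => [|e' e'E]; last by apply: wE; rewrite inE e'E orbT.
have := wE e; rewrite inE eqxx /within !mem_cat => /(_ isT).
case: (boolP (e.1 \in t1)) => [/d12 ->|_]; case: (boolP (e.2 \in t1)) => [/d12 ->|_] /=;
  case: (e.1 \in t2); case: (e.2 \in t2) => //= _; rewrite ?addnS //.
Qed.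

(** [order_shape] tolerates several arcs at one internal vertex, [one_pair] does not. With one arc
    fewer than leaves there is no room for that: a surjection from the arcs to the internal vertices
    is bijective. *)
Lemma order_shapeE E t T :
  uniq t -> {in E, forall e, within t e && (e.1 != e.2)} ->
  size t = nleaves T -> (size E).+1 = size t ->
  order_shape E t T = one_pair E t T.
Proof.
elim: T E t => [y|l IHl r IHr] E t ut wE st sE.
  move: sE; rewrite st => -[/size0nil ->]; rewrite /order_shape /= big_nil /one_pair /=.
  by case: t st {ut wE} => [|? [|? ?]].
rewrite {1}/nleaves /= size_cat !size_map -/(nleaves l) -/(nleaves r) in st.
rewrite /one_pair /= -!/(one_pair _ _ _); have s1 : size (take (nleaves l) t) = nleaves l by rewrite size_take st; case: ltnP; lia.
have s2 : size (drop (nleaves l) t) = nleaves r by rewrite size_drop st; lia.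
have Dt := cat_take_drop (nleaves l) t.
move: (take _ t) (drop _ t) Dt s1 s2 => t1 t2 Dt s1 s2; subst t.
have wE' : {in E, forall e, within (t1 ++ t2) e} by move=> e /wE/andP[].
have lE : {in E, forall e, e.1 != e.2} by move=> e /wE/andP[].
rewrite order_shape_node // prod_crossing_sign // has_crossing // /cross_sign.
have := size_within_cat E ut; rewrite (_ : filter (within (t1 ++ t2)) E = E); last first.
  exact/all_filterP/allP.
set f := count _ _; set b := count _ _; set E1 := filter (within t1) E; set E2 := filter _ E.
move=> sz; have /and3P[u1 _ u2] : [&& uniq t1, ~~ has (mem t1) t2 & uniq t2].
  by rewrite -cat_uniq.
have wi ti : {in filter (within ti) E, forall e, within ti e && (e.1 != e.2)}.
  by move=> e; rewrite mem_filter => /andP[-> /lE].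
have loc ti T' : one_pair E ti T' = one_pair (filter (within ti) E) ti T'.
  by apply: order_pair_local; rewrite filter_id.
(* Either each side has as many arcs as its branch has internal vertices, which leaves exactly one
   crossing arc, or both pairings vanish. *)
have [/andP[/eqP c1 /eqP c2]|nc] :=
    boolP (((size E1).+1 == nleaves l) && ((size E2).+1 == nleaves r)).
  rewrite (loc t1) (loc t2) -/E1 -/E2 IHl ?s1 ?IHr ?s2 //; try exact: wi.
  have fb : (f + b = 1)%N by move: sE sz; rewrite st -c1 -c2; lia.
  congr (_ * _); rewrite fb /=.
  by case: (f) (b) fb => [|[|?]] [|[|?]] // _; rewrite ?subr0 ?sub0r.
rewrite [RHS](_ : _ = 0); last first.
  apply/eqP; apply: contraNT nc => nz.
  have [z1|/(one_pair_size lE u1)] := eqVneq (one_pair E t1 l) 0.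
    by rewrite z1 mul0r mulr0 eqxx in nz.
  have [z2|/(one_pair_size lE u2)] := eqVneq (one_pair E t2 r) 0.
    by rewrite z2 !mulr0 eqxx in nz.
  by rewrite /E1 /E2 => -> ->; rewrite s1 s2 !eqxx.
apply/eqP; apply: contraNT nc => nz.
have [z0|fb] := eqVneq (f + b)%N 0%N; first by rewrite z0 /= mul0r eqxx in nz.
have [z1|/order_shape_size l1] := eqVneq (order_shape E1 t1 l) 0.
  by rewrite z1 mul0r mulr0 eqxx in nz.
have [z2|/order_shape_size l2] := eqVneq (order_shape E2 t2 r) 0.
  by rewrite z2 !mulr0 eqxx in nz.
move: sE sz fb l1 l2; rewrite st; lia.
Qed.
End ShapeOfOrder.

(** Every vertex other than the root is the target of exactly one arc, since arcs point away from
    the root. *)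
Lemma perm_verts_arcs (X : eqType) (g : rooted X) :
  perm_eq (verts g) (root g :: map snd (arcs g)).
Proof.
elim: g => //= g /seq.permP IHg h /seq.permP IHh; apply/seq.permP=> a.
by rewrite map_cat /= !count_cat; move: (IHg a) (IHh a) => /=; lia.
Qed.

Lemma uniq_arcs (X : eqType) (g : rooted X) : uniq (verts g) -> uniq (arcs g).
Proof. by rewrite (perm_uniq (perm_verts_arcs g)) => /andP[_ /map_uniq]. Qed.

Definition represents n (e : rooted 'I_n) (G : graph n) : Prop :=
  perm_eq (verts e) (enum 'I_n) /\ edges G =i arcs e.

(** * The configuration pairing of a rooted graph with a tree *)

Section GenPairing.
Variables (K : fieldType) (V : vectType K).

Lemma sum_injective_perm n (F : ('I_n -> 'I_n) -> K) (F' : seq 'I_n -> K) (s : seq 'I_n) :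
  perm_eq s (enum 'I_n) -> (forall f g, f =1 g -> F f = F g) ->
  (forall sg : {perm 'I_n}, F (sg^-1)%g = F' (map sg (enum 'I_n))) ->
  \sum_(f : {ffun 'I_n -> 'I_n} | injectiveb f) F f
  = \sum_(t <- permutations s) F' t.
Proof.
move=> ps extF eF.
rewrite (reindex (@pval 'I_n)); last first.
  exists (insubd (1%g : {perm 'I_n})) => f injf; first exact: valKd.
  exact: (insubdK (1%g : {perm 'I_n}) injf).
rewrite (eq_bigl predT) => [|sg]; last by rewrite /= (valP sg).
rewrite (eq_bigr (fun sg : {perm 'I_n} => F sg)) => [|sg _]; last first.
  by apply: extF => i; rewrite pvalE.
(* The ordering [t] lists the vertices in the order of their leaves, so it comes from the inverse of
   the bijection. *)
have invI : injective (fun sg : {perm 'I_n} => (sg^-1)%g) by apply: invg_inj.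
rewrite (reindex_inj invI) /=.
rewrite (eq_bigr _ (fun sg _ => eF sg)) -(big_map (fun sg : {perm 'I_n} => map sg (enum 'I_n)) predT F').
apply: perm_big.
have u1 : uniq [seq map sg (enum 'I_n) | sg : {perm 'I_n} <- index_enum {perm 'I_n}].
  rewrite map_inj_uniq ?index_enum_uniq // => sg sg' /eq_in_map e.
  by apply/permP => i; apply: e; rewrite mem_enum.
have us : uniq s by rewrite (perm_uniq ps) enum_uniq.
apply: uniq_perm => //; first exact: permutations_uniq.
apply: (uniq_min_size u1 _ _).2.
  move=> _ /mapP[sg _ ->]; rewrite mem_permutations perm_sym; apply: perm_trans ps _.
  rewrite perm_sym.
  apply: uniq_perm; rewrite ?enum_uniq ?(map_inj_uniq perm_inj) ?enum_uniq // => i.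
  by rewrite mem_enum -[i](permKV sg) map_f // mem_enum.
rewrite size_map size_permutations // (perm_size ps) size_enum_ord.
have -> : size (index_enum {perm 'I_n}) = #|{perm 'I_n}| by rewrite cardE enumT.
by rewrite card_Sn.
Qed.

(** A bijection is an ordering of the vertices. [order_shapeE] replaces the common ancestors by the
    recursive signs, and [sum_order_pair] sums over the orderings. *)
Lemma gen_pairingE n (G : graph n) (l : {ffun 'I_n -> dual_space V}) e (T : tree V) :
  represents e G ->
  gen_pairing (LGraph G l) T = rpair (fun i x => l i x : K) e T.
Proof.
move=> [pe eG]; have ue : uniq (verts e) by rewrite (perm_uniq pe) enum_uniq.
have sn : size (verts e) = n by rewrite (perm_size pe) size_enum_ord.
rewrite -sum_order_pair // /gen_pairing /=.
have [nT|nT] := eqVneq n (nleaves T); last first.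
  rewrite big_pred0 => [|s]; last by rewrite andbF.
  rewrite big_seq big1 // => t; rewrite mem_permutations => /perm_size; rewrite sn => st.
  by apply: contra_neq_eq nT => /order_pair_size <-.
rewrite (eq_bigl (fun s : {ffun 'I_n -> 'I_(nleaves T)} => injectiveb s)); last first.
  by move=> s; rewrite andbT.
subst n; apply: (@sum_injective_perm _
  (fun s => shape_pairing K G s * \prod_(i < nleaves T) (l i (leaf_label (s i)) : K))) => //.
  move=> f g fg; congr (_ * _); last by apply: eq_bigr => i _; rewrite fg.
  have be : beta f =1 beta g by move=> p; rewrite /beta !fg.
  rewrite /shape_pairing; under eq_all do under eq_existsb do rewrite be.
  by case: ifP => // _; apply: eq_bigr => p _; rewrite /beta_sign !fg.
move=> sg; set t := map sg _.
have ut : uniq t by rewrite (map_inj_uniq perm_inj) enum_uniq.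
have st : size t = nleaves T by rewrite size_map size_enum_ord.
have it a : index a t = (sg^-1)%g a.
  by rewrite -{1}[a](permKV sg) index_map ?index_enum_ord //; apply: perm_inj.
have mt a : a \in t by rewrite -index_mem it st.
rewrite order_pairE // -order_shapeE //; first 1 last.
- by move=> p pa; rewrite /within !mt /=; apply: perm_arcs_verts ue.
- by rewrite size_arcs sn st.
congr (_ * _).
  rewrite /shape_pairing /order_shape.
  have -> : all (fun p => [exists e0 in edges G, beta (sg^-1)%g e0 == p]) (internal_addresses T)
    = all (fun p => has (fun e0 => order_beta t T e0 == p) (arcs e)) (internal_addresses T).
    apply: eq_all => p; apply/existsP/hasP.
      case=> q /andP[]; rewrite eG => qG /eqP <-; exists q => //.
      by rewrite /order_beta /beta /leaf_address !(tnth_nth [::]) !it.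
    case=> q qG /eqP <-; exists q; rewrite eG qG /=.
    by rewrite /order_beta /beta /leaf_address !(tnth_nth [::]) !it.
  case: ifP => // _; rewrite (eq_bigl _ _ eG) -big_uniq ?uniq_arcs //=.
  by apply: eq_bigr => p _; rewrite /beta_sign /order_sign !it.
rewrite (reindex_inj (@perm_inj _ sg)) /=.
have T0 : (0 < nleaves T)%N by rewrite -size_internal_addresses.
pose i0 := Ordinal T0.
rewrite (big_nth (i0, 0)) big_mkord size_zip st size_leaf_labels minnn.
apply: eq_bigr => i _; rewrite permK nth_zip ?st ?size_leaf_labels //= /t.
by rewrite (nth_map i0) ?size_enum_ord // nth_ord_enum.
Qed.
End GenPairing.

(** * From rooted graphs to graphs *)

Lemma mem_arcs_rmap (X Y : eqType) (s : X -> Y) (o : rooted X) a b : injective s ->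
  ((s a, s b) \in arcs (rmap s o)) = ((a, b) \in arcs o).
Proof.
move=> injs; rewrite arcs_rmap -[RHS](mem_map (f := fun p => (s p.1, s p.2))) //.
by move=> [? ?] [? ?] [/injs-> /injs->].
Qed.

Section GraphTransport.

Lemma is_graph_asym n (E : {set 'I_n * 'I_n}) a b :
  is_graph E -> (a, b) \in E -> (b, a) \notin E.
Proof. by case/and4P=> _ /forallP/(_ a)/forallP/(_ b)/implyP. Qed.

(** Apart from asymmetry, being a graph depends only on undirected adjacency up to renaming. This
    serves both to renumber vertices and to reverse edges. *)
Lemma is_graph_adjacent n (E E' : {set 'I_n * 'I_n}) (s : 'I_n -> 'I_n) :
  injective s -> is_graph E ->
  (forall a b, adjacent E' (s a) (s b) = adjacent E a b) ->
  (forall a b, (a, b) \in E' -> (b, a) \notin E') -> is_graph E'.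
Proof.
move=> injs gE adjE asym; have [s' sK s'K] := injF_bij injs.
have adjE' a b : adjacent E' a b = adjacent E (s' a) (s' b) by rewrite -adjE !s'K.
case/and4P: (gE) => n0 _ /forallP conn _; apply/and4P; split=> //.
- by apply/forallP=> a; apply/forallP=> b; apply/implyP; apply: asym.
- apply/forallP=> a; apply/forallP=> b.
  have /connectP[p pp pb] := forallP (conn (s' a)) (s' b).
  apply/connectP; exists (map s p); last by rewrite -[a]s'K last_map -pb s'K.
  by rewrite -[a]s'K path_map; apply: sub_path pp => x y; rewrite /= adjE.
- apply/forallP=> k; apply/forallP=> p; apply/implyP=> /andP[cp up].
  rewrite -(size_tuple p) -(size_map s' p).
  apply: (@acyclicP _ (Graph gE)); apply/andP; split; last first.
    by rewrite map_inj_uniq //; apply: can_inj s'K.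
  case: (tval p) cp => //= x q; rewrite -map_rcons path_map.
  by apply: sub_path => y z; rewrite adjE'.
Qed.
End GraphTransport.

Section PgraphOfRooted.
Variable W : nmodType.

Fixpoint pg (g : rooted W) : pgraph W :=
  match g with
  | Vertex x => single x
  | Attach g h => graft (pg g) (pg h)
  end.

Lemma pg_achain g gs : pg (achain g gs) = chain (pg g) (map pg gs).
Proof. by elim: gs g => //= h gs IH g; rewrite IH. Qed.

Lemma enum_ord_add m n :
  perm_eq (enum 'I_(m + n)) (map (lshift n) (enum 'I_m) ++ map (@rshift m n) (enum 'I_n)).
Proof.
apply: uniq_perm; first exact: enum_uniq.
  rewrite cat_uniq (map_inj_uniq (@lshift_inj _ _)) (map_inj_uniq (@rshift_inj _ _)).
  rewrite !enum_uniq andbT /=; apply/hasPn=> _ /mapP[i _ ->]; apply/mapP=> -[j _ /eqP].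
  by rewrite eq_rlshift.
move=> i; rewrite mem_enum mem_cat inE; apply/esym.
by case: (graft_ordP i) => -[j ->]; rewrite map_f ?mem_enum ?orbT.
Qed.

(** Numbers the vertices of g, so that vertices with equal labels become distinct; the labels give g
    back by [rmap]. *)
Lemma pg_represents (g : rooted W) :
  exists o : rooted 'I_(pg_size (pg g)),
    [/\ represents o (pg_graph (pg g)), rmap (pg_label (pg g)) o = g
      & root o = pivot (pg g)].
Proof.
elim: g => [x|g [og [[pog eog] mog rog]] h [oh [[poh eoh] moh roh]]] /=.
  exists (Vertex ord0); split=> //=; last by rewrite ffunE.
  split; last by move=> p; rewrite /= !inE.
  by apply: uniq_perm; rewrite ?enum_uniq // => i; rewrite mem_enum !inE ord1.
set n1 := pg_size (pg g); set n2 := pg_size (pg h).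
exists (Attach (rmap (lshift n2) og) (rmap (@rshift n1 n2) oh)); split.
- split=> /=.
    rewrite !verts_rmap perm_sym; apply: perm_trans (enum_ord_add _ _) _.
    by rewrite perm_sym; apply: perm_cat; apply: perm_map.
  move=> [i j]; rewrite !inE /= !root_rmap mem_cat !arcs_rmap rog roh.
  have LL a b := mem_arcs_rmap og a b (@lshift_inj n1 n2).
  have RR a b := mem_arcs_rmap oh a b (@rshift_inj n1 n2).
  rewrite !arcs_rmap in LL RR.
  have notR a k : ((lshift n2 a, k)
      \in [seq (@rshift n1 n2 p.1, @rshift n1 n2 p.2) | p <- arcs oh]) = false.
    by apply/negP=> /mapP[p _ /(congr1 fst)/eqP]; rewrite /= eq_lrshift.
  have notL b k : ((@rshift n1 n2 b, k)
      \in [seq (lshift n2 p.1, lshift n2 p.2) | p <- arcs og]) = false.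
    by apply/negP=> /mapP[p _ /(congr1 fst)/eqP]; rewrite /= eq_rlshift.
  have notL' k b : ((k, @rshift n1 n2 b)
      \in [seq (lshift n2 p.1, lshift n2 p.2) | p <- arcs og]) = false.
    by apply/negP=> /mapP[p _ /(congr1 snd)/eqP]; rewrite /= eq_rlshift.
  have notR' k a : ((k, lshift n2 a)
      \in [seq (@rshift n1 n2 p.1, @rshift n1 n2 p.2) | p <- arcs oh]) = false.
    by apply/negP=> /mapP[p _ /(congr1 snd)/eqP]; rewrite /= eq_lrshift.
  rewrite xpair_eqE.
  case: (graft_ordP i) => -[a ->]; case: (graft_ordP j) => -[b ->].
  + rewrite !(unsplitK (inl _)) LL eog [lshift _ b == _]eq_lrshift andbF /=.
    by rewrite notR orbF.
  + rewrite (unsplitK (inl _)) (unsplitK (inr _)) eq_lshift eq_rshift.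
    by rewrite notL' notR !orbF.
  + by rewrite (unsplitK (inl _)) (unsplitK (inr _)) eq_rlshift /= notL notR'.
  + by rewrite !(unsplitK (inr _)) RR eoh eq_rlshift notL.
- rewrite /= !rmap_comp; congr Attach.
    by rewrite -[RHS]mog; apply: eq_rmap => i /=; rewrite ffunE (unsplitK (inl _)).
  by rewrite -[RHS]moh; apply: eq_rmap => i /=; rewrite ffunE (unsplitK (inr _)).
- by rewrite /= root_rmap rog.
Qed.
End PgraphOfRooted.

Lemma size_verts_enum n (e : rooted 'I_n) : perm_eq (verts e) (enum 'I_n) -> size (verts e) = n.
Proof. by move/perm_size->; rewrite size_enum_ord. Qed.

Lemma uniq_verts_enum n (e : rooted 'I_n) : perm_eq (verts e) (enum 'I_n) -> uniq (verts e).
Proof. by move/perm_uniq->; rewrite enum_uniq. Qed.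

Lemma map_enum_inj m n (s : 'I_m -> 'I_n) (o : rooted 'I_m) :
  perm_eq (verts o) (enum 'I_m) -> perm_eq (verts (rmap s o)) (enum 'I_n) -> injective s.
Proof.
move=> po pe; apply/injectiveP; rewrite /injectiveb /dinjectiveb.
by rewrite -(perm_uniq (perm_map s po)) -verts_rmap (perm_uniq pe) enum_uniq.
Qed.

(** Connectedness and acyclicity are known for [graft], hence for the graphs made by [pg], and are
    transported along the labels. These are taken in [nat] because [pg] wants labels in an
    nmodType. *)
Lemma arcs_is_graph n (e : rooted 'I_n) : perm_eq (verts e) (enum 'I_n) ->
  is_graph [set p | p \in arcs e]%SET.
Proof.
move=> pe; have [o [[po eo] mo _]] := pg_represents (rmap (@nat_of_ord n) e).
have n0 : (0 < n)%N by rewrite -(size_verts_enum pe) -size_arcs.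
pose s i := insubd (Ordinal n0) (pg_label (pg (rmap (@nat_of_ord n) e)) i).
have De : e = rmap s o.
  have -> : rmap s o = rmap (insubd (Ordinal n0)) (rmap (@nat_of_ord n) e).
    by rewrite -[in RHS]mo rmap_comp.
  rewrite rmap_comp -[LHS](_ : rmap id e = e); last by elim: (e) => //= ? -> ? ->.
  by apply: eq_rmap => i /=; apply: val_inj; rewrite val_insubd ltn_ord.
have ps : perm_eq (verts (rmap s o)) (enum 'I_n) by rewrite -De.
have injs := map_enum_inj po ps.
have En : pg_size (pg (rmap (@nat_of_ord n) e)) = n.
  have e1 := size_verts_enum ps; rewrite verts_rmap size_map in e1.
  exact: etrans (esym (size_verts_enum po)) e1.
clearbody s; move: (pg_size _) (pg_graph _) o po eo s De ps injs En {mo} => N G o po eo s De ps injs En.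
subst N.
apply: (is_graph_adjacent injs (graphP G)) => [a b|a b].
  by rewrite /adjacent !inE De !mem_arcs_rmap // !eo.
have [s' sK s'K] := injF_bij injs; rewrite -[a]s'K -[b]s'K !inE De !mem_arcs_rmap // -!eo.
exact: is_graph_asym (graphP G).
Qed.

(** * Classes of rooted graphs in the Lie coalgebra *)

Section QuotientLinear.
Variables (K : nzRingType) (U : lmodType K) (rel : U -> Prop).

Lemma quotmod_pi_linear : linear (\pi_(quotmod rel)%qT : U -> quotmod rel).
Proof. by move=> c u v; rewrite quotmod_piD quotmod_piZ. Qed.

Definition quotmod_pi : {linear U -> quotmod rel} :=
  HB.pack (\pi_(quotmod rel)%qT : U -> quotmod rel)
    (GRing.isLinear.Build K U (quotmod rel) *:%R _ quotmod_pi_linear).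

Lemma quotmod_pi_rel u : rel u -> quotmod_pi u = 0.
Proof.
move=> ru; rewrite -(linear0 quotmod_pi); apply/quotmod_piP.
rewrite subr0 -[u]addr0 -[X in X + _]scale1r.
exact: in_span_scale_add ru (in_span0 _).
Qed.
End QuotientLinear.

(** One-hole contexts, for relations applied inside a rooted graph. The arcs of a context depend on
    the plugged graph only through its root. *)
Inductive rctx (X : Type) : Type :=
| RHole
| RLeft of rctx X & rooted X
| RRight of rooted X & rctx X.
Arguments RHole {X}.

Section Contexts.
Variable X : Type.

Fixpoint rplug (C : rctx X) (g : rooted X) : rooted X :=
  match C with
  | RHole => g
  | RLeft C' h => Attach (rplug C' g) h
  | RRight h C' => Attach h (rplug C' g)
  end.

Fixpoint rcomp (C D : rctx X) : rctx X :=
  match C with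
  | RHole => D
  | RLeft C' h => RLeft (rcomp C' D) h
  | RRight h C' => RRight h (rcomp C' D)
  end.

Lemma rplug_comp C D g : rplug (rcomp C D) g = rplug C (rplug D g).
Proof. by elim: C => //= [C -> h|h C ->]. Qed.

Fixpoint ctx_verts (C : rctx X) : seq X :=
  match C with
  | RHole => [::]
  | RLeft C' h => ctx_verts C' ++ verts h
  | RRight h C' => verts h ++ ctx_verts C'
  end.

Fixpoint ctx_root (C : rctx X) (r : X) : X :=
  match C with
  | RHole => r
  | RLeft C' h => ctx_root C' r
  | RRight h C' => root h
  end.

Fixpoint ctx_arcs (C : rctx X) (r : X) : seq (X * X) :=
  match C with
  | RHole => [::]
  | RLeft C' h => (ctx_root C' r, root h) :: ctx_arcs C' r ++ arcs h
  | RRight h C' => (root h, ctx_root C' r) :: arcs h ++ ctx_arcs C' r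
  end.

Lemma root_rplug C g : root (rplug C g) = ctx_root C (root g).
Proof. by elim: C. Qed.
End Contexts.

Lemma verts_rplug (X : eqType) (C : rctx X) g :
  perm_eq (verts (rplug C g)) (ctx_verts C ++ verts g).
Proof.
elim: C => //= [C /seq.permP IH h|h C /seq.permP IH]; apply/seq.permP=> a;
  move: (IH a); rewrite !count_cat; lia.
Qed.

Lemma arcs_rplug (X : eqType) (C : rctx X) g :
  perm_eq (arcs (rplug C g)) (ctx_arcs C (root g) ++ arcs g).
Proof.
elim: C => //= [C /seq.permP IH h|h C /seq.permP IH]; apply/seq.permP=> a;
  move: (IH a); rewrite /= root_rplug !count_cat; lia.
Qed.

Fixpoint cmap X Y (f : X -> Y) (C : rctx X) : rctx Y :=
  match C with
  | RHole => RHole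
  | RLeft C' h => RLeft (cmap f C') (rmap f h)
  | RRight h C' => RRight (rmap f h) (cmap f C')
  end.

Lemma rmap_rplug X Y (f : X -> Y) C g : rmap f (rplug C g) = rplug (cmap f C) (rmap f g).
Proof. by elim: C => //= [C -> h|h C ->]. Qed.

Lemma rmap_rplug_inv X Y (f : X -> Y) o C g : rmap f o = rplug C g ->
  exists C' g', [/\ o = rplug C' g', cmap f C' = C & rmap f g' = g].
Proof.
elim: C o => [|C IH h|h C IH] o /= Eo; first by exists RHole, o.
  case: o Eo => //= o1 o2 [/IH[C' [g' [-> <- <-]]] <-].
  by exists (RLeft C' o2), g'.
case: o Eo => //= o1 o2 [<- /IH[C' [g' [-> <- <-]]]].
by exists (RRight o1 C'), g'.
Qed.

(** Two rooted graphs that agree once their labels are forgotten correspond by the rank of each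
    vertex in [verts]. *)
Lemma rmap_nth_index (X : eqType) Y (y0 : Y) (g : rooted X) (h : rooted Y) :
  uniq (verts g) -> rmap (fun=> tt) g = rmap (fun=> tt) h ->
  rmap (fun x => nth y0 (verts h) (index x (verts g))) g = h.
Proof.
elim: g h => [x|g IHg g' IHg'] [y|h h'] //=; first by rewrite eqxx.
rewrite cat_uniq => /and3P[ug /hasPn d ug'] [Eg Eg'].
have sz : size (verts g) = size (verts h).
  by rewrite -(size_map (fun=> tt)) -verts_rmap Eg verts_rmap size_map.
congr Attach.
  rewrite -[RHS](IHg h) //; apply: eq_in_rmap => x xg.
  by rewrite index_cat xg nth_cat -sz index_mem xg.
rewrite -[RHS](IHg' h') //; apply: eq_in_rmap => x xg.
by rewrite index_cat (negbTE (d _ xg)) nth_cat -sz ltnNge leq_addr /= addKn.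
Qed.

Lemma rmap_eq_in (X : eqType) Y (f1 f2 : X -> Y) g :
  rmap f1 g = rmap f2 g -> {in verts g, f1 =1 f2}.
Proof. by move=> e; apply/eq_in_map; rewrite -!verts_rmap e. Qed.

Section FlipGraph.
Variables (n : nat) (E : {set 'I_n * 'I_n}) (a b : 'I_n).
Hypotheses (gE : is_graph E) (abE : (a, b) \in E).
Let E' := ((b, a) |: (E :\ (a, b)))%SET.

Lemma flip_is_graph : is_graph E'.
Proof.
have baE := is_graph_asym gE abE.
have ab : ((a, b) == (b, a)) = false.
  by apply: contraNF baE => /eqP <-.
have sw x y : ((x, y) == (b, a)) = ((y, x) == (a, b)) by rewrite !xpair_eqE andbC.
have adjE x y : adjacent E' x y = adjacent E x y.
  rewrite /adjacent !inE !sw.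
  have [[-> ->]|n1] := (x, y) =P (a, b); first by rewrite abE orbT.
  by have [[-> ->]|n2] := (y, x) =P (a, b); rewrite ?abE ?orbT.
apply: (is_graph_adjacent (@inj_id _) gE adjE) => x y.
have asym := @is_graph_asym _ _ x y gE.
rewrite !inE !sw; have [[-> ->]|n1] := (x, y) =P (a, b).
  by rewrite [(b, a) == _]eq_sym ab.
have [//|n2] := (y, x) =P (a, b).
exact: asym.
Qed.
End FlipGraph.

Section GraphClass.
Variables (K : nzRingType) (W : lmodType K).

Notation cls G l := (graph_class (LGraph G l) : cofree_lie W).

Lemma graph_classE (g : lgraph W) : graph_class g = quotmod_pi (@graph_rel K W) (graph_gen g).
Proof. by []. Qed.

Lemma class_iso n n' (G : graph n) (G' : graph n')
    (l : {ffun 'I_n -> W}) (l' : {ffun 'I_n' -> W}) (s : 'I_n -> 'I_n') :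
  n = n' -> injective s -> (forall a b, ((s a, s b) \in edges G') = ((a, b) \in edges G)) ->
  (forall a, l' (s a) = l a) -> cls G l = cls G' l'.
Proof.
move=> En; subst n' => injs eG el; apply/eqP; rewrite -subr_eq0 !graph_classE -linearB /=.
apply/eqP/quotmod_pi_rel; apply: (graph_iso (s := perm injs)) => [a b|a].
  by rewrite !permE eG.
by rewrite permE el.
Qed.

Definition rclass (g : rooted W) : cofree_lie W :=
  graph_class (lgraph_of_pgraph (pg g)).

(** [pg] numbers the vertices in its own way; [rmap_nth_index] supplies the renumbering and
    [graph_iso] identifies the classes. *)
Lemma class_represents n (e : rooted 'I_n) (G : graph n) (l : {ffun 'I_n -> W}) :
  represents e G -> cls G l = rclass (rmap l e).
Proof.
move=> [pe eG]; rewrite /rclass /lgraph_of_pgraph.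
move: {-2}(rmap l e) (erefl (rmap l e)) => g Dg.
have [o [[po eo] mo _]] := pg_represents g.
have ue := uniq_verts_enum pe.
have shape : rmap (fun=> tt) e = rmap (fun=> tt) o.
  have := congr1 (rmap (fun=> tt)) (etrans mo Dg).
  by rewrite !rmap_comp => /esym.
have := rmap_nth_index (root o) ue shape; set s := fun x => nth _ _ _ => So.
have ps : perm_eq (verts (rmap s e)) (enum 'I_(pg_size (pg g))) by rewrite So.
have injs := map_enum_inj pe ps.
apply: (class_iso (s := s)) => // [|a b|a].
- by rewrite -[LHS](size_verts_enum pe) -(size_verts_enum ps) verts_rmap size_map.
- by rewrite eo eG -So mem_arcs_rmap.
have := @rmap_eq_in _ _ l (pg_label (pg g) \o s) e.
rewrite -rmap_comp So mo -Dg => -> //.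
by rewrite (perm_mem pe) mem_enum.
Qed.
End GraphClass.

Section RootedClass.
Variables (K : nzRingType) (W : lmodType K).

Notation cls G l := (graph_class (LGraph G l) : cofree_lie W).
Notation rclass := (@rclass K W).

Definition arc_graph n (e : rooted 'I_n) (pe : perm_eq (verts e) (enum 'I_n)) : graph n :=
  Graph (arcs_is_graph pe).

Lemma class_arc_graph n (e : rooted 'I_n) pe (l : {ffun 'I_n -> W}) :
  cls (arc_graph (e := e) pe) l = rclass (rmap l e).
Proof. by apply: class_represents; split=> // p; rewrite inE. Qed.

Lemma named_rooted (g : rooted W) :
  exists n (o : rooted 'I_n) (l : {ffun 'I_n -> W}),
    perm_eq (verts o) (enum 'I_n) /\ rmap l o = g.
Proof.
have [o [[po _] mo _]] := pg_represents g.
by exists (pg_size (pg g)), o, (pg_label (pg g)).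
Qed.

Lemma class_flip n (G G' : graph n) (l : {ffun 'I_n -> W}) a b :
  (a, b) \in edges G -> edges G' = ((b, a) |: (edges G :\ (a, b)))%SET ->
  cls G l = - cls G' l.
Proof.
move=> abG EG'; apply/eqP; rewrite -addr_eq0 !graph_classE -linearD /=.
by apply/eqP/quotmod_pi_rel; apply: graph_reverse abG EG'.
Qed.

Lemma class_arnold n (G1 G2 G3 : graph n) (l : {ffun 'I_n -> W}) (F : {set 'I_n * 'I_n}) a b c :
  edges G1 = (F :|: [set (a, b); (b, c)])%SET ->
  edges G2 = (F :|: [set (b, c); (c, a)])%SET ->
  edges G3 = (F :|: [set (c, a); (a, b)])%SET ->
  cls G1 l + cls G2 l + cls G3 l = 0.
Proof.
move=> E1 E2 E3; rewrite !graph_classE -!linearD /=.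
by apply/quotmod_pi_rel; apply: graph_arnold E1 E2 E3.
Qed.

(** The two graphs differ only in the direction of the edge between the two roots. The root of a
    graph may thus be moved at the cost of a sign. *)
Lemma rclass_swap (g h : rooted W) : rclass (Attach g h) = - rclass (Attach h g).
Proof.
have [n [o [l [po mo]]]] := named_rooted (Attach g h).
case: o po mo => // o o' po [<- <-].
have po' : perm_eq (verts (Attach o' o)) (enum 'I_n).
  by apply: perm_trans po; rewrite /= perm_catC.
rewrite -[Attach (rmap l o) _]/(rmap l (Attach o o')) -[Attach (rmap l o') _]/(rmap l (Attach o' o)).
rewrite -(class_arc_graph po) -(class_arc_graph po').
have /= /andP[na _] := uniq_arcs (uniq_verts_enum po).
apply: (@class_flip _ _ _ _ (root o) (root o')); first by rewrite inE /= inE eqxx.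
apply/setP=> p; rewrite !inE /=; have [->|_] //= := eqVneq p (root o', root o).
have [->|_] /= := eqVneq p (root o, root o'); last by rewrite !mem_cat orbC.
by rewrite mem_cat orbC -mem_cat (negbTE na).
Qed.

Lemma set_flip (T : finType) (E F : {set T}) (p q r : T) :
  p \notin F -> r != p -> E = (F :|: [set r; p])%SET ->
  (q |: (E :\ p))%SET = (F :|: [set q; r])%SET.
Proof.
move=> pF rp ->; apply/setP=> x; rewrite !inE.
have [->|xp] := eqVneq x p; last by case: (x \in F); case: (x == q); case: (x == r).
by rewrite (negbTE pF) orbF /= [p == r]eq_sym (negbTE rp) orbF.
Qed.

(** With a, b, c the roots of g, h, k, the three graphs differ in the edges {a -> b, a -> c}, {a ->
    b, b -> c} and {a -> c, c -> b}. Reversing a -> c in the first and both edges in the third gives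
    the three terms of the Arnold relation. *)
Lemma rclass_arnold (C : rctx W) g h k :
  rclass (rplug C (Attach (Attach g h) k))
  = rclass (rplug C (Attach g (Attach h k))) + rclass (rplug C (Attach g (Attach k h))).
Proof.
have [n [o [l [po mo]]]] := named_rooted (rplug C (Attach (Attach g h) k)).
have [C' [o' [Eo EC Eo']]] := rmap_rplug_inv mo; subst o C.
case: o' po Eo' {mo} => // -[//|g' h'] k' po [Eg Eh Ek]; subst g h k.
set a := root g'; set b := root h'; set c := root k'.
set e1 := rplug C' (Attach (Attach g' h') k') in po *.
pose e2 := rplug C' (Attach g' (Attach h' k')).
pose e3 := rplug C' (Attach g' (Attach k' h')).
have sum e : perm_eq (verts e) (verts (Attach (Attach g' h') k')) ->
    perm_eq (verts (rplug C' e)) (enum 'I_n).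
  move=> pe; apply: perm_trans po; rewrite (perm_trans (verts_rplug _ _)) //.
  by rewrite perm_sym (perm_trans (verts_rplug _ _)) // perm_cat2l perm_sym.
have po2 : perm_eq (verts e2) (enum 'I_n) by apply: sum; rewrite /= catA.
have po3 : perm_eq (verts e3) (enum 'I_n).
  by apply: sum; rewrite /= -catA perm_cat2l perm_catC.
have -> : rplug (cmap l C') (Attach (Attach (rmap l g') (rmap l h')) (rmap l k')) = rmap l e1.
  by rewrite rmap_rplug.
have -> : rplug (cmap l C') (Attach (rmap l g') (Attach (rmap l h') (rmap l k'))) = rmap l e2.
  by rewrite rmap_rplug.
have -> : rplug (cmap l C') (Attach (rmap l g') (Attach (rmap l k') (rmap l h'))) = rmap l e3.
  by rewrite rmap_rplug.
rewrite -(class_arc_graph po) -(class_arc_graph po2) -(class_arc_graph po3).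
pose Fs := ctx_arcs C' a ++ arcs g' ++ arcs h' ++ arcs k'.
have p1 : perm_eq (arcs e1) ((a, b) :: (a, c) :: Fs).
  apply: perm_trans (arcs_rplug _ _) _; apply/seq.permP=> x.
  by do 3! rewrite /= ?count_cat; rewrite -/a -/b -/c; lia.
have p2 : perm_eq (arcs e2) ((a, b) :: (b, c) :: Fs).
  apply: perm_trans (arcs_rplug _ _) _; apply/seq.permP=> x.
  by do 3! rewrite /= ?count_cat; rewrite -/a -/b -/c; lia.
have p3 : perm_eq (arcs e3) ((a, c) :: (c, b) :: Fs).
  apply: perm_trans (arcs_rplug _ _) _; apply/seq.permP=> x.
  by do 3! rewrite /= ?count_cat; rewrite -/a -/b -/c; lia.
pose F := [set p in Fs]%SET.
have u1 := uniq_arcs (uniq_verts_enum po); rewrite (perm_uniq p1) /= inE negb_or in u1.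
have u3 := uniq_arcs (uniq_verts_enum po3); rewrite (perm_uniq p3) /= inE negb_or in u3.
have E1 : edges (arc_graph po) = (F :|: [set (a, b); (a, c)])%SET.
  by apply/setP=> x; rewrite /= !inE (perm_mem p1) !inE orbA orbC.
have E2 : edges (arc_graph po2) = (F :|: [set (a, b); (b, c)])%SET.
  by apply/setP=> x; rewrite /= !inE (perm_mem p2) !inE orbA orbC.
have E3 : edges (arc_graph po3) = (F :|: [set (a, c); (c, b)])%SET.
  by apply/setP=> x; rewrite /= !inE (perm_mem p3) !inE orbA orbC.
case/and3P: u1 => /andP[abc abF] acF _; case/and3P: u3 => /andP[accb _] cbF _.
have ac1 : (a, c) \in edges (arc_graph po) by rewrite E1 !inE eqxx !orbT.
pose G1 := Graph (flip_is_graph (graphP (arc_graph po)) ac1).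
have EG1 : edges G1 = (F :|: [set (c, a); (a, b)])%SET.
  by rewrite /= (set_flip _ _ _ E1) // inE.
have cb3 : (c, b) \in edges (arc_graph po3) by rewrite E3 !inE eqxx !orbT.
pose G2 := Graph (flip_is_graph (graphP (arc_graph po3)) cb3).
have EG2 : edges G2 = (F :|: [set (b, c); (a, c)])%SET.
  by rewrite /= (set_flip _ _ _ E3) // inE.
have ac2 : (a, c) \in edges G2 by rewrite EG2 !inE eqxx !orbT.
pose G3 := Graph (flip_is_graph (graphP G2) ac2).
have ab : (a, b) \in arcs e1 by rewrite (perm_mem p1) inE eqxx.
have bcac : (b, c) != (a, c).
  by rewrite xpair_eqE eqxx andbT eq_sym; apply: perm_arcs_verts ab (uniq_verts_enum po).
have EG3 : edges G3 = (F :|: [set (b, c); (c, a)])%SET.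
  rewrite /= (set_flip _ _ bcac EG2); last by rewrite inE.
  by congr (_ :|: _)%SET; apply: finset.setUC.
have := class_arnold l E2 EG3 EG1.
rewrite (class_flip l ac1 (erefl (edges G1))) (class_flip l cb3 (erefl (edges G2))).
rewrite (class_flip l ac2 (erefl (edges G3))) opprK => /eqP.
by rewrite addr_eq0 => /eqP ->.
Qed.

End RootedClass.

(** * Every graph is a rooted one up to reversing edges *)

Section SpanningRooted.

Fixpoint add_leaf (X : eqType) (a c : X) (e : rooted X) : rooted X :=
  match e with
  | Vertex x => Attach (Vertex x) (Vertex c)
  | Attach g h =>
      if a \in verts g then Attach (add_leaf a c g) h else Attach g (add_leaf a c h)
  end.

Lemma add_leafP (X : eqType) (a c : X) (e : rooted X) : a \in verts e ->
  [/\ root (add_leaf a c e) = root e, perm_eq (verts (add_leaf a c e)) (c :: verts e)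
    & perm_eq (arcs (add_leaf a c e)) ((a, c) :: arcs e)].
Proof.
elim: e => [x|g IHg h IHh] /=.
  by rewrite inE => /eqP ->; split=> //; rewrite (perm_catC [:: x] [:: c]).
rewrite mem_cat; case: (boolP (a \in verts g)) => /= [/IHg|_ /IHh];
  move=> [r /seq.permP v /seq.permP e].
  move=> _; split; rewrite //= ?r //; apply/seq.permP=> p.
    by move: (v p); rewrite /= !count_cat /=; lia.
  by move: (e p); rewrite /= !count_cat /=; lia.
split; rewrite //= ?r //; apply/seq.permP=> p.
  by move: (v p); rewrite /= !count_cat /=; lia.
by move: (e p); rewrite /= !count_cat /=; lia.
Qed.

Variables (n : nat) (G : graph n).
Local Notation adj := (adjacent (edges G)).

Definition arc_rel (e : rooted 'I_n) : rel 'I_n :=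
  fun a b => ((a, b) \in arcs e) || ((b, a) \in arcs e).

Lemma arc_relC e : symmetric (arc_rel e).
Proof. by move=> a b; rewrite /arc_rel orbC. Qed.

Lemma adjC : symmetric adj.
Proof. by move=> a b; rewrite /adjacent orbC. Qed.

Lemma arc_connect e : {in verts e &, forall x y, connect (arc_rel e) x y}.
Proof.
have cC : connect_sym (arc_rel e) := sym_connect_sym (arc_relC e).
suff r x : x \in verts e -> connect (arc_rel e) (root e) x.
  by move=> x y /r xr /r; apply: connect_trans; rewrite cC.
have mono (g h : rooted 'I_n) a b : {subset arcs g <= arcs h} ->
    connect (arc_rel g) a b -> connect (arc_rel h) a b.
  move=> gh; apply: connect_sub => u v uv; apply: connect1.
  by case/orP: uv => /gh uv; rewrite /arc_rel uv ?orbT.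
elim: e {cC} => [y|g IHg h IHh] /=; first by rewrite inE => /eqP->; rewrite connect0.
rewrite mem_cat => /orP[/IHg|/IHh]; first by apply: mono => p pg; rewrite inE mem_cat pg orbT.
move=> rh; apply: (@connect_trans _ _ (root h)).
  by apply: connect1; rewrite /arc_rel /= inE eqxx.
by apply: mono rh => p pg; rewrite inE mem_cat pg !orbT.
Qed.

Lemma arc_rel_verts e x y : arc_rel e x y -> (x \in verts e) && (y \in verts e).
Proof. by case/orP=> /arcs_verts //=; rewrite andbC. Qed.

(** A second neighbour x of c would close the path from a to x inside e into a cycle through c with
    at least three vertices. *)
Lemma unique_neighbor e a c x :
  {in verts e &, adj =2 arc_rel e} -> a \in verts e -> x \in verts e ->
  c \notin verts e -> adj a c -> adj x c -> x = a.
Proof.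
move=> eE ae xe ce ac xc; apply/eqP/negPn/negP => xa.
have /connectP[p0 pp0 Dx] := arc_connect ae xe.
move: Dx; case/shortenP: pp0 => p pp up _ Dx.
have pe : {subset a :: p <= verts e}.
  elim: (p) (a) ae pp => [|z q IH] y ye /=; first by move=> _ u; rewrite inE => /eqP->.
  case/andP=> /arc_rel_verts/andP[_ ze] pq u; rewrite inE => /predU1P[->//|].
  exact: IH.
have : ucycleb adj (c :: a :: p).
  rewrite /ucycleb /= rcons_path -Dx xc andbT adjC ac /=.
  have -> : path adj a p.
    elim: (p) (a) pp pe {up Dx ac xa ae} => [|z q IH] y //= /andP[yz pq] pe.
    rewrite eE ?yz /= ?pe ?inE ?eqxx ?orbT //; apply: IH => // u uq.
    by rewrite pe // inE uq orbT.
  by rewrite -[(a \notin p) && _]/(uniq (a :: p)) up andbT; apply: contra ce; apply: pe.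
move/acyclicP; case: p {pp up pe} Dx => [|//] /= Dx.
by rewrite Dx eqxx in xa.
Qed.

Lemma adj_irr x : adj x x = false.
Proof.
by rewrite /adjacent orbb; apply/negP=> xx; have := is_graph_asym (graphP G) xx; rewrite xx.
Qed.

Lemma grow_rooted k : (k < n)%N -> exists e : rooted 'I_n,
  [/\ size (verts e) = k.+1, uniq (verts e) & {in verts e &, adj =2 arc_rel e}].
Proof.
elim: k => [n0|k IH kn].
  exists (Vertex (Ordinal n0)); split=> // x y; rewrite !inE => /eqP-> /eqP->.
  by rewrite adj_irr.
have [e [se ue eE]] := IH (ltnW kn).
have [b be] : exists b, b \notin verts e.
  apply/existsP; rewrite -negb_forall; apply: contraL kn => /forallP all_e.
  rewrite -leqNgt -se -[X in (X <= _)%N](size_enum_ord n).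
  by apply: uniq_leq_size; [exact: enum_uniq|move=> x _; apply: all_e].
have /and4P[_ _ /forallP/(_ (root e))/forallP/(_ b)/connectP[p pp Db] _] := graphP G.
(* The path from the root to [b] leaves [e] at some edge, whose outer end is the vertex to add. *)
have [a [c [ae ce ac]]] : exists a c, [/\ a \in verts e, c \notin verts e & adj a c].
  elim: p (root e) (mem_root e) pp Db => [|z p IHp] y ye /=.
    by move=> _ Db; rewrite Db ye in be.
  case/andP=> yz pp Db; case: (boolP (z \in verts e)) => ze; first exact: IHp ze pp Db.
  by exists y, z.
have [_ pv pa] := add_leafP c ae.
exists (add_leaf a c e); split.
- by rewrite (perm_size pv) /= se.
- by rewrite (perm_uniq pv) /= ce ue.
have arcE x y : arc_rel (add_leaf a c e) x y =
    [|| (x == a) && (y == c), (y == a) && (x == c) | arc_rel e x y].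
  rewrite /arc_rel !(perm_mem pa) !inE !xpair_eqE.
  by case: (_ && _); case: (_ && _) => //=; rewrite ?orbT.
have nc x y : (x == c) || (y == c) -> arc_rel e x y = false.
  by move=> xy; apply: contraNF ce => /arc_rel_verts/andP[xe ye]; case/orP: xy => /eqP <-.
have ca : c != a by apply: contraNneq ce => ->.
have cx x : x \in verts e -> adj x c = (x == a).
  by move=> xe; apply/idP/eqP => [xc|->//]; apply: unique_neighbor eE ae xe ce ac xc.
move=> x y; rewrite !(perm_mem pv) !inE arcE => /predU1P[->|xe] /predU1P[->|ye].
- by rewrite adj_irr eqxx (negbTE ca) nc ?eqxx.
- by rewrite adjC cx // eqxx (negbTE ca) /= nc ?eqxx // orbF andbT.
- by rewrite cx // eqxx andbT (negbTE ca) /= nc ?eqxx ?orbT // !orbF.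
- rewrite eE //.
  have -> : y == c = false by apply: contraNF ce => /eqP <-.
  have -> : x == c = false by apply: contraNF ce => /eqP <-.
  by rewrite !andbF.
Qed.

Lemma spanning_rooted : exists e : rooted 'I_n,
  perm_eq (verts e) (enum 'I_n) /\ adj =2 arc_rel e.
Proof.
have /and4P[n0 _ _ _] := graphP G.
have [|e [se ue eE]] := @grow_rooted n.-1; first by rewrite prednK.
rewrite prednK // in se.
have pe : perm_eq (verts e) (enum 'I_n).
  apply: uniq_perm; rewrite ?enum_uniq //; apply: (uniq_min_size ue _ _).2.
    by move=> x _; rewrite mem_enum.
  by rewrite size_enum_ord se.
by exists e; split=> // x y; apply: eE; rewrite (perm_mem pe) mem_enum.
Qed.

(** Each edge is, up to direction, an arc of the spanning rooted graph, and no edge occurs in both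
    directions. The bound is what makes the middle term of the Arnold relation vanish on a tree. *)
Lemma card_edges : (#|edges G| <= n.-1)%N.
Proof.
have [e [pe eE]] := spanning_rooted.
have sz : (size (arcs e)).+1 = n by rewrite size_arcs (size_verts_enum pe).
have -> : n.-1 = size (arcs e) by rewrite -[X in X.-1]sz.
pose f p : 'I_n * 'I_n := if p \in arcs e then p else (p.2, p.1).
have asym p : p \in edges G -> (p.2, p.1) \notin edges G.
  by case: p => a b; apply: is_graph_asym (graphP G).
rewrite cardE -(size_map f); apply: uniq_leq_size.
  rewrite map_inj_in_uniq ?enum_uniq // => -[a b] [a' b']; rewrite !mem_enum => pG p'G.
  rewrite /f /=; case: ifP => _; case: ifP => _ // [E1 E2]; rewrite ?E1 ?E2 //.
    by move: (asym _ pG); rewrite E1 E2 /= p'G.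
  by move: (asym _ pG); rewrite /= E1 E2 p'G.
move=> q /mapP[[a b]]; rewrite mem_enum /f => pG ->; case: ifP => // nab /=.
by have := eE a b; rewrite /adjacent pG /arc_rel nab /= => <-.
Qed.

End SpanningRooted.

Section ClassSign.
Variables (K : nzRingType) (W : lmodType K).
Notation cls G l := (graph_class (LGraph G l) : cofree_lie W).

(** Induction on the number of edges of G' that G lacks: each of them occurs reversed in G, and
    reversing it costs a sign. *)
Lemma class_same_adjacent n (G G' : graph n) (l : {ffun 'I_n -> W}) :
  adjacent (edges G) =2 adjacent (edges G') ->
  exists k, cls G l = (-1) ^+ k *: cls G' l.
Proof.
move: {2}#|_| (leqnn #|edges G' :\: edges G|) => m.
elim: m G => [|m IH] G.
  rewrite leqn0 cards_eq0 setD_eq0 => /subsetP sub adjE; exists 0%N; rewrite scale1r.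
  suff -> : G = G' by [].
  apply/val_inj/setP => -[a b]; apply/idP/idP => [abG|/sub//].
  have := adjE a b; rewrite {1}/adjacent abG /= => /esym/orP[//|/sub baG].
  by have := is_graph_asym (graphP G) abG; rewrite baG.
have [z mz|/set0Pn[[a b]] abD mz adjE] := eqVneq (edges G' :\: edges G)%SET finset.set0.
  by apply: IH; rewrite z cards0.
move: (abD); rewrite inE => /andP[abG abG'].
have baG : (b, a) \in edges G.
  by have := adjE a b; rewrite /adjacent abG' (negbTE abG) /= => ->.
pose G1 := Graph (flip_is_graph (graphP G) baG).
have [||k Ek] := IH G1.
- rewrite -ltnS; apply: leq_trans mz; rewrite [X in (_ < X)%N](cardsD1 (a, b)) abD ltnS.
  apply/subset_leq_card/subsetP=> p; rewrite !inE negb_or => /andP[/andP[pab]].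
  rewrite pab negb_and negbK => /orP[/eqP pba|->->//].
  by rewrite pba => ba; have := is_graph_asym (graphP G') abG'; rewrite ba.
- move=> x y; rewrite -adjE /adjacent !inE !xpair_eqE.
  have ab : ((b, a) == (a, b)) = false.
    by apply: contraNF abG => /eqP <-.
  have sw u v : ((u, v) == (a, b)) = ((v, u) == (b, a)) by rewrite !xpair_eqE andbC.
  rewrite -!xpair_eqE !sw.
  have [[-> ->]|n1] := (x, y) =P (b, a); first by rewrite baG orbT.
  by have [[-> ->]|n2] := (y, x) =P (b, a); rewrite ?baG ?orbT.
by exists k.+1; rewrite (class_flip l baG (erefl (edges G1))) Ek exprS mulN1r scaleNr.
Qed.

Lemma class_rooted n (G : graph n) (l : {ffun 'I_n -> W}) :
  exists k e, cls G l = (-1) ^+ k *: rclass (rmap l e).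
Proof.
have [e [pe eE]] := spanning_rooted G.
have [|k Ek] := @class_same_adjacent n G (arc_graph pe) l.
  by move=> a b; rewrite eE /arc_rel /adjacent !inE.
by exists k, e; rewrite Ek class_arc_graph.
Qed.
End ClassSign.

(** * Shuffles *)

Section Shuffle.
Variables (X : Type) (M : zmodType).
Implicit Types (u v : seq X) (F : seq X -> M).

(* The sum of F over all shuffles of u and v. *)
Fixpoint shuf u : seq X -> (seq X -> M) -> M :=
  if u is a :: u' then
    fix shuf_u v F :=
      if v is b :: v' then
        shuf u' v (fun s => F (a :: s)) + shuf_u v' (fun s => F (b :: s))
      else F u
  else fun v F => F v.

Lemma shuf_nilr u F : shuf u [::] F = F u. Proof. by case: u. Qed.

Lemma shuf_cons a b u v F :
  shuf (a :: u) (b :: v) F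
  = shuf u (b :: v) (fun s => F (a :: s)) + shuf (a :: u) v (fun s => F (b :: s)).
Proof. by []. Qed.

Lemma eq_shuf u v F F' : F =1 F' -> shuf u v F = shuf u v F'.
Proof.
elim: u v F F' => [|a u IHu] v F F' eF; first exact: eF.
elim: v F F' eF => [|b v IHv] F F' eF; first exact: eF.
by rewrite !shuf_cons; congr (_ + _); [apply: IHu|apply: IHv] => s; apply: eF.
Qed.

Lemma shufC u v F : shuf u v F = shuf v u F.
Proof.
elim: u v F => [|a u IHu] v F; first by rewrite shuf_nilr.
elim: v F => [//|b v IHv] F.
by rewrite !shuf_cons addrC; congr (_ + _); [apply: IHv|apply: IHu].
Qed.

(** [shuf] is defined by recursion on first letters; here the shuffles are sorted by their last
    letter. *)
Lemma shuf_rcons a b u v F :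
  shuf (rcons u a) (rcons v b) F
  = shuf u (rcons v b) (fun s => F (rcons s a))
    + shuf (rcons u a) v (fun s => F (rcons s b)).
Proof.
elim: u v F => [|c u IHu] v F.
  elim: v F => [|e v IHv] F; first by rewrite /= addrC.
  rewrite rcons_cons shuf_cons.
  rewrite [X in _ + X](IHv (fun s => F (e :: s))) /= [RHS]addrCA.
  by congr (_ + (_ + _)).
elim: v F => [|e v IHv] F.
  rewrite rcons_cons /= -![shuf _ [:: b] _]/(shuf _ (rcons [::] b) _) IHu /=.
  by rewrite shuf_nilr -!addrA [_ + F _]addrC.
transitivity (shuf (rcons u a) (rcons (e :: v) b) (fun s => F (c :: s))
  + shuf (rcons (c :: u) a) (rcons v b) (fun s => F (e :: s))); first by [].
by rewrite IHu IHv addrACA.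
Qed.

End Shuffle.

Lemma shuf_map X Y (f : X -> Y) (M : zmodType) u v (F : seq Y -> M) :
  shuf u v (fun s => F (map f s)) = shuf (map f u) (map f v) F.
Proof.
elim: u v F => [|a u IHu] v F //.
elim: v F => [|b v IHv] F //.
congr (_ + _); first exact: (IHu (b :: v) (fun s => F (f a :: s))).
exact: (IHv (fun s => F (f b :: s))).
Qed.

Section SpanSub.
Variables (K : nzRingType) (U : lmodType K).

Lemma in_span_rel (S : U -> Prop) x : S x -> in_span S x.
Proof.
move=> Sx; rewrite -[x]addr0 -[X in X + _]scale1r.
exact: in_span_scale_add Sx (in_span0 _).
Qed.

Lemma in_span_sub (S S' : U -> Prop) x :
  (forall y, S y -> in_span S' y) -> in_span S x -> in_span S' x.
Proof.
move=> sub; elim=> [|c u v Su _ IH]; first exact: in_span0.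
by apply: in_spanD => //; apply: in_spanZ; apply: sub.
Qed.

Lemma in_span_sum (S : U -> Prop) I (r : seq I) (P : pred I) (F : I -> U) :
  (forall i, P i -> in_span S (F i)) -> in_span S (\sum_(i <- r | P i) F i).
Proof.
move=> SF; elim/big_rec: _ => [|i x Pi Sx]; first exact: in_span0.
by apply: in_spanD => //; apply: SF.
Qed.

Lemma in_span_shuf (S : U -> Prop) (X : eqType) (u v : seq X) F :
  (forall s, perm_eq s (u ++ v) -> in_span S (F s)) -> in_span S (shuf u v F).
Proof.
elim: u v F => [|a u IHu] v F SF; first exact: SF.
elim: v F SF => [|b v IHv] F SF; first by apply: SF; rewrite cats0.
rewrite shuf_cons; apply: in_spanD.
  by apply: IHu => s ps; apply: SF; rewrite /= perm_cons.
apply: IHv => s ps; apply: SF; rewrite perm_sym perm_catC /= perm_cons perm_sym.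
by rewrite (perm_trans ps) // perm_catC.
Qed.
End SpanSub.

(** * Words in the Lie coalgebra *)

Section Words.
Variables (K : nzRingType) (W : lmodType K).
Implicit Types (C : rctx W) (s u v : seq W).
Notation rclass := (@rclass K W).

(* Rooted graphs modulo the Arnold relations form a Zinbiel algebra, with
   [Attach] for the half-shuffle. *)
Lemma rclass_half_shuffle C a u b v :
  rclass (rplug C (Attach (long a u) (long b v)))
  = shuf u (b :: v) (fun s => rclass (rplug C (long a s))).
Proof.
move: {2}(size u + size v)%N (leqnn (size u + size v)) => n.
elim: n C a u b v => [|n IH] C a [|c u] b v //= uvn.
pose C' := rcomp C (RRight (Vertex a) RHole).
have CE g : rplug C (Attach (Vertex a) g) = rplug C' g by rewrite rplug_comp.
rewrite rclass_arnold !CE !IH; [|lia..].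
rewrite [X in _ + X]shufC.
by congr (_ + _); apply: eq_shuf => s; rewrite -CE.
Qed.

(** Each component is linearized inside the context formed by the other, and then the two chains are
    merged by [rclass_half_shuffle]. Labels are tracked as a multiset, which keeps lengths and
    letters under control. *)
Lemma rclass_in_span_long C (g : rooted W) :
  in_span (fun x => exists a s, perm_eq (a :: s) (verts g) /\ x = rclass (rplug C (long a s)))
    (rclass (rplug C g)).
Proof.
elim: g C => [x|g IHg h IHh] C; first by apply: in_span_rel; exists x, [::].
have L g' h' : rplug C (Attach g' h') = rplug (rcomp C (RLeft RHole h')) g' by rewrite rplug_comp.
have R g' h' : rplug C (Attach g' h') = rplug (rcomp C (RRight g' RHole)) h' by rewrite rplug_comp.
rewrite L; apply: in_span_sub (IHg _) => _ [a [u [pu ->]]].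
rewrite -L R; apply: in_span_sub (IHh _) => _ [b [v [pv ->]]].
rewrite -R rclass_half_shuffle; apply: in_span_shuf => s ps.
apply: in_span_rel; exists a, s; split=> //=.
have : perm_eq (a :: s) ((a :: u) ++ (b :: v)) by rewrite /= perm_cons.
by move/perm_trans; apply; apply: perm_cat.
Qed.

Definition wclass s : cofree_lie W := if s is a :: s' then rclass (long a s') else 0.

(** Sorted by first letter, the shuffles are the two half-shuffles [Attach g h] and [Attach h g] of
    the chains, which are opposite. *)
Lemma wclass_shuffle u v : u != [::] -> v != [::] -> shuf u v wclass = 0.
Proof.
case: u v => // a u [|b v] // _ _; rewrite shuf_cons [X in _ + X]shufC.
rewrite -(rclass_half_shuffle RHole) -(rclass_half_shuffle RHole) /= rclass_swap.
by rewrite addNr.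
Qed.

(** The shuffles of [rcons u x] with the reversal of [b :: v] add up to 0. Sorting them by their
    last letter, x or b, moves the distinguished letter from x to b at the cost of a sign. *)
Lemma wclass_fold u x v :
  shuf u (rev v) (fun s => wclass (rcons s x)) = (-1) ^+ size v *: wclass (u ++ x :: v).
Proof.
elim: v u x => [|b v IH] u x; first by rewrite shuf_nilr scale1r cats1.
have := wclass_shuffle (u := rcons u x) (v := rev (b :: v)).
rewrite rev_cons -!size_eq0 !size_rcons => /(_ isT isT).
rewrite shuf_rcons IH => /eqP; rewrite addr_eq0 => /eqP ->.
by rewrite -cats1 -catA /= exprS mulN1r scaleNr.
Qed.
End Words.

(** * The Dynkin identity *)

Fixpoint right_normed X (b : X) (t : seq X) : tree X :=
  if t is c :: t' then Node (Leaf b) (right_normed c t') else Leaf b.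

(** Recursion on the first letter, rather than a sum over tuples, matches the peeling of letters in
    [word_pair_rec]. *)
Fixpoint word_sum (I : finType) (M : nmodType) n (G : seq I -> M) : M :=
  if n is m.+1 then \sum_(i : I) word_sum m (fun t => G (i :: t)) else G [::].

Section WordSum.
Variables (I : finType) (M : nmodType).

Lemma eq_word_sum n (G G' : seq I -> M) :
  (forall t, size t = n -> G t = G' t) -> word_sum n G = word_sum n G'.
Proof.
elim: n G G' => [|n IH] G G' eG /=; first exact: eG.
by apply: eq_bigr => i _; apply: IH => t st; apply: eG; rewrite /= st.
Qed.

Lemma word_sumD n (G G' : seq I -> M) :
  word_sum n (fun t => G t + G' t) = word_sum n G + word_sum n G'.
Proof.
elim: n G G' => [//|n IH] G G' /=; rewrite -big_split; apply: eq_bigr => i _.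
exact: IH.
Qed.

Lemma word_sum0 n : word_sum n (fun _ : seq I => 0 : M) = 0.
Proof. by elim: n => //= n IH; rewrite big1. Qed.
End WordSum.

Lemma word_sumZ (I : finType) (K : pzRingType) (M : lmodType K) n (c : K) (G : seq I -> M) :
  word_sum n (fun t => c *: G t) = c *: word_sum n G.
Proof. by elim: n G => //= n IH G; rewrite scaler_sumr; apply: eq_bigr => i _; apply: IH. Qed.

Section WordPairing.
Variables (K : comNzRingType) (I : eqType).
Local Notation P := (rpair (fun x y : I => (x == y)%:R : K)).

Definition word_pair (w t : seq I) : K :=
  if (w, t) is (a :: s, b :: t') then P (long a s) (right_normed b t') else 0.

(** Only the cut at the last arc of a chain detaches a single vertex. *)
Lemma sum_cuts_long_last (x : I) s y (G : rooted I -> K) :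
  \sum_(c <- cuts (long x s)) P c.2 (Leaf y) * G c.1
  = if s is z :: s' then (last z s' == y)%:R * G (long x (belast z s')) else 0.
Proof.
elim: s x G => [|z s IH] x G; first by rewrite big_nil.
rewrite /= big_cons big_map /= (IH z (fun g => G (Attach (Vertex x) g))).
by case: s {IH} => [|z' s]; rewrite /= ?addr0 // mul0r add0r.
Qed.

(** Bracketing with the letter b on the left detaches one vertex from the chain, which must be its
    first or, with a minus sign, its last. *)
Lemma word_pair_rec a x s b c t :
  word_pair [:: a, x & s] [:: b, c & t]
  = (a == b)%:R * word_pair (x :: s) (c :: t)
    - (last x s == b)%:R * word_pair (a :: belast x s) (c :: t).
Proof.
rewrite /word_pair [right_normed b _]/= [LHS]/= big_cons big_map /=.
set T := right_normed c t; set R := \sum_(c <- _) _.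
have {R}-> : R = - \sum_(c <- cuts (long x s)) P c.2 (Leaf b) * P (Attach (Vertex a) c.1) T.
  by rewrite /R -sumrN; apply: eq_bigr => e _; rewrite mul0r add0r.
rewrite (sum_cuts_long_last x s b (fun g => P (Attach (Vertex a) g) T)) -addrA; congr (_ + _).
by case: s => [|z s] /=; rewrite ?oppr0 ?addr0 // mul0r oppr0 add0r.
Qed.
End WordPairing.

Section Dynkin.
Variables (K : comNzRingType) (W : lmodType K) (I : finType) (f : I -> W).
Let F (w : seq I) : cofree_lie W := wclass (map f w).

(** The dual Dynkin operator with a prefix p in front, where the recursion accumulates the letters
    already peeled off. *)
Let Psi p w := word_sum (size w) (fun t => word_pair K w t *: F (p ++ t)).

Let Psi_rec p a x s :
  Psi p [:: a, x & s] = Psi (rcons p a) (x :: s) - Psi (rcons p (last x s)) (a :: belast x s).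
Proof.
have sz : size (a :: belast x s) = size (x :: s) by rewrite /= size_belast.
have sum1 (i : I) (A : cofree_lie W) : \sum_(j : I) (i == j)%:R *: A = A.
  rewrite (bigD1 i) //= eqxx scale1r big1 ?addr0 // => j.
  by rewrite eq_sym => /negbTE->; rewrite scale0r.
rewrite /Psi sz.
have D i : word_sum (size (x :: s)) (fun t => word_pair K [:: a, x & s] (i :: t) *: F (p ++ i :: t))
   = (a == i)%:R *: word_sum (size (x :: s)) (fun t => word_pair K (x :: s) t *: F (rcons p a ++ t))
     - (last x s == i)%:R *: word_sum (size (x :: s))
        (fun t => word_pair K (a :: belast x s) t *: F (rcons p (last x s) ++ t)).
  rewrite -scaleNr -!word_sumZ -word_sumD; apply: eq_word_sum => -[//|c t] _.
  rewrite word_pair_rec scalerBl -!scalerA scaleNr; congr (_ - _).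
    by case: eqP => [->|_]; rewrite ?scale0r ?scale1r // cat_rcons.
  by case: eqP => [->|_]; rewrite ?scale0r ?scale1r // cat_rcons.
transitivity (\sum_i ((a == i)%:R *: word_sum (size (x :: s)) (fun t => word_pair K (x :: s) t *: F (rcons p a ++ t))
     - (last x s == i)%:R *: word_sum (size (x :: s))
        (fun t => word_pair K (a :: belast x s) t *: F (rcons p (last x s) ++ t)))).
  by apply: eq_bigr => i _; exact: D.
by rewrite sumrB !sum1.
Qed.

Variable x0 : I.
Let T p w i := shuf (take i w) (rev (drop i.+1 w)) (fun q => F (p ++ rcons q (nth x0 w i))).

Let T_rec p a s b i : (i <= (size s).+1)%N ->
  T p (a :: rcons s b) i =
  (if (0 < i)%N then T (rcons p a) (rcons s b) i.-1 else 0)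
  + (if (i <= size s)%N then T (rcons p b) (a :: s) i else 0).
Proof.
rewrite /T; case: i => [_|i].
  by rewrite /= add0r !drop0 rev_rcons /= cat_rcons.
rewrite (ltnS i) => li; have -> : (0 < i.+1)%N by [].
have -> : take i.+1 (a :: rcons s b) = a :: take i (rcons s b) by [].
have -> : drop i.+2 (a :: rcons s b) = drop i.+1 (rcons s b) by [].
have [ls|ls] := ltnP i (size s); last first.
  have -> : i = size s by apply/eqP; rewrite eqn_leq li ls.
  rewrite drop_oversize ?size_rcons // -cats1 take_size_cat // !shuf_nilr addr0.
  by rewrite /= cat_rcons.
have -> : take i.+1 (a :: s) = a :: take i s by [].
have -> : drop i.+2 (a :: s) = drop i.+1 s by [].
have -> : drop i.+1 (rcons s b) = rcons (drop i.+1 s) b.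
  by rewrite drop_rcons.
have -> : take i (rcons s b) = take i s by rewrite -cats1 takel_cat // ltnW.
rewrite rev_rcons shuf_cons; congr (_ + _).
  by apply: eq_shuf => q; rewrite /= cat_rcons.
by apply: eq_shuf => q; rewrite /= cat_rcons nth_rcons ls.
Qed.
(** Letters are peeled off both ends of w until only the letter i remains. Those before it leave in
    order, those after it in reverse order and each with a sign, and the two series are interleaved
    at will: hence the shuffle in [T] and the exponent, the number of letters after i. *)
Let PsiE p w : w != [::] ->
  Psi p w = \sum_(i < size w) (-1) ^+ (size w - i.+1) *: T p w i.
Proof.
move: {2}(size w) (erefl (size w)) => n; elim: n p w => [|n IH] p [|a w] //= [sw] _.
case/lastP: w sw => [|s b] sw.
  rewrite big_ord1 /= subnn scale1r /Psi /= /T /=.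
  rewrite (bigD1 a) //= /word_pair /= eqxx scale1r big1 ?addr0 // => i.
  by rewrite eq_sym => /negbTE->; rewrite scale0r.
have ss : size (rcons s b) = (size s).+1 by rewrite size_rcons.
have -> : Psi p (a :: rcons s b) = Psi (rcons p a) (rcons s b) - Psi (rcons p b) (a :: s).
  by case: (s) => [|x s'] /=; rewrite Psi_rec // last_rcons belast_rcons.
rewrite !IH //= -?size_eq0 ?ss //; try by rewrite -sw ss.
rewrite (eq_bigr (fun i : 'I_(size s).+2 =>
   (-1) ^+ ((size s).+2 - i.+1) *: (if (0 < i)%N then T (rcons p a) (rcons s b) i.-1 else 0)
   + (-1) ^+ ((size s).+2 - i.+1) *: (if (i <= size s)%N then T (rcons p b) (a :: s) i else 0)));
  last first.
  by move=> i _; rewrite T_rec ?scalerDr // -ltnS.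
rewrite big_split; congr (_ + _).
  by rewrite [RHS]big_ord_recl /= scaler0 add0r.
rewrite [RHS]big_ord_recr /= ltnn scaler0 addr0 -sumrN; apply: eq_bigr => i _.
have li : (i <= size s)%N by rewrite -ltnS ltn_ord.
by rewrite li -scaleNr [((size s).+2 - _)%N]subSn // exprS mulN1r.
Qed.

(** By [wclass_fold] each term of [PsiE] is the class of w up to a sign, which cancels the sign of
    the term. There is one term for each letter. *)
Lemma cofree_dynkin (w : seq I) : 
  word_sum (size w) (fun t => word_pair K w t *: (wclass (map f t) : cofree_lie W))
  = (size w)%:R *: (wclass (map f w) : cofree_lie W).
Proof.
have [->|w0] := eqVneq w [::]; first by rewrite /= !scaler0.
rewrite -[LHS]/(Psi [::] w) PsiE // -[X in X%:R]card_ord -sum1_card natr_sum scaler_suml.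
apply: eq_bigr => i _; rewrite scale1r /T /F /=.
under eq_shuf do rewrite map_rcons.
rewrite (shuf_map f _ _ (fun q => wclass (rcons q _) : cofree_lie W)) map_rev wclass_fold.
rewrite -map_cons -map_cat -drop_nth // cat_take_drop size_map size_drop.
by rewrite scalerA -exprD addnn -mul2n exprM sqrrN !expr1n scale1r.
Qed.
End Dynkin.

(** * The pairing on the quotients *)

Lemma common_prefixC p q : common_prefix p q = common_prefix q p.
Proof.
elim: p q => [|a p IH] [|b q] //=; rewrite eq_sym IH.
by case: eqP => [->|].
Qed.

Section LeafTriples.
Variable W : Type.
Implicit Type T : tree W.

Definition lca T i j : seq bool :=
  common_prefix (nth [::] (leaf_addresses T) i) (nth [::] (leaf_addresses T) j).

Lemma lcaC T i j : lca T i j = lca T j i.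
Proof. exact: common_prefixC. Qed.

(* The leaves i and j are on the same side of the vertex where k branches off. *)
Definition outer T i j k : Prop :=
  lca T j k = lca T k i /\ (j < k)%N = ~~ (k < i)%N.

(** Follow the three paths from the root to the node where they no longer all take the same branch:
    one of the leaves is alone there. *)
Lemma outer_triple T i j k :
  (i < nleaves T)%N -> (j < nleaves T)%N -> (k < nleaves T)%N ->
  i != j -> j != k -> k != i ->
  [\/ outer T i j k, outer T j k i | outer T k i j].
Proof.
elim: T i j k => [w|l IHl r IHr] i j k; rewrite /nleaves /=.
  by case: i => //; case: j.
rewrite size_cat !size_map -!/(nleaves _).
have aE x : (x < nleaves l + nleaves r)%N ->
    nth [::] (map (cons false) (leaf_addresses l) ++ map (cons true) (leaf_addresses r)) x
    = if (x < nleaves l)%N then false :: nth [::] (leaf_addresses l) x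
      else true :: nth [::] (leaf_addresses r) (x - nleaves l).
  move=> xl; rewrite nth_cat size_map -/(nleaves l).
  by case: ltnP => lx; rewrite (nth_map [::]) // -/(nleaves r); lia.
rewrite /outer /lca => il jl kl ij jk ki.
case li : (i < nleaves l)%N; case lj : (j < nleaves l)%N; case lk : (k < nleaves l)%N;
  rewrite !aE // li lj lk /=.
- by case: (IHl i j k) => // -[e1 e2]; [apply: Or31|apply: Or32|apply: Or33];
    rewrite /lca in e1; rewrite e1 e2.
- by apply: Or31; split=> //; lia.
- by apply: Or33; split=> //; lia.
- by apply: Or32; split=> //; lia.
- by apply: Or32; split=> //; lia.
- by apply: Or33; split=> //; lia.
- by apply: Or31; split=> //; lia.
- case: (IHr (i - nleaves l) (j - nleaves l) (k - nleaves l))%N; try lia.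
  + by move=> [e1 e2]; apply: Or31; rewrite /lca in e1; rewrite e1; split=> //; lia.
  + by move=> [e1 e2]; apply: Or32; rewrite /lca in e1; rewrite e1; split=> //; lia.
  + by move=> [e1 e2]; apply: Or33; rewrite /lca in e1; rewrite e1; split=> //; lia.
Qed.
End LeafTriples.

(** * The relations of the coalgebra under a fixed bijection *)

Section ShapeRelations.
Variables (K : fieldType) (W : Type) (n : nat) (T : tree W).
Variable f : 'I_n -> 'I_(nleaves T).
Hypothesis injf : injective f.

Let hits (E : {set 'I_n * 'I_n}) :=
  all (fun p => [exists e in E, @beta W n T f e == p]) (internal_addresses T).

Let shape (E : {set 'I_n * 'I_n}) : K :=
  if hits E then \prod_(e in E) @beta_sign K W n T f e else 0.

Let shapeE (G : graph n) : shape_pairing K G f = shape (edges G). Proof. by []. Qed.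

Let betaE e : @beta W n T f e = lca T (f e.1) (f e.2).
Proof. by rewrite /beta /leaf_address !(tnth_nth [::]). Qed.

Let betaC a b : @beta W n T f (a, b) = @beta W n T f (b, a).
Proof. by rewrite !betaE lcaC. Qed.

Let signC a b : a != b -> @beta_sign K W n T f (b, a) = - @beta_sign K W n T f (a, b).
Proof.
move=> ab; have : f a != f b :> nat by rewrite (inj_eq val_inj) (inj_eq injf).
by rewrite /beta_sign /=; case: ltngtP; rewrite ?opprK.
Qed.

Lemma shape_reverse (G G' : graph n) a b :
  (a, b) \in edges G -> edges G' = ((b, a) |: (edges G :\ (a, b)))%SET ->
  shape_pairing K G f + shape_pairing K G' f = 0.
Proof.
move=> abG EG'; rewrite !shapeE.
have ba : (b, a) \notin edges G := is_graph_asym (graphP G) abG.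
have ab : a != b by apply: contraNneq ba => Eab; rewrite -{1}Eab Eab in abG *.
have hE : hits (edges G') = hits (edges G).
  apply: eq_all => p; apply/exists_inP/exists_inP=> -[e eG /eqP Ep].
    move: eG; rewrite EG' !inE => /orP[/eqP De|/andP[_ eG]]; last by exists e; rewrite ?Ep.
    by exists (a, b) => //; rewrite betaC -De Ep.
  have [De|ne] := eqVneq e (a, b).
    by exists (b, a); rewrite ?EG' ?inE ?eqxx // betaC -De Ep.
  by exists e; rewrite ?Ep // EG' !inE ne eG orbT.
rewrite /shape hE; case: ifP => // _; last by rewrite addr0.
rewrite EG' big_setU1 ?inE ?(negbTE ba) ?andbF //=.
by rewrite (big_setD1 (a, b)) //= (signC ab) mulNr addrN.
Qed.

Lemma hits_card (E : {set 'I_n * 'I_n}) : hits E -> ((nleaves T).-1 <= #|E|)%N.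
Proof.
move=> /allP h; have -> : (nleaves T).-1 = size (internal_addresses T).
  by rewrite -(size_internal_addresses T).
rewrite cardE -(size_map (@beta W n T f)).
apply: uniq_leq_size; first exact: uniq_internal_addresses.
move=> p /h/exists_inP[e eE /eqP <-]; apply: map_f; by rewrite mem_enum.
Qed.

(** If c branches off first, b -> c and c -> a go to the same internal vertex with opposite signs.
    The first and third terms therefore cancel. In the second, two of at most n - 1 edges share
    their image, so not all n - 1 internal vertices are reached. *)
Let arnold_outer (F : {set 'I_n * 'I_n}) a b c :
  n = nleaves T -> a != b -> b != c -> c != a ->
  (a, b) \notin F -> (b, c) \notin F -> (c, a) \notin F ->
  (#|F :|: [set (b, c); (c, a)]|%SET <= n.-1)%N ->
  outer T (f a) (f b) (f c) ->
  shape (F :|: [set (a, b); (b, c)])%SET + shape (F :|: [set (b, c); (c, a)])%SET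
    + shape (F :|: [set (c, a); (a, b)])%SET = 0.
Proof.
move=> nT ab bc ca abF bcF caF cardE [Elca lts].
have Ebeta : @beta W n T f (b, c) = @beta W n T f (c, a) by rewrite !betaE.
have U2 (E : {set 'I_n * 'I_n}) p q : (E :|: [set p; q] = p |: (q |: E))%SET.
  by apply/setP=> x; rewrite !inE orbC -orbA.
have -> : shape (F :|: [set (b, c); (c, a)])%SET = 0.
  rewrite /shape; case: ifP => // h; exfalso.
  have h' : hits ((b, c) |: F)%SET.
    apply/allP=> p /(allP h)/exists_inP[e eE /eqP Ep]; apply/exists_inP.
    move: eE; rewrite !inE => /orP[eF|/orP[]/eqP De].
    - by exists e; rewrite ?Ep // !inE eF orbT.
    - by exists (b, c); rewrite ?inE ?eqxx // -De Ep.
    - by exists (b, c); rewrite ?inE ?eqxx // Ebeta -De Ep.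
  have := hits_card h'; rewrite -nT leqNgt => /negP; apply.
  apply: leq_trans cardE; apply: proper_card; apply/properP; split.
    by apply/subsetP=> p; rewrite !inE => /orP[->|->]; rewrite ?orbT.
  exists (c, a); rewrite !inE ?eqxx ?orbT // negb_or caF andbT xpair_eqE negb_and.
  by rewrite eq_sym bc.
have hE : hits (F :|: [set (a, b); (b, c)])%SET = hits (F :|: [set (c, a); (a, b)])%SET.
  apply: eq_all => p; apply/exists_inP/exists_inP=> -[e]; rewrite !inE => /or3P[eF|/eqP De|/eqP De] ep.
  - by exists e; rewrite // !inE eF.
  - by exists e; rewrite // !inE De eqxx !orbT.
  - by exists (c, a); rewrite ?inE ?eqxx ?orbT // -Ebeta -De.
  - by exists e; rewrite // !inE eF.
  - by exists (b, c); rewrite ?inE ?eqxx ?orbT // Ebeta -De.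
  - by exists e; rewrite // !inE De eqxx !orbT.
rewrite addr0 /shape hE; case: ifP => // _; last by rewrite addr0.
have ne1 : (a, b) \notin ((b, c) |: F)%SET.
  by rewrite !inE negb_or abF andbT xpair_eqE negb_and ab.
have ne2 : (c, a) \notin ((a, b) |: F)%SET.
  by rewrite !inE negb_or caF andbT xpair_eqE negb_and ca.
rewrite !U2 !big_setU1 //= /beta_sign /= lts.
set P := \prod_(i in F) _.
by case: (f c < f a)%N => /=; case: (f a < f b)%N => /=; ring.
Qed.

(** The relation is invariant under cyclic permutations of a, b, c, so the outer vertex may be
    called c. None of the three edges lies in F, because it would complete a triangle. *)
Lemma shape_arnold (G1 G2 G3 : graph n) (F : {set 'I_n * 'I_n}) a b c :
  n = nleaves T ->
  edges G1 = (F :|: [set (a, b); (b, c)])%SET ->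
  edges G2 = (F :|: [set (b, c); (c, a)])%SET ->
  edges G3 = (F :|: [set (c, a); (a, b)])%SET ->
  shape_pairing K G1 f + shape_pairing K G2 f + shape_pairing K G3 f = 0.
Proof.
move=> nT E1 E2 E3.
have irr (G : graph n) x y : (x, y) \in edges G -> x != y.
  move=> xy; apply/negP=> /eqP Exy; rewrite Exy in xy.
  by have := is_graph_asym (graphP G) xy; rewrite xy.
have ab : a != b by apply: (irr G1); rewrite E1 !inE eqxx !orbT.
have bc : b != c by apply: (irr G1); rewrite E1 !inE eqxx !orbT.
have ca : c != a by apply: (irr G2); rewrite E2 !inE eqxx !orbT.
have tri (G : graph n) : (a, b) \in edges G -> (b, c) \in edges G -> (c, a) \in edges G -> False.
  move=> xab xbc xca; have : ucycleb (adjacent (edges G)) [:: a; b; c].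
    by rewrite /ucycleb /= /adjacent xab xbc xca /= !inE negb_or ab bc eq_sym ca.
  by move/acyclicP.
have abF : (a, b) \notin F.
  by apply/negP=> h; apply: (tri G2); rewrite E2 !inE ?h ?eqxx ?orbT.
have bcF : (b, c) \notin F.
  by apply/negP=> h; apply: (tri G3); rewrite E3 !inE ?h ?eqxx ?orbT.
have caF : (c, a) \notin F.
  by apply/negP=> h; apply: (tri G1); rewrite E1 !inE ?h ?eqxx ?orbT.
rewrite !shapeE E1 E2 E3.
have nef x y : x != y -> f x != f y :> nat by rewrite (inj_eq val_inj) (inj_eq injf).
have c1 := card_edges G1; rewrite E1 in c1.
have c2 := card_edges G2; rewrite E2 in c2.
have c3 := card_edges G3; rewrite E3 in c3.
case: (outer_triple (ltn_ord (f a)) (ltn_ord (f b)) (ltn_ord (f c)) (nef _ _ ab) (nef _ _ bc) (nef _ _ ca)) => o.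
- exact: arnold_outer.
- by have := arnold_outer nT bc ca ab bcF caF abF c3 o; rewrite addrC addrA.
- by have := arnold_outer nT ca ab bc caF abF bcF c1 o; rewrite -addrA addrC.
Qed.
End ShapeRelations.

Section GenPairingRelations.
Variables (K : fieldType) (V : vectType K).
Notation W := (dual_space V).
Implicit Types (T : tree V).

Lemma gen_pairing_iso n (G G' : graph n) (l l' : {ffun 'I_n -> W}) (s : {perm 'I_n}) T :
  (forall a b, ((a, b) \in edges G) = ((s a, s b) \in edges G')) ->
  (forall a, l a = l' (s a)) ->
  gen_pairing (LGraph G l) T = gen_pairing (LGraph G' l') T.
Proof.
move=> eG el; rewrite /gen_pairing /=.
rewrite (reindex (fun h : {ffun 'I_n -> 'I_(nleaves T)} => [ffun a => h (s a)])) /=; last first.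
  exists (fun h : {ffun 'I_n -> 'I_(nleaves T)} => [ffun a => h ((s^-1)%g a)]) => h _;
    by apply/ffunP=> a; rewrite !ffunE ?permK ?permKV.
apply: eq_big => h.
  congr (_ && _); apply/injectiveP/injectiveP => injh a b.
    by move=> Eh; apply: (can_inj (permKV s)); apply: injh; rewrite !ffunE !permKV.
  by rewrite !ffunE => /injh/perm_inj.
move=> _; congr (_ * _); last first.
  rewrite [RHS](reindex_inj (@perm_inj _ s)) /=.
  by apply: eq_bigr => i _; rewrite el ffunE.
pose ss (p : 'I_n * 'I_n) := (s p.1, s p.2).
have ssI : injective ss by move=> [a b] [a' b'] [/perm_inj-> /perm_inj->].
have eGp p : (p \in edges G) = (ss p \in edges G') by case: p => a b; apply: eG.
have ss_onto p : exists q, p = ss q.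
  by exists ((s^-1)%g p.1, (s^-1)%g p.2); rewrite /ss /= !permKV; case: p.
have eb p : beta [ffun a => h (s a)] p = beta h (ss p) by rewrite /beta !ffunE.
rewrite /shape_pairing (eq_all (a2 := fun p => [exists e in edges G', beta h e == p])).
  case: ifP => // _; rewrite [RHS](reindex_inj ssI) /=.
  by apply: eq_big => p; rewrite ?eGp // => _; rewrite /beta_sign !ffunE.
move=> p; apply/exists_inP/exists_inP => -[e eE ep].
  by exists (ss e); rewrite -?eGp -?eb.
by have [q Dq] := ss_onto e; exists q; rewrite ?eGp ?eb -?Dq.
Qed.

Lemma gen_pairing_multilinear n (G : graph n) (l : {ffun 'I_n -> W}) i (c : K) x y T :
  gen_pairing (LGraph G (relabel l i (c *: x + y))) T
  = c * gen_pairing (LGraph G (relabel l i x)) T + gen_pairing (LGraph G (relabel l i y)) T.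
Proof.
rewrite /gen_pairing /= mulr_sumr -big_split; apply: eq_bigr => f _ /=.
have D z : \prod_(j < n) (relabel l i z j (leaf_label (f j)) : K) =
    (z (leaf_label (f i)) : K) * \prod_(j < n | j != i) (l j (leaf_label (f j)) : K).
  rewrite (bigD1 i) //= ffunE eqxx; congr (_ * _).
  by apply: eq_bigr => j ji; rewrite ffunE (negbTE ji).
rewrite !D add_lfunE scale_lfunE; set P := \prod_(_ < _ | _) _.
rewrite -[c *: (x _ : K^o)]/(c * x (leaf_label (f i))).
by set u := x _; set w := y _; ring.
Qed.

End GenPairingRelations.

(** * Linear maps out of free modules and quotients *)

Section FreegLift.
Variables (K : nzRingType) (S : choiceType) (M : lmodType K) (F : S -> M).

Lemma fglift_dom D : fglift F D = \sum_(x <- dom D) coeff x D *: F x.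
Proof.
rewrite -{1}[D]Freeg_dom fglift_Freeg /prelift big_map.
by apply: eq_bigr => x _.
Qed.

Lemma fglift_sub D (s : seq S) : uniq s -> {subset dom D <= s} ->
  fglift F D = \sum_(x <- s) coeff x D *: F x.
Proof.
move=> us sub; rewrite (bigID (mem (dom D))) /= [X in _ + X]big1 ?addr0; last first.
  by move=> x /coeff_outdom ->; rewrite scale0r.
rewrite -big_filter fglift_dom; apply: perm_big; apply: uniq_perm.
- exact: uniq_dom.
- exact: filter_uniq.
by move=> x; rewrite mem_filter /=; apply/idP/andP => [xD|[]//]; rewrite xD sub.
Qed.

Lemma fglift_is_linear : linear (fglift F).
Proof.
move=> c D E; pose s := undup (dom D ++ dom E ++ dom (c *: D + E)).
rewrite !(@fglift_sub _ s) ?undup_uniq // => [|x xD|x xD|x xD].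
- rewrite scaler_sumr -big_split; apply: eq_bigr => x _ /=.
  by rewrite coeffD coeffZ scalerDl scalerA.
- by rewrite mem_undup !mem_cat xD ?orbT.
- by rewrite mem_undup !mem_cat xD ?orbT.
- by rewrite mem_undup !mem_cat xD ?orbT.
Qed.

Definition freeg_lift : {linear {freeg S / K} -> M} :=
  HB.pack (fglift F) (GRing.isLinear.Build K _ _ *:%R _ fglift_is_linear).

Lemma freeg_liftU x : freeg_lift << x >> = F x.
Proof. by rewrite /freeg_lift /= liftU scale1r. Qed.
End FreegLift.

Section QuotientLift.
Variables (K : nzRingType) (U M : lmodType K) (rel : U -> Prop) (phi : {linear U -> M}).
Hypothesis phi_rel : forall u, rel u -> phi u = 0.

Lemma in_span_ker u : in_span rel u -> phi u = 0.
Proof.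
elim=> [|c v w /phi_rel pv _ pw]; first exact: linear0.
by rewrite linearP pv pw scaler0 addr0.
Qed.

Lemma phi_repr u : phi (repr (\pi_(quotmod rel)%qT u)) = phi u.
Proof.
apply/eqP; rewrite -subr_eq0 -linearB /=; apply/eqP/in_span_ker/quotmod_piP.
by rewrite reprK.
Qed.

Lemma quot_lift_is_linear : linear (fun x : quotmod rel => phi (repr x)).
Proof.
move=> c; elim/quotW=> u; elim/quotW=> v.
have <- := quotmod_pi_linear rel c u v.
by rewrite !phi_repr linearP.
Qed.

Definition quot_lift : {linear quotmod rel -> M} :=
  HB.pack (fun x : quotmod rel => phi (repr x))
    (GRing.isLinear.Build K _ _ *:%R _ quot_lift_is_linear).

Lemma quot_liftE u : quot_lift (\pi_(quotmod rel)%qT u) = phi u.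
Proof. exact: phi_repr. Qed.
End QuotientLift.

Section PairWithTree.
Variables (K : fieldType) (V : vectType K) (T : tree V).
Notation W := (dual_space V).

Definition free_pair_tree : {linear {freeg (lgraph W) / K} -> K^o} :=
  freeg_lift (fun g => gen_pairing g T : K^o).

Lemma free_pair_tree_rel u : graph_rel u -> free_pair_tree u = 0.
Proof.
have U g : free_pair_tree (graph_gen g) = gen_pairing g T by apply: freeg_liftU.
case=> [n G G' l l' s eG el|n G l i c x y|n G G' l a b ab EG'|n G1 G2 G3 l F a b c E1 E2 E3].
- by rewrite linearB !U (gen_pairing_iso T eG el) subrr.
- rewrite !linearB linearZ !U gen_pairing_multilinear.
  set A := gen_pairing _ _; set B := gen_pairing _ _.
  by rewrite -[X in _ - X - _]/(c * A) addrAC addrK subrr.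
- rewrite linearD !U /gen_pairing /= -big_split big1 //= => f /andP[/injectiveP injf _].
  by rewrite -mulrDl (shape_reverse K injf ab EG') mul0r.
- rewrite !linearD !U /gen_pairing /= -!big_split big1 //= => f.
  case/andP=> /injectiveP injf /eqP nT.
  by rewrite -!mulrDl (shape_arnold K injf nT E1 E2 E3) mul0r.
Qed.

Definition pair_tree : {linear cofree_lie W -> K^o} := quot_lift free_pair_tree_rel.

Lemma pair_tree_class g : pair_tree (graph_class g) = gen_pairing g T.
Proof. by rewrite /pair_tree quot_liftE; apply: freeg_liftU. Qed.
End PairWithTree.

(** * Trees as functionals on words *)

Section Convolution.
Variables (K : comPzRingType) (X : Type).
Implicit Types (f g h : seq X -> K) (w : seq X).

(* Dual to the deconcatenation of words. *)
Fixpoint conv f g w : K :=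
  f [::] * g w + (if w is a :: w' then conv (fun s => f (a :: s)) g w' else 0).

Lemma eq_conv f f' g g' w : f =1 f' -> g =1 g' -> conv f g w = conv f' g' w.
Proof.
elim: w f f' => [|a w IH] f f' ef eg /=; first by rewrite ef eg.
by rewrite ef eg (IH _ (fun s => f' (a :: s))).
Qed.

Lemma convDl f f' g w : conv (fun s => f s + f' s) g w = conv f g w + conv f' g w.
Proof. by elim: w f f' => [|a w IH] f f' /=; rewrite ?IH; ring. Qed.

Lemma convDr f g g' w : conv f (fun s => g s + g' s) w = conv f g w + conv f g' w.
Proof. by elim: w f => [|a w IH] f /=; rewrite ?IH; ring. Qed.

Lemma convZl c f g w : conv (fun s => c * f s) g w = c * conv f g w.
Proof. by elim: w f => [|a w IH] f /=; rewrite ?IH; ring. Qed.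

Lemma convZr c f g w : conv f (fun s => c * g s) w = c * conv f g w.
Proof. by elim: w f => [|a w IH] f /=; rewrite ?IH; ring. Qed.

Lemma convNl f g w : conv (fun s => - f s) g w = - conv f g w.
Proof. by elim: w f => [|a w IH] f /=; rewrite ?IH; ring. Qed.

Lemma convNr f g w : conv f (fun s => - g s) w = - conv f g w.
Proof. by elim: w f => [|a w IH] f /=; rewrite ?IH; ring. Qed.

Lemma conv0l g w : conv (fun=> 0) g w = 0.
Proof. by elim: w => [|a w IH] /=; rewrite ?IH; ring. Qed.

Lemma conv0r f w : conv f (fun=> 0) w = 0.
Proof. by elim: w f => [|a w IH] f /=; rewrite ?IH; ring. Qed.

Lemma convA f g h w : conv f (conv g h) w = conv (conv f g) h w.
Proof.
elim: w f g => [|a w IH] f g /=; first by ring.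
rewrite IH (convDl (fun s => f [::] * g (a :: s))) convZl; ring.
Qed.

Lemma convE f g w :
  conv f g w = \sum_(i <- iota 0 (size w).+1) f (take i w) * g (drop i w).
Proof.
elim: w f => [|a w IH] f; first by rewrite /= big_seq1 addr0.
rewrite [LHS]/= IH -[iota 0 (size (a :: w)).+1]/(0%N :: iota (1 + 0) (size w).+1).
by rewrite (iotaDl 1 0) [in RHS]big_cons big_map.
Qed.
End Convolution.

Section TreeWords.
Variables (K : comPzRingType) (X : eqType) (Y : Type) (b : X -> Y -> K).

(** Cutting a linear chain is deconcatenating a word, so pairing with a node is a commutator for the
    convolution. Antisymmetry is then clear and Jacobi follows from associativity. *)
Fixpoint tree_words (T : tree Y) : seq X -> K :=
  match T with
  | Leaf y => fun w => if w is [:: x] then b x y else 0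
  | Node l r => fun w =>
      conv (tree_words l) (tree_words r) w - conv (tree_words r) (tree_words l) w
  end.

Lemma tree_words_nil T : tree_words T [::] = 0.
Proof. by elim: T => //= l -> r ->; rewrite !mul0r !addr0 subrr. Qed.

Lemma rpair_long a s T : rpair b (long a s) T = tree_words T (a :: s).
Proof.
elim: T a s => [y|l IHl r IHr] a s /=; first by case: s.
rewrite !tree_words_nil !mul0r !add0r !convE -addn1 iotaD !big_cat /= !big_seq1.
rewrite add0n !drop_size !tree_words_nil !mulr0 !addr0 cuts_long big_map -sumrB.
rewrite !big_seq; apply: eq_bigr => i; rewrite mem_iota add0n /= => li.
rewrite !IHl !IHr; suff -> : head a (drop i s) :: behead (drop i s) = drop i s by ring.
by case: (drop i s) (size_drop i s) => //= /eqP; rewrite eq_sym subn_eq0 leqNgt li.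
Qed.

End TreeWords.

Section TreeWordsRelations.
Variables (K : fieldType) (V : vectType K).
Notation W := (dual_space V).
Notation tw := (tree_words (fun (f : W) (y : V) => f y : K)).

(** The coefficients (1, -a, -1), (1, 1, 0) and (1, 1, 1) give multilinearity, antisymmetry and
    Jacobi, so one induction on contexts serves all three. *)
Lemma tree_words_plug (c1 c2 c3 : K) (t1 t2 t3 : tree V) :
  (forall w, c1 * tw t1 w + c2 * tw t2 w + c3 * tw t3 w = 0) ->
  forall C w, c1 * tw (plug C t1) w + c2 * tw (plug C t2) w + c3 * tw (plug C t3) w = 0.
Proof.
move=> H; elim=> [|C IH r|l C IH] w //=.
  transitivity (conv (fun s => c1 * tw (plug C t1) s + c2 * tw (plug C t2) s + c3 * tw (plug C t3) s) (tw r) w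
     - conv (tw r) (fun s => c1 * tw (plug C t1) s + c2 * tw (plug C t2) s + c3 * tw (plug C t3) s) w).
    by rewrite !(convDl, convDr, convZl, convZr); ring.
  rewrite (eq_conv (f' := fun=> 0) (g' := tw r)) // conv0l.
  by rewrite (eq_conv (f' := tw r) (g' := fun=> 0)) // conv0r subrr.
transitivity (conv (tw l) (fun s => c1 * tw (plug C t1) s + c2 * tw (plug C t2) s + c3 * tw (plug C t3) s) w
   - conv (fun s => c1 * tw (plug C t1) s + c2 * tw (plug C t2) s + c3 * tw (plug C t3) s) (tw l) w).
  by rewrite !(convDl, convDr, convZl, convZr); ring.
rewrite (eq_conv (f' := tw l) (g' := fun=> 0)) // conv0r.
by rewrite (eq_conv (f' := fun=> 0) (g' := tw l)) // conv0l subrr.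
Qed.

Lemma pair_tree_rclass (g : rooted W) T :
  pair_tree T (rclass g) = rpair (fun (f : W) (y : V) => f y : K) g T.
Proof.
rewrite pair_tree_class; have [o [ro mo _]] := pg_represents g.
rewrite /lgraph_of_pgraph (gen_pairingE _ _ ro) -[g in RHS]mo.
elim: T (o) => [y|l IHl r IHr] e /=; first by case: e.
by rewrite cuts_rmap big_map; apply: eq_bigr => c _; rewrite /= !IHl !IHr.
Qed.

Lemma pair_tree_wclass a s T : pair_tree T (wclass (a :: s)) = tw T (a :: s).
Proof. by rewrite pair_tree_rclass rpair_long. Qed.
End TreeWordsRelations.

Section CofreeSpan.
Variables (K : nzRingType) (W : lmodType K).

Lemma freeg_span (S : choiceType) (P : {freeg S / K} -> Prop) :
  P 0 -> (forall c x u, P u -> P (c *: << x >> + u)) -> forall u, P u.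
Proof.
move=> P0 PD u; rewrite -[u]freeg_sumE; elim: (dom u) => [|x s IH]; first by rewrite big_nil.
rewrite big_cons; have -> : << coeff x u *g x >> = coeff x u *: << x >> :> {freeg S / K}.
  by apply/eqP/freeg_eqP => y; rewrite coeffZ !coeffU mul1r.
exact: PD.
Qed.

Lemma cofree_span_class (x : cofree_lie W) :
  in_span (fun y => exists n (G : graph n) l, y = graph_class (LGraph G l)) x.
Proof.
elim/quotW: x; apply: freeg_span => [|c g u IH].
  have -> : \pi_(quotmod (@graph_rel K W))%qT 0 = 0 :> cofree_lie W.
    exact: linear0 (quotmod_pi (@graph_rel K W)).
  exact: in_span0.
have -> := quotmod_pi_linear (@graph_rel K W) c << g >> u.
by apply: in_span_scale_add IH; case: g => n [G l]; exists n, G, l.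
Qed.

Lemma cofree_span_wclass (x : cofree_lie W) :
  in_span (fun y => exists a s, y = wclass (a :: s)) x.
Proof.
apply: in_span_sub (cofree_span_class x) => _ [n [G [l ->]]].
have [k [e ->]] := class_rooted G l; apply: in_spanZ.
apply: in_span_sub (rclass_in_span_long RHole (rmap l e)) => _ [a [s [_ ->]]].
by apply: in_span_rel; exists a, s.
Qed.
End CofreeSpan.

(** * Descent of the configuration pairing *)

Section ConfPairing.
Variables (K : fieldType) (V : vectType K).
Notation W := (dual_space V).
Notation tw := (tree_words (fun (f : W) (y : V) => f y : K)).

Definition free_pair_graph (x : cofree_lie W) : {linear {freeg (tree V) / K} -> K^o} :=
  freeg_lift (fun t => pair_tree t x).

(** E is spanned by words, so a relation between trees has to be checked on words only, that is in
    the convolution algebra. *)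
Lemma pair_tree_comb (c1 c2 c3 : K) (t1 t2 t3 : tree V) (x : cofree_lie W) :
  (forall w, c1 * tw t1 w + c2 * tw t2 w + c3 * tw t3 w = 0) ->
  c1 * pair_tree t1 x + c2 * pair_tree t2 x + c3 * pair_tree t3 x = 0.
Proof.
move=> H; elim: (cofree_span_wclass x) => [|c _ v [a [s ->]] _ IH].
  by rewrite !linear0; ring.
rewrite !linearP !pair_tree_wclass; set p1 := pair_tree _ _ in IH *.
set p2 := pair_tree _ _ in IH *; set p3 := pair_tree _ _ in IH *.
transitivity (c * (c1 * tw t1 (a :: s) + c2 * tw t2 (a :: s) + c3 * tw t3 (a :: s))
  + (c1 * p1 + c2 * p2 + c3 * p3)); last by rewrite H IH mulr0 addr0.
by rewrite -![_ *: _]/(_ * _); ring.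
Qed.

Lemma free_pair_graph_rel x u : tree_rel u -> free_pair_graph x u = 0.
Proof.
have U t : free_pair_graph x (tree_gen t) = pair_tree t x by apply: freeg_liftU.
case=> [C a y z|C s t|C r s t].
- rewrite !linearB linearZ !U.
  have := @pair_tree_comb 1 (- a) (-1) (plug C (Leaf (a *: y + z))) (plug C (Leaf y)) (plug C (Leaf z)) x.
  rewrite !mul1r !mulN1r mulNr => -> //; apply: tree_words_plug.
  case=> [|f [|? ?]] /=; rewrite ?mulr0 ?addr0 // linearP.
  by rewrite -[X in 1 * (X + _)]/(a * f y) -[X in 1 * (_ + X)]/(f z); ring.
- rewrite linearD !U.
  have := @pair_tree_comb 1 1 0 (plug C (Node s t)) (plug C (Node t s)) (plug C (Leaf 0)) x.
  rewrite !mul1r mul0r addr0 => -> //; apply: tree_words_plug => w /=.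
  by ring.
- rewrite !linearD !U.
  have := @pair_tree_comb 1 1 1 (plug C (Node (Node r s) t)) (plug C (Node (Node s t) r))
    (plug C (Node (Node t r) s)) x.
  rewrite !mul1r => -> //; apply: tree_words_plug => w /=.
  rewrite !(convDl, convDr, convNl, convNr) !convA; ring.
Qed.

Lemma pair_tree_dom t (x : cofree_lie W) :
  let u := repr (x : quotmod (@graph_rel K W)) in
  pair_tree t x = \sum_(g <- dom u) coeff g u * gen_pairing g t.
Proof. exact: fglift_dom. Qed.

(** Exchanging the two sums shows that the pairing of chosen representatives is a lifted linear map,
    whatever the choice. *)
Lemma conf_pairing_quot_lift x y : conf_pairing x y = quot_lift (@free_pair_graph_rel x) y.
Proof.
rewrite /conf_pairing /free_pairing exchange_big [RHS]fglift_dom /=.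
apply: eq_bigr => t _; rewrite [X in _ *: X]pair_tree_dom scaler_sumr.
by apply: eq_bigr => g _; rewrite [RHS]mulrCA mulrA.
Qed.

Lemma conf_pairing_linearr (x : cofree_lie W) : linear (conf_pairing x : free_lie V -> K^o).
Proof. by move=> c y z; rewrite !conf_pairing_quot_lift linearP. Qed.

Lemma conf_pairing_tree x (t : tree V) : conf_pairing x (tree_class t) = pair_tree t x.
Proof. by rewrite conf_pairing_quot_lift quot_liftE; exact: (freeg_liftU (fun t => pair_tree t x : K^o)). Qed.

Lemma conf_pairing_linearl (y : free_lie V) : linear (fun x => conf_pairing x y : K^o).
Proof.
move=> c x x'; rewrite !conf_pairing_quot_lift ![quot_lift _ y]fglift_dom scaler_sumr -big_split.
apply: eq_bigr => t _; rewrite linearP scalerDr !scalerA mulrC.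
by [].
Qed.
End ConfPairing.

(** * Lyndon words *)

Section Lex.
Variables (A : eqType) (r : rel A).

(** The alphabet is arbitrary because the order is iterated: words of one level are the letters of
    the next. *)
Fixpoint lexlt (s t : seq A) : bool :=
  match s, t with
  | _, [::] => false
  | [::], _ => true
  | a :: s', b :: t' => r a b || (a == b) && lexlt s' t'
  end.

Hypotheses (r_irr : irreflexive r) (r_tr : transitive r)
  (r_total : forall a b, [|| r a b, a == b | r b a]).

Lemma lexlt_irr : irreflexive lexlt.
Proof. by elim=> //= a s ->; rewrite r_irr andbF. Qed.

Lemma lexlt_trans : transitive lexlt.
Proof.
elim=> [|b t IH] [|a s] [|c u] //= /orP[ab|/andP[/eqP-> st]] /orP[bc|/andP[/eqP<- tu]].
- by rewrite (r_tr ab bc).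
- by rewrite ab.
- by rewrite bc.
- by rewrite eqxx (IH _ _ st tu) orbT.
Qed.

Lemma lexlt_total s t : [|| lexlt s t, s == t | lexlt t s].
Proof.
elim: s t => [|a s IH] [|b t] //=; rewrite eqseq_cons [b == a]eq_sym.
case/or3P: (r_total a b) => [->|/eqP->|->]; rewrite ?orbT // eqxx /=.
by case/or3P: (IH t) => ->; rewrite ?orbT.
Qed.

Lemma lexlt_catl p s t : lexlt (p ++ s) (p ++ t) = lexlt s t.
Proof. by elim: p => //= a p ->; rewrite r_irr eqxx. Qed.

Lemma lexlt_prefix s t : t != [::] -> lexlt s (s ++ t).
Proof. by rewrite -{1}[s]cats0 lexlt_catl; case: t. Qed.

Lemma lexltP s t : lexlt s t ->
  (exists2 u, u != [::] & t = s ++ u) \/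
  (exists p a b s' t', [/\ s = p ++ a :: s', t = p ++ b :: t' & r a b]).
Proof.
elim: s t => [|a s IH] [|b t] //=; first by left; exists (b :: t).
case/orP=> [ab|/andP[/eqP-> /IH[[u u0 ->]|[p [a' [b' [s' [t' [-> -> ab]]]]]]]]].
- by right; exists [::], a, b, s, t.
- by left; exists u.
- by right; exists (b :: p), a', b', s', t'.
Qed.

Lemma lexlt_diff p a b s t : r a b -> lexlt (p ++ a :: s) (p ++ b :: t).
Proof. by move=> ab; rewrite lexlt_catl /= ab. Qed.

Lemma lexlt_cat s t x y : lexlt s t -> (size t <= size s)%N ->
  lexlt (s ++ x) (t ++ y).
Proof.
move=> /lexltP[[u u0 ->]|[p [a [b [s' [t' [-> -> ab]]]]]] _].
  by rewrite size_cat -[X in (_ <= X)%N]addn0 leq_add2l leqn0 size_eq0 (negbTE u0).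
by rewrite -!catA; apply: lexlt_diff.
Qed.

(** The classical equivalent of minimality among rotations, which behaves well under
    concatenation. *)
Definition suffix_lyndon (w : seq A) : Prop :=
  w != [::] /\ forall u v, u != [::] -> v != [::] -> w = u ++ v -> lexlt w v.

Lemma suffix_lyndon_rot w i : suffix_lyndon w -> (0 < i < size w)%N -> lexlt w (rot i w).
Proof.
case=> w0 sl /andP[i0 iw]; rewrite /rot -{1}[w]cats0; apply: lexlt_cat.
  apply: (sl (take i w)); rewrite ?cat_take_drop // -size_eq0 ?size_drop ?size_take ?iw; lia.
by rewrite size_drop leq_subr.
Qed.

(** Suppose w = uv with v not greater than w. If v and w differ at some letter, the rotation vu is
    smaller than w. If w = vt, then w < vu gives t < u, so the rotation tv is smaller than uv =
    w. *)
Lemma rot_suffix_lyndon w : w != [::] ->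
  (forall i, (0 < i < size w)%N -> lexlt w (rot i w)) -> suffix_lyndon w.
Proof.
move=> w0 rw; split=> // u v u0 v0 Dw.
have u1 : (0 < size u)%N by rewrite lt0n size_eq0.
have v1 : (0 < size v)%N by rewrite lt0n size_eq0.
have sw : size w = (size u + size v)%N by rewrite Dw size_cat.
have su : (0 < size u < size w)%N by lia.
have ru : rot (size u) w = v ++ u by rewrite Dw rot_size_cat.
have wr := rw _ su; rewrite ru in wr.
case/or3P: (lexlt_total w v) => // [/eqP Ewv|/lexltP[[t t0 Ew]|[p [a [b [s' [t' [Ev Ew ab]]]]]]]].
- by move: sw; rewrite Ewv; lia.
- have st : size t = size u by have := congr1 size Ew; rewrite size_cat; lia.
  have tu : lexlt t u by move: wr; rewrite {1}Ew lexlt_catl.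
  have vv : (0 < size v < size w)%N by lia.
  have := rw _ vv; rewrite {2}Ew rot_size_cat => wtv.
  have : lexlt (t ++ v) w by rewrite Dw; apply: lexlt_cat => //; rewrite st.
  by move/(lexlt_trans wtv); rewrite lexlt_irr.
- have : lexlt (v ++ u) w by rewrite Ev Ew -catA; apply: lexlt_diff.
  by move/(lexlt_trans wr); rewrite lexlt_irr.
Qed.

(** The point is uv < v: a suffix inside v is at least v, and a suffix starting inside u is compared
    with u before v comes into play. *)
Lemma suffix_lyndon_cat u v : suffix_lyndon u -> suffix_lyndon v -> lexlt u v ->
  suffix_lyndon (u ++ v).
Proof.
move=> [u0 su] [v0 sv] uv; split; first by case: (u) u0.
have uvv : lexlt (u ++ v) v.
  case/lexltP: (uv) => [[t t0 Ev]|[p [a [b [s' [t' [Eu Ev ab]]]]]]].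
    by rewrite [in X in lexlt _ X]Ev lexlt_catl; apply: (sv u).
  by rewrite [in X in lexlt _ X]Ev {1}Eu -catA; apply: lexlt_diff.
move=> p q p0 q0 Epq.
have Ep : p = take (size p) (u ++ v) by rewrite Epq take_size_cat.
have Eq : q = drop (size p) (u ++ v) by rewrite Epq drop_size_cat.
case: (ltngtP (size p) (size u)) => sz.
- rewrite drop_cat sz in Eq; rewrite Eq; apply: lexlt_cat; last by rewrite size_drop leq_subr.
  apply: (su (take (size p) u)); rewrite ?cat_take_drop // -size_eq0 ?size_drop ?size_take ?sz.
    by rewrite size_eq0.
  by rewrite subn_eq0 -ltnNge.
- rewrite drop_cat ltnNge ltnW //= in Eq.
  apply: lexlt_trans uvv _; apply: (sv (take (size p - size u) v)).
  + have := congr1 size Epq; rewrite !size_cat -!size_eq0 size_take; case: ltnP; lia.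
  + exact: q0.
  + by rewrite Eq cat_take_drop.
- by rewrite Eq sz drop_size_cat.
Qed.
End Lex.

Lemma lexlt_ord d (s t : seq 'I_d) :
  lexlt (fun i j : 'I_d => i < j)%N s t = ((s : seqlexi 'I_d) < (t : seqlexi 'I_d))%O.
Proof.
elim: s t => [|i s IH] [|j t] //=.
rewrite ltxi_cons IH !leEord -val_eqE /=.
by case: ltngtP.
Qed.

Lemma lyndonP d (w : word d) :
  lyndon w <-> suffix_lyndon (fun i j : 'I_d => i < j)%N w.
Proof.
have irr : irreflexive (fun i j : 'I_d => i < j)%N by move=> i; rewrite ltnn.
have tr : transitive (fun i j : 'I_d => i < j)%N by move=> j i k; apply: ltn_trans.
have tot (i j : 'I_d) : [|| (i < j)%N, i == j | (j < i)%N].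
  by rewrite -val_eqE /=; case: ltngtP.
rewrite /lyndon; split=> [/andP[w0 /allP H]|sl].
  apply: rot_suffix_lyndon => // i iw; rewrite lexlt_ord; apply: H.
  case/andP: iw => i0 iw; rewrite mem_iota i0 add1n prednK //.
  exact: leq_ltn_trans iw.
have [w0 _] := sl; rewrite w0; apply/allP=> i; rewrite mem_iota => iw.
by rewrite -lexlt_ord; apply: suffix_lyndon_rot => //; move: iw; rewrite add1n prednK // lt0n size_eq0.
Qed.

(** * Alphabets of compatible words *)

Section SimpleWords.
Variables (A : eqType) (z : A).
Implicit Types (t : seq A) (S : seq (seq A)).

Definition simple t : Prop :=
  exists k ys, [/\ (0 < k)%N, ys != [::], z \notin ys & t = nseq k z ++ ys].

Lemma find_simple k ys : ys != [::] -> z \notin ys -> find (predC1 z) (nseq k z ++ ys) = k.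
Proof.
case: ys => // y ys _; rewrite inE negb_or eq_sym => /andP[yz _].
by elim: k => /= [|k ->]; rewrite ?yz // eqxx.
Qed.

Lemma simple_inj k k' ys ys' : ys != [::] -> z \notin ys -> ys' != [::] -> z \notin ys' ->
  nseq k z ++ ys = nseq k' z ++ ys' -> k = k' /\ ys = ys'.
Proof.
move=> y0 zy y0' zy' E; have Ek : k = k'.
  by rewrite -(find_simple k y0 zy) E find_simple.
split=> //; move: E; rewrite Ek => /eqP.
by rewrite eqseq_cat // eqxx => /eqP.
Qed.

(* Cuts a word before each z that follows another letter. *)
Fixpoint blocks t : seq (seq A) :=
  if t is a :: t' then
    if blocks t' is h :: bs then
      if (a != z) && (head a h == z) then [:: [:: a], h & bs] else (a :: h) :: bs
    else [:: [:: a]]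
  else [::].

Lemma blocks_cons a t : blocks (a :: t) =
  if blocks t is h :: bs then
    if (a != z) && (head a h == z) then [:: [:: a], h & bs] else (a :: h) :: bs
  else [:: [:: a]].
Proof. by []. Qed.

Lemma blocksK t : flatten (blocks t) = t.
Proof.
elim: t => //= a t; case: (blocks t) => [<-//|h S] /= <-.
by case: ifP.
Qed.

(** Simple words begin with z and end with another letter, so their boundaries are exactly the
    places where [blocks] cuts. *)
Lemma blocks_flatten S : (forall t, t \in S -> simple t) -> blocks (flatten S) = S.
Proof.
elim: S => //= t S IH simS.
have {}IH : blocks (flatten S) = S by apply: IH => u uS; apply: simS; rewrite inE uS orbT.
have hS : S = [::] \/ exists t' S', S = (z :: t') :: S'.
  case: (S) simS => [|u S'] simS; first by left.
  have [|[|k] [ys [// _ _ _ ->]]] := simS u; first by rewrite !inE eqxx orbT.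
  by right; exists (nseq k z ++ ys), S'.
have [|k [ys [k0 y0 zy ->]]] := simS t; first by rewrite inE eqxx.
have base ys' : ys' != [::] -> z \notin ys' -> blocks (ys' ++ flatten S) = ys' :: S.
  elim: ys' => // y [|y' ys'] IHy _ zy2.
    rewrite inE eq_sym in zy2; rewrite /= IH; case: hS => [->//|[t' [S' ->]]] /=.
    by rewrite zy2 eqxx.
  rewrite inE negb_or in zy2; case/andP: zy2 => _ zy'.
  have y'z : (y' == z) = false.
    by apply: contraNF zy' => /eqP->; rewrite inE eqxx.
  by rewrite cat_cons blocks_cons IHy //= y'z andbF.
by elim: k {k0} => [|k IHk]; [exact: base|rewrite !cat_cons blocks_cons IHk eqxx].
Qed.

(** The initial z of t gives the first block its power of z, and the last letter gives the last
    block its tail; the other cuts provide both. *)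
Lemma blocks_simple t x0 : head x0 t = z -> last z t != z ->
  forall u, u \in blocks t -> simple u.
Proof.
move=> ht lt; have t0 : t != [::] by case: (t) lt => //=; rewrite eqxx.
have : exists k ys S, [/\ blocks t = (nseq k z ++ ys) :: S, ys != [::], z \notin ys
    & forall u, u \in S -> simple u].
  elim: t t0 lt {ht} => // a [|b t] IH _ lt.
    by exists 0%N, [:: a], [::]; split; rewrite // inE eq_sym.
  have [//|//|k [ys [S [Eb y0 zy simS]]]] := IH.
  rewrite blocks_cons Eb.
  case: ifP => [/andP[az hz]|].
    exists 0%N, [:: a], ((nseq k z ++ ys) :: S); split=> //; first by rewrite inE eq_sym.
    move=> u; rewrite inE => /predU1P[->|]; last exact: simS.
    exists k, ys; split=> //; rewrite lt0n; apply: contraTneq hz => -> /=.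
    by case: (ys) y0 zy => //= y ys' _; rewrite inE negb_or eq_sym => /andP[].
  case: (eqVneq a z) => [->|az] /= hz; first by exists k.+1, ys, S.
  have k0 : k = 0%N by case: (k) hz => //= k'; rewrite eqxx.
  by exists 0%N, (a :: ys), S; split; rewrite ?k0 // inE negb_or eq_sym az.
case=> k [ys [S [Eb y0 zy simS]]] u; rewrite Eb inE => /predU1P[->|]; last exact: simS.
exists k, ys; split=> //; rewrite lt0n; apply: contraTneq (eqxx z) => k0.
rewrite -{1}ht -(blocksK t) Eb k0 /=.
by case: (ys) y0 zy => //= y ys' _; rewrite inE negb_or eq_sym => /andP[].
Qed.

Lemma simple_size t : simple t -> (2 <= size t)%N.
Proof. by case=> [[|k] [[|y ys] [// _ _ _ ->]]]; rewrite size_cat size_nseq /=; lia. Qed.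
End SimpleWords.

Section Alphabets.
Variable d : nat.
Implicit Types (zs : seq (word d)) (u w z : word d) (s : seq (word d)).

(* The words of A_m, m = size zs, with initial letter z in A_(m-1), that
   letter having itself the initial letter z' in A_(m-2), and so on, for
   zs = [:: z, z' ...]. *)
Fixpoint alpha zs u : Prop :=
  if zs is z :: zs' then exists k ys, simple_in (alpha zs') z k ys u
  else size u = 1%N.

Definition over (C : word d -> Prop) s := forall u, u \in s -> C u.

Lemma over_cat C s t : over C (s ++ t) <-> over C s /\ over C t.
Proof.
split=> [o|[os ot] u]; last by rewrite mem_cat => /orP[/os|/ot].
by split=> u us; apply: o; rewrite mem_cat us ?orbT.
Qed.

Lemma lift_over (C : word d -> Prop) (D : word d -> seq (word d) -> Prop) s :
  (forall u, C u -> exists2 t, u = flatten t & D u t) -> over C s ->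
  exists S : seq (seq (word d)), s = map flatten S /\ forall t, t \in S -> D (flatten t) t.
Proof.
move=> CD; elim: s => [|u s IH] os; first by exists [::].
have [S [Es DS]] : exists S : seq (seq (word d)), s = map flatten S /\ forall t, t \in S -> D (flatten t) t.
  by apply: IH => v vs; apply: os; rewrite inE vs orbT.
have [t Eu Dt] := CD u (os u (mem_head _ _)).
exists (t :: S); split; first by rewrite /= -Eu -Es.
by move=> t'; rewrite inE => /predU1P[->|/DS//]; rewrite -Eu.
Qed.

Lemma flatten_flatten (S : seq (seq (word d))) : flatten (map flatten S) = flatten (flatten S).
Proof. by elim: S => //= t S ->; rewrite flatten_cat. Qed.

Lemma simple_inP (C : word d -> Prop) z k ys u : simple_in C z k ys u ->
  exists2 t, u = flatten t & simple z t /\ over C t.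
Proof.
case=> k0 y0 zy Cu ->; exists (nseq k z ++ ys) => //; split.
  by exists k, ys; split=> //; rewrite -size_eq0 -lt0n.
move=> x; rewrite mem_cat mem_nseq => /orP[/andP[_ /eqP->]|xy]; apply: Cu; rewrite inE ?eqxx //.
by rewrite xy orbT.
Qed.

Lemma simple_head z (t : seq (word d)) : simple z t -> exists t', t = z :: t'.
Proof. by case=> [[|k] [ys [// _ _ _ ->]]]; exists (nseq k z ++ ys). Qed.

Lemma flatten_singletons s s' : over (fun u => size u = 1%N) s -> over (fun u => size u = 1%N) s' ->
  flatten s = flatten s' -> s = s'.
Proof.
elim: s s' => [|u s IH] [|u' s'] os os' //=.
- by have := os' u' (mem_head _ _); case: u' {os'} => [|? [|? ?]].
- by have := os u (mem_head _ _); case: u {os} => [|? [|? ?]].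
have := os u (mem_head _ _); have := os' u' (mem_head _ _).
move: (os) (os'); case: u' {os'} => [|a' [|? ?]] //; case: u {os} => [|a [|? ?]] // os os' _ _ [-> E].
congr (_ :: _); apply: IH => // v vs; [apply: os|apply: os']; by rewrite inE vs orbT.
Qed.

(** Induction on the length of the lists. At the lower level the two readings agree; their first
    entry is the initial letter, and [blocks] recovers the cuts of this level. *)
Lemma alpha_code zs zs' s s' : size zs = size zs' -> s != [::] ->
  over (alpha zs) s -> over (alpha zs') s' -> flatten s = flatten s' -> zs = zs' /\ s = s'.
Proof.
elim: zs zs' s s' => [|z zs IH] [|z' zs'] s s' //= sz s0 os os' E.
  by split=> //; apply: flatten_singletons.
have lift y ys v : over (alpha (y :: ys)) v -> exists S : seq (seq (word d)),
    v = map flatten S /\ forall t, t \in S -> simple y t /\ over (alpha ys) t.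
  apply: (lift_over (D := fun _ t => simple y t /\ over (alpha ys) t)).
  by move=> u [k [zz]]; apply: simple_inP.
have [S [Es simS]] := lift z zs s os; have [S' [Es' simS']] := lift z' zs' s' os'.
rewrite Es Es' !flatten_flatten in E.
have S0 : S != [::] by apply: contraNneq s0 => S0; rewrite Es S0.
have [t' [S1 ES]] : exists t S1, S = (z :: t) :: S1.
  case: (S) S0 simS => // t S1 _ simS.
  have [/simple_head[t' Et] _] := simS t (mem_head _ _).
  by exists t', S1; rewrite Et.
have ovf (S2 : seq (seq (word d))) y ys : (forall t, t \in S2 -> simple y t /\ over (alpha ys) t) ->
    over (alpha ys) (flatten S2).
  by move=> H u /flattenP[t /H[_ o] ut]; apply: o.
have [] := IH zs' (flatten S) (flatten S') _ _ (ovf _ _ _ simS) (ovf _ _ _ simS') E.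
- by case: sz.
- by rewrite ES.
move=> <- EfS; have Ez : z = z'.
  case: (S') EfS simS' => [|t2 S2]; first by rewrite ES.
  by move=> + simS'; have [/simple_head[t3 ->] _] := simS' t2 (mem_head _ _); rewrite ES => -[].
subst z'; split=> //; rewrite Es Es'; congr map.
have eS : blocks z (flatten S) = S by apply: blocks_flatten => t /simS[].
by rewrite -eS EfS; apply: blocks_flatten => t /simS'[].
Qed.

Lemma alpha_split zs1 zs2 w : alpha (zs1 ++ zs2) w ->
  exists2 s, w = flatten s & over (alpha zs2) s /\ (0 < size zs1 -> 1 < size s)%N /\ s != [::].
Proof.
elim: zs1 w => [|z zs1 IH] w /=.
  move=> aw; exists [:: w]; first by rewrite /= cats0.
  by split=> // u; rewrite inE => /eqP->.
case=> k [ys /simple_inP[t -> [/simple_size st ot]]].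
have [S [Et HS]] := lift_over (D := fun _ s => over (alpha zs2) s /\ s != [::])
  (fun u au => let: ex_intro2 s e (conj o (conj _ n)) := IH u au in ex_intro2 _ _ s e (conj o n)) ot.
have szS : (size S <= size (flatten S))%N.
  elim: (S) HS => //= s S' IHS HS; rewrite size_cat.
  have [_ s0] := HS s (mem_head _ _).
  have {}IHS : (size S' <= size (flatten S'))%N.
    by apply: IHS => s' s'S; apply: HS; rewrite inE s'S orbT.
  by case: (s) s0 => //= *; lia.
have sS : (1 < size (flatten S))%N.
  by apply: leq_trans szS; rewrite -(size_map flatten S) -Et.
exists (flatten S); first by rewrite Et flatten_flatten.
split; first by move=> u /flattenP[s /HS[o _] us]; apply: o.
by split=> //; case: (flatten S) sS.
Qed.

(** If the lists had different lengths, the longer one would read [w] as a word of at least two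
    letters over the alphabet of its end, of the length of the shorter list. For the shorter list
    [w] is a single letter, and [alpha_code] forbids two readings. *)
Lemma alpha_inj zs zs' w : alpha zs w -> alpha zs' w -> zs = zs'.
Proof.
wlog le : zs zs' / (size zs <= size zs')%N.
  by move=> H; case: (leqP (size zs) (size zs')) => [/H//|/ltnW/H h a1 a2]; rewrite h.
move=> aw aw'; have : alpha (take (size zs' - size zs) zs' ++ drop (size zs' - size zs) zs') w.
  by rewrite cat_take_drop.
case/alpha_split=> s Ew [os [s1 s0]].
have sz : size (drop (size zs' - size zs) zs') = size zs by rewrite size_drop subKn.
have ow : over (alpha zs) [:: w] by move=> u; rewrite inE => /eqP->.
have [//||Ez Es] := alpha_code (esym sz) _ ow os; first by rewrite /= cats0.
move: s1; rewrite -Es /= ltnn; case: posnP => [t0 _|_ /(_ isT)//].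
by rewrite [LHS]Ez -[RHS](cat_take_drop (size zs' - size zs)) (size0nil t0).
Qed.

Lemma alpha_simple_uniq zs x k ys zs' x' k' ys' w :
  simple_in (alpha zs) x k ys w -> simple_in (alpha zs') x' k' ys' w ->
  [/\ zs = zs', x = x', k = k' & ys = ys'].
Proof.
move=> s1 s2; have [] : x :: zs = x' :: zs'.
  by apply: (@alpha_inj _ _ w); [exists k, ys|exists k', ys'].
move=> Ex Ez; subst x' zs'.
case: s1 s2 => k0 y0 xy Cx -> [k0' y0' xy' Cx' E].
have n0 (ys0 : seq (word d)) : (0 < size ys0)%N -> ys0 != [::] by case: ys0.
have ov j ys0 : (forall u, u \in x :: ys0 -> alpha zs u) -> over (alpha zs) (nseq j x ++ ys0).
  move=> H u; rewrite mem_cat mem_nseq => /orP[/andP[_ /eqP->]|uy]; apply: H; rewrite inE ?eqxx //.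
  by rewrite uy orbT.
have [|_ Eseq] := alpha_code (erefl (size zs)) _ (ov k _ Cx) (ov k' _ Cx') E.
  by case: (k) k0.
by have [] := simple_inj (n0 _ y0) xy (n0 _ y0') xy' Eseq.
Qed.

Lemma eq_simple_in (C C' : word d -> Prop) x k ys w :
  (forall u, u \in x :: ys -> C u -> C' u) -> simple_in C x k ys w -> simple_in C' x k ys w.
Proof. by move=> CC' [k0 y0 xy Cu Ew]; split=> // u uxy; apply: CC' => //; apply: Cu. Qed.

(** [factors] fixes the common initial letter z of an alphabet but not the initial letter of z, and
    so on. These agree for all the words, since by [alpha_inj] the word z has only one list. *)
Lemma factors_alpha m x k ys w : factors m x k ys w ->
  exists2 zs, size zs = m & simple_in (alpha zs) x k ys w.
Proof.
elim: m x k ys w => [|m IH] x k ys w /=; first by exists [::].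
case=> z sw; have lift u : (exists j us, factors m z j us u) ->
    exists2 zs, size zs = m & alpha (z :: zs) u /\ alpha zs z.
  case=> j [us /IH[zs sz su]]; exists zs => //; split; first by exists j, us.
  by case: su => _ _ _ + _; apply; rewrite mem_head.
have [_ _ _ Cu _] := sw.
have [zs sz [ax az]] := lift x (Cu x (mem_head _ _)).
exists (z :: zs); first by rewrite /= sz.
apply: eq_simple_in sw => u _ /lift[zs' _ [au az']].
by rewrite (alpha_inj az az').
Qed.

Lemma alpha_factors zs x k ys w : simple_in (alpha zs) x k ys w -> factors (size zs) x k ys w.
Proof.
elim: zs x k ys w => [//|z zs IH] x k ys w /= sw; exists z.
by apply: eq_simple_in sw => u _ [j [us /IH fu]]; exists j, us.
Qed.

Lemma in_level_alpha m w : in_level m w -> exists2 zs, size zs = m & alpha zs w.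
Proof.
case: m => [sw|m [x [k [ys /factors_alpha[zs sz sw]]]]]; first by exists [::].
by exists (x :: zs); rewrite ?sz //=; [rewrite sz|exists k, ys].
Qed.

Lemma level_alpha zs w : alpha zs w -> level w = size zs.
Proof.
move=> aw; have lw : in_level (size zs) w.
  case: zs aw => [//|z zs [k [ys sw]]]; exists z, k, ys; exact: alpha_factors.
have ex : exists m, in_level m w by exists (size zs).
have [zs' sz aw'] := in_level_alpha (classical_sets.xgetPex 0%N ex).
by rewrite /level -sz (alpha_inj aw' aw).
Qed.

Lemma decomposition_alpha zs x k ys w : simple_in (alpha zs) x k ys w ->
  decomposition (size zs) w = (x, k, ys).
Proof.
move=> sw; have fw := alpha_factors sw.
have ex : exists f : word d * nat * seq (word d), factors (size zs) f.1.1 f.1.2 f.2 w.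
  by exists (x, k, ys).
have [zs' _ sw'] := factors_alpha (classical_sets.xgetPex ([::], 0%N, [::]) ex).
rewrite /decomposition; move: (classical_sets.xget _ _) sw' => [[x' k'] ys'] /= sw'.
by have [_ -> -> ->] := alpha_simple_uniq sw' sw.
Qed.
End Alphabets.

(** * Lyndon words over iterated alphabets *)

Section LyndonAlphabets.
Variable d : nat.
Implicit Types (zs : seq (word d)) (u w z : word d) (s t : seq (word d)).

Definition ord_lt : rel 'I_d := fun i j => (i < j)%N.
Local Notation wlt := (lexlt ord_lt).
Local Notation wwlt := (lexlt wlt).

Lemma ord_lt_irr : irreflexive ord_lt. Proof. by move=> i; rewrite /ord_lt ltnn. Qed.
Lemma ord_lt_trans : transitive ord_lt. Proof. by move=> j i k; apply: ltn_trans. Qed.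
Lemma ord_lt_total i j : [|| ord_lt i j, i == j | ord_lt j i].
Proof. by rewrite /ord_lt -val_eqE /=; case: ltngtP. Qed.

Lemma wlt_irr : irreflexive wlt. Proof. exact: lexlt_irr ord_lt_irr. Qed.
Lemma wlt_trans : transitive wlt. Proof. exact: lexlt_trans ord_lt_trans. Qed.
Lemma wlt_total (u w : seq 'I_d) : [|| wlt u w, u == w | wlt w u].
Proof. exact: lexlt_total ord_lt_total u w. Qed.

(* The part of [alpha] made of the Lyndon words. *)
Fixpoint lam zs u : Prop :=
  if zs is z :: zs' then
    exists k ys, simple_in (lam zs') z k ys u /\ forall y, y \in ys -> wlt z y
  else size u = 1%N.

Lemma lam_alpha zs u : lam zs u -> alpha zs u.
Proof.
elim: zs u => //= z zs IH u [k [ys [su _]]]; exists k, ys.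
by apply: eq_simple_in su => v _; apply: IH.
Qed.

Lemma lam_nonempty zs u : lam zs u -> u != [::].
Proof.
elim: zs u => [|z zs IH] u /=; first by case: u.
case=> k [ys [[k0 _ _ Cu ->] _]]; have z0 := IH z (Cu z (mem_head _ _)).
by case: k k0 => //= k _; case: (z) z0.
Qed.

Definition lam_word zs z t : Prop :=
  over (lam zs) t /\
  exists k ys, [/\ (0 < k)%N, ys != [::], z \notin ys, t = nseq k z ++ ys
    & forall y, y \in ys -> wlt z y].

Lemma lam_wordP zs z u : lam (z :: zs) u -> exists2 t, u = flatten t & lam_word zs z t.
Proof.
case=> k [ys [[k0 y0 zy Cu Eu] zlt]]; exists (nseq k z ++ ys); first exact: Eu.
split; last by exists k, ys; split=> //; rewrite -size_eq0 -lt0n.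
move=> v; rewrite mem_cat mem_nseq => /orP[/andP[_ /eqP->]|vy]; apply: Cu; rewrite inE ?eqxx //.
by rewrite vy orbT.
Qed.

Lemma lam_of_word zs z t : lam_word zs z t -> lam (z :: zs) (flatten t).
Proof.
case=> ot [k [ys [k0 y0 zy Et zlt]]]; exists k, ys; split=> //; split=> //.
- by rewrite lt0n size_eq0.
- move=> u uz; apply: ot; rewrite Et mem_cat mem_nseq k0 /=.
  by move: uz; rewrite inE.
- by rewrite Et.
Qed.

Lemma lam_words zs z s : over (lam (z :: zs)) s ->
  exists S : seq (seq (word d)), s = map flatten S /\ forall t, t \in S -> lam_word zs z t.
Proof.
move=> os; apply: (lift_over (D := fun _ t => lam_word zs z t)) os => u.
exact: lam_wordP.
Qed.

Lemma flatten_nonempty zs s : over (lam zs) s -> s != [::] -> flatten s != [::].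
Proof.
case: s => // u s os _; have := lam_nonempty (os u (mem_head _ _)).
by rewrite /=; case: (u).
Qed.

(** Compare the first differing letters, unfolded one level down. If one unfolding is a proper
    prefix of the other, the smaller word ends or continues with z, the head of its next letter,
    while the larger one continues with a letter above z. *)
Lemma flatten_mono zs s t : over (lam zs) s -> over (lam zs) t ->
  wwlt s t -> wlt (flatten s) (flatten t).
Proof.
elim: zs s t => [|z zs IH] s t os ot.
  elim: s t os ot => [|u s IHs] [|v t] // os ot.
    by move=> _; have := ot v (mem_head _ _); case: (v).
  have /= su := os u (mem_head _ _); have /= sv := ot v (mem_head _ _).
  have os' : over (lam [::]) s by move=> x xs; apply: os; rewrite inE xs orbT.
  have ot' : over (lam [::]) t by move=> x xs; apply: ot; rewrite inE xs orbT.
  move: IHs => /(_ t os' ot'); case: u su {os} => [|a [|? ?]] // _.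
  case: v sv {ot} => [|b [|? ?]] // _ IHs /=.
  by rewrite eqseq_cons andbT andbF orbF => /orP[->//|/andP[-> /IHs->]]; rewrite orbT.
case/lexltP=> [[u u0 Et]|[p [a [b [s' [t' [Es Et ab]]]]]]].
  rewrite Et flatten_cat; apply: lexlt_prefix; first exact: ord_lt_irr.
  by apply: flatten_nonempty u0; move: ot; rewrite Et => /over_cat[_]; exact.
move: os ot; rewrite Es Et => /over_cat[_ os] /over_cat[_ ot].
rewrite !flatten_cat lexlt_catl; last exact: ord_lt_irr.
have [S [ES HS]] := lam_words os; have [T [ET HT]] := lam_words ot.
rewrite ES ET; case: S ES HS => // sa S [Ea ES] HS; case: T ET HT => // sb T [Eb ET] HT.
have [osa [k [ys [k0 y0 zy Esa zlt]]]] := HS sa (mem_head _ _).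
have [osb [j [us [j0 u0 zu Esb zlt']]]] := HT sb (mem_head _ _).
have ovf (R : seq (seq (word d))) : (forall t, t \in R -> lam_word zs z t) -> over (lam zs) (flatten R).
  by move=> H u /flattenP[r /H[o _] ur]; apply: o.
rewrite !flatten_flatten; apply: (IH); [exact: ovf|exact: ovf|].
have sab : wwlt sa sb.
  case/or3P: (lexlt_total wlt_total sa sb) => // [/eqP E|ba].
    by move: ab; rewrite Ea Eb E wlt_irr.
  have := IH _ _ osb osa ba; rewrite -Ea -Eb => ba'.
  by have := wlt_trans ab ba'; rewrite wlt_irr.
case/lexltP: (sab) => [[x x0 Ex]|[p' [a' [b' [q [q' [E1 E2 ab']]]]]]]; last first.
  by rewrite /= E1 E2 -!catA; apply: lexlt_diff ab'; exact: wlt_irr.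
rewrite /= {1}Ex -catA lexlt_catl; last exact: wlt_irr.
case: (S) HS => [|s1 S1] HS /=; first by case: (x) x0.
have [_ [k1 [ys1 [k10 _ _ -> _]]]] := HS s1 (mem_behead (s := [:: sa, s1 & S1]) (mem_head _ _)).
case: x x0 Ex => // x1 x _ Ex; case: k1 k10 => // k1 _ /=.
(* [sa] already contains a letter other than z, so [x1] lies beyond the power of z at the head of
   [sb]. *)
suff -> : wlt z x1 by [].
apply: zlt'; have jk : (j <= k)%N.
  rewrite leqNgt; apply/negP=> kj.
  have : nth z sb k = z by rewrite Esb nth_cat size_nseq kj nth_nseq kj.
  rewrite Ex Esa -catA nth_cat size_nseq ltnn subnn => hy.
  by move: zy; rewrite -hy; case: (ys) y0 => //= y ys' _; rewrite mem_head.
have -> : us = drop j sb by rewrite Esb drop_size_cat ?size_nseq.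
have js : (j <= size sa)%N by rewrite Esa size_cat size_nseq (leq_trans jk) ?leq_addr.
rewrite Ex drop_cat; case: ltngtP js => // [_|->] _; last by rewrite subnn drop0 mem_head.
by rewrite mem_cat mem_head orbT.
Qed.

Lemma flatten_mono_inv zs s t : over (lam zs) s -> over (lam zs) t ->
  wlt (flatten s) (flatten t) -> wwlt s t.
Proof.
move=> os ot st; case/or3P: (lexlt_total wlt_total s t) => // [/eqP E|ts].
  by move: st; rewrite E wlt_irr.
by have := wlt_trans st (flatten_mono ot os ts); rewrite wlt_irr.
Qed.

(** The word is built from its first tail letter by putting copies of z in front and then appending
    the other letters, each time concatenating two Lyndon words in increasing order. *)
Lemma lam_lyndon zs u : lam zs u -> suffix_lyndon ord_lt u.
Proof.
elim: zs u => [|z zs IH] u.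
  case: u => [|a [|? ?]] //= _; split=> // u v u0 v0 /(congr1 size).
  by rewrite size_cat; case: u v u0 v0 => [|? ?] [|? ?] //= _ _; lia.
case/lam_wordP=> t -> [ot [k [ys [k0 y0 zy Et zlt]]]].
have cat := @suffix_lyndon_cat _ _ ord_lt_irr ord_lt_trans.
have oz : lam zs z by apply: ot; rewrite Et mem_cat mem_nseq k0 eqxx.
have oy y : y \in ys -> lam zs y by move=> yy; apply: ot; rewrite Et mem_cat yy orbT.
case/lastP: ys y0 {zy} Et zlt oy => // ys y _ Et zlt oy; rewrite {t ot}Et.
elim/last_ind: ys y zlt oy => [|ys y' IHy] y zlt oy.
  have zy := zlt y (mem_head _ _); have ay := oy y (mem_head _ _).
  case: k k0 => // k _; elim: k => [|k IHk].
    by rewrite /= cats0; apply: cat; [apply: IH|apply: IH|].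
  rewrite -[nseq k.+2 z ++ _]/(z :: (nseq k.+1 z ++ [:: y])) [flatten _]/=.
  apply: cat; [exact: IH|exact: IHk|].
  rewrite /= -/(flatten (nseq k z ++ [:: y])); apply: lexlt_prefix; first exact: ord_lt_irr.
  have := flatten_nonempty (zs := zs) (s := nseq k z ++ [:: y]); apply; last by case: (k).
  by move=> v; rewrite mem_cat mem_nseq inE => /orP[/andP[_ /eqP->]|/eqP->].
rewrite -cats1 catA flatten_cat /= cats0.
have zy : wlt z y by apply: zlt; rewrite mem_rcons mem_head.
have s1 : suffix_lyndon ord_lt (flatten (nseq k z ++ rcons ys y')).
  by apply: IHy => v vy; [apply: zlt|apply: oy]; rewrite mem_rcons inE vy orbT.
apply: cat => //; first by apply: IH; apply: oy; rewrite mem_rcons mem_head.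
have -> : y = flatten [:: y] by rewrite /= cats0.
apply: (@flatten_mono zs).
- move=> v; rewrite mem_cat mem_nseq => /orP[/andP[_ /eqP->//]|vy].
  by apply: oy; rewrite mem_rcons inE vy orbT.
- by move=> v; rewrite inE => /eqP->; apply: oy; rewrite mem_rcons mem_head.
- by case: (k) k0 => // k' _ /=; rewrite zy.
Qed.

(** A Lyndon word of at least two letters over an alphabet begins with its least letter z and ends
    with another one, so [blocks] cuts it into letters of the next alphabet. Each block has at least
    two letters, so the length drops until a single letter is left. *)
Lemma lam_exists w : suffix_lyndon ord_lt w -> exists zs, lam zs w.
Proof.
move=> lw; suff H n zs s : (size s <= n)%N -> over (lam zs) s -> flatten s = w -> exists zs, lam zs w.
  apply: (H (size w) [::] [seq [:: a] | a <- w]); first by rewrite size_map.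
    by move=> u /mapP[a _ ->].
  by elim: (w) => //= a u ->.
elim: n zs s => [|n IH] zs s.
  by rewrite leqn0 size_eq0 => /eqP-> _ Ew; case: lw; rewrite -Ew.
case: s => [|z [|z' s]] ss os Ew.
- by case: lw; rewrite -Ew.
- by exists zs; move: Ew; rewrite /= cats0 => <-; apply: os; rewrite mem_head.
set s0 := [:: z, z' & s] in ss os Ew.
(* The comparison with suffixes passes from [w] to its spelling [s0], as flattening reflects the
   order. *)
have suf (u v : seq (word d)) : u != [::] -> v != [::] -> s0 = u ++ v -> wwlt s0 v.
  move=> u0 v0 E; have [ou ov] : over (lam zs) u /\ over (lam zs) v.
    by apply/over_cat; rewrite -E.
  apply: (@flatten_mono_inv zs) => //; rewrite Ew; case: lw => _; apply.
  - exact: (flatten_nonempty ou u0).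
  - exact: (flatten_nonempty ov v0).
  - by rewrite -flatten_cat -E.
have geq y : y \in s0 -> (y == z) || wlt z y.
  rewrite inE => /orP[->//|ys].
  have [p1 [p2 E]] : exists p1 p2, z' :: s = p1 ++ y :: p2.
    by case/path.splitPr: ys => p1 p2; exists p1, p2.
  have := suf (z :: p1) (y :: p2) isT isT; rewrite /s0 E => /(_ (erefl _)).
  by rewrite /= [y == z]eq_sym => /orP[->|/andP[->]//]; rewrite orbT.
have lz : last z s0 != z.
  have := suf (belast z (z' :: s)) [:: last z s0] isT isT.
  rewrite cats1 -lastI => /(_ (erefl _)) /=; rewrite andbF orbF => zl.
  by apply: contraTneq zl => ->; rewrite wlt_irr.
have simS := blocks_simple (z := z) (x0 := z) (erefl : head z s0 = z) lz.
have szS (S : seq (seq (word d))) : (forall t, t \in S -> simple z t) ->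
    (2 * size S <= size (flatten S))%N.
  elim: S => //= t S IHS sS; rewrite size_cat mulnS leq_add //.
    by apply: simple_size (sS t (mem_head _ _)).
  by apply: IHS => t' t'S; apply: sS; rewrite inE t'S orbT.
apply: (IH (z :: zs) (map flatten (blocks z s0))); last first.
- by rewrite flatten_flatten blocksK.
- move=> u /mapP[t tS ->]; have [k [ys [k0 y0 zy Et]]] := simS t tS.
  have ts : {subset t <= s0}.
    by move=> x xt; rewrite -(blocksK z s0); apply/flattenP; exists t.
  apply: lam_of_word; split; first by move=> x /ts; apply: os.
  exists k, ys; split=> // y yy.
  have /geq/orP[/eqP yz|//] : y \in s0 by apply: ts; rewrite Et mem_cat yy orbT.
  by move: zy; rewrite -yz yy.
rewrite size_map; have := szS _ simS; rewrite blocksK => sz2.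
by move: ss sz2; rewrite /s0 /=; lia.
Qed.
End LyndonAlphabets.

(** * Duality of words *)

(** Substitution of graphs for vertices: an arc between two vertices becomes an arc between the
    roots of their graphs. *)
Fixpoint rbind X Y (f : X -> rooted Y) (g : rooted X) : rooted Y :=
  match g with
  | Vertex x => f x
  | Attach g h => Attach (rbind f g) (rbind f h)
  end.

Fixpoint tbind X Y (f : X -> tree Y) (T : tree X) : tree Y :=
  match T with
  | Leaf x => f x
  | Node l r => Node (tbind f l) (tbind f r)
  end.

Section Bind.
Variables (X Y Z : Type).

Lemma rbind_rbind (f : Y -> rooted Z) (f' : X -> rooted Y) g :
  rbind f (rbind f' g) = rbind (fun x => rbind f (f' x)) g.
Proof. by elim: g => //= g -> h ->. Qed.

Lemma tbind_tbind (f : Y -> tree Z) (f' : X -> tree Y) T :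
  tbind f (tbind f' T) = tbind (fun x => tbind f (f' x)) T.
Proof. by elim: T => //= l -> r ->. Qed.

Lemma rbind_achain (f : X -> rooted Y) g gs :
  rbind f (achain g gs) = achain (rbind f g) (map (rbind f) gs).
Proof. by elim: gs g => //= h gs IH g; rewrite IH. Qed.

Lemma tbind_foldl (f : X -> tree Y) T Ts :
  tbind f (foldl (@Node X) T Ts) = foldl (@Node Y) (tbind f T) (map (tbind f) Ts).
Proof. by elim: Ts T => //= U Ts IH T; rewrite IH. Qed.

Lemma rbind_rmap (f : Y -> rooted Z) (f' : X -> Y) g :
  rbind f (rmap f' g) = rbind (fun x => f (f' x)) g.
Proof. by elim: g => //= g -> h ->. Qed.

Lemma tbind_tmap (f : Y -> tree Z) (f' : X -> Y) T :
  tbind f (tmap f' T) = tbind (fun x => f (f' x)) T.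
Proof. by elim: T => //= l -> r ->. Qed.
End Bind.

Lemma eq_in_rbind (X : eqType) Y (f f' : X -> rooted Y) g :
  {in verts g, f =1 f'} -> rbind f g = rbind f' g.
Proof.
elim: g => [x|g IHg h IHh] /= ef; first by apply: ef; rewrite inE.
by rewrite IHg ?IHh // => x xg; apply: ef; rewrite mem_cat xg ?orbT.
Qed.

Lemma eq_in_tbind (X : eqType) Y (f f' : X -> tree Y) T :
  {in leaf_labels T, f =1 f'} -> tbind f T = tbind f' T.
Proof.
elim: T => [x|l IHl r IHr] /= ef; first by apply: ef; rewrite inE.
by rewrite IHl ?IHr // => x xT; apply: ef; rewrite mem_cat xT ?orbT.
Qed.

Lemma mem_verts_rbind (X Y : eqType) (f : X -> rooted Y) g y :
  (y \in verts (rbind f g)) = has (fun x => y \in verts (f x)) (verts g).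
Proof. by elim: g => /= [x|g IHg h IHh]; rewrite ?orbF // mem_cat has_cat IHg IHh. Qed.

Lemma mem_leaves_tbind (X Y : eqType) (f : X -> tree Y) T y :
  (y \in leaf_labels (tbind f T)) = has (fun x => y \in leaf_labels (f x)) (leaf_labels T).
Proof. by elim: T => /= [x|l IHl r IHr]; rewrite ?orbF // mem_cat has_cat IHl IHr. Qed.

Lemma cuts_attach X (g h : rooted X) :
  cuts (Attach g h) = (g, h) :: [seq (Attach c.1 h, c.2) | c <- cuts g]
                             ++ [seq (Attach g c.1, c.2) | c <- cuts h].
Proof. by []. Qed.

(** * Substitution of simple words for letters *)

Section Stars.
Variables (K : comNzRingType) (A : eqType) (x : A).
Local Notation P := (rpair (fun a b => (a == b)%:R : K)).
Local Notation letter := (nat * A * seq A)%type.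
Implicit Types (i u : letter) (g : rooted letter) (T : tree letter).

(* The letter (k, y, s) stands for the simple word x ^ (k + 1) y s. *)
Definition good i := (i.1.2 != x) && (x \notin i.2).

Definition core k y := achain (Vertex y) (nseq k.+1 (Vertex x)).

Definition star i := achain (core i.1.1 i.1.2) (map (@Vertex A) i.2).

Definition left_normed i : tree A :=
  foldl (@Node A) (Leaf i.1.2) (nseq i.1.1.+1 (Leaf x) ++ map (@Leaf A) i.2).

Arguments core : simpl never.
Arguments star : simpl never.
Arguments left_normed : simpl never.

Lemma coreE k y : core k y = long y (nseq k.+1 x).
Proof. by rewrite /core -achain_vertex map_nseq. Qed.

Lemma starE k y c s : star (k, y, c :: s) = Attach (core k y) (long c s).
Proof. by rewrite /star /= achain_vertex. Qed.

Lemma star_nil k y : star (k, y, [::]) = core k y. Proof. by []. Qed.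

Lemma verts_star i : verts (star i) = i.1.2 :: nseq i.1.1.+1 x ++ i.2.
Proof.
case: i => [[k y] [|c s]]; first by rewrite star_nil coreE verts_long /= cats0.
by rewrite starE coreE [LHS]/= !verts_long.
Qed.

Lemma leaves_left_normed i : leaf_labels (left_normed i) = i.1.2 :: nseq i.1.1.+1 x ++ i.2.
Proof.
case: i => [[k y] s]; rewrite /left_normed.
have H : forall (T : tree A) l, leaf_labels (foldl (@Node A) T (map (@Leaf A) l)) = leaf_labels T ++ l.
  move=> T l; elim: l T => [|a l IH] T; first by rewrite cats0.
  by rewrite /= IH /= -catA.
by rewrite -map_nseq -map_cat H.
Qed.

Lemma star_not_vertex i a : star i <> Vertex a.
Proof. by case: i => [[k y] [|c s]]. Qed.

Lemma rbind_star_not_vertex g a : rbind star g <> Vertex a.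
Proof. by case: g => // i; apply: star_not_vertex. Qed.

Lemma cuts_core k y c : c \in cuts (core k y) -> all (pred1 x) (verts c.2).
Proof.
rewrite coreE [cuts _]/= inE => /predU1P[->|/mapP[c' cc ->]] /=.
  by rewrite verts_long /= eqxx all_pred1_nseq ?orbT.
have /perm_mem pc := cuts_verts cc.
apply/allP=> a ac; have : a \in verts (long x (nseq k x)) by rewrite pc mem_cat ac orbT.
by rewrite verts_long inE mem_nseq => /orP[|/andP[_]].
Qed.

(** The component without the root is an end of the chain of letters x or an end of the chain of the
    tail, which has no x. Neither contains x together with another letter. *)
Lemma cuts_star i c : good i -> c \in cuts (star i) ->
  all (pred1 x) (verts c.2) || (x \notin verts c.2).
Proof.
case: i => [[k y] [|b s]] gi; first by rewrite star_nil => /cuts_core->.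
case/andP: gi => _ xs; change (is_true (x \notin b :: s)) in xs.
rewrite starE cuts_attach inE mem_cat => /or3P[/eqP->|/mapP[c' /cuts_core cc ->]|/mapP[c' cc ->]] /=.
- by rewrite verts_long xs orbT.
- by rewrite cc.
- apply/orP; right; apply: contra xs => xc; rewrite -(verts_long b s).
  by rewrite (perm_mem (cuts_verts cc)) mem_cat xc orbT.
Qed.

(** The substituted graphs are joined at their roots, so a cut inside [f u] detaches a piece [c.2]
    of [f u] alone; the assumption discards these cuts. *)
Lemma sum_cuts_rbind (M : nmodType) (X : eqType) (f : X -> rooted A) (g : rooted X)
    (F : rooted A * rooted A -> M) :
  (forall c1 (u : X) c, u \in verts g -> c \in cuts (f u) -> F (c1, c.2) = 0) ->
  \sum_(c <- cuts (rbind f g)) F c = \sum_(c <- cuts g) F (rbind f c.1, rbind f c.2).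
Proof.
elim: g F => [u|g IHg h IHh] F F0 /=.
  by rewrite big_nil big_seq big1 // => -[c1 c2] cu; apply: (F0 _ u _ _ cu); rewrite inE.
rewrite !big_cons !big_cat !big_map /=; congr (_ + (_ + _)).
  rewrite (IHg (fun c => F (Attach c.1 (rbind f h), c.2))) // => c1 u c ug.
  by apply: F0; rewrite mem_cat ug.
rewrite (IHh (fun c => F (Attach (rbind f g) c.1, c.2))) // => c1 u c ug.
by apply: F0; rewrite mem_cat ug orbT.
Qed.

Lemma rpair_mono c (T : tree A) a b : a \in leaf_labels T -> b \in leaf_labels T ->
  a = x -> b != x -> all (pred1 x) (verts c) || (x \notin verts c) -> P c T = 0.
Proof.
move=> aT bT ax bx cc; apply/eqP/negPn/negP=> /perm_eq_rpair/perm_mem pc.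
case/orP: cc => [/allP cx|xc]; first by move: bx; rewrite (eqP (cx b _)) ?eqxx // pc.
by move: xc; rewrite pc -ax aT.
Qed.

Lemma good_leaves T : all good (leaf_labels T) -> exists a b,
  [/\ a \in leaf_labels (tbind left_normed T), b \in leaf_labels (tbind left_normed T), a = x & b != x].
Proof.
have [u uT] : exists u, u \in leaf_labels T.
  by elim: T => [u|l [u ul] r _]; exists u; rewrite ?inE // mem_cat ul.
move=> /allP/(_ u uT)/andP[yx _]; exists x, u.1.2; rewrite !mem_leaves_tbind; split=> //;
  apply/hasP; exists u => //; rewrite leaves_left_normed ?mem_head //.
by rewrite inE mem_cat inE eqxx orbT.
Qed.

(** The leaves of both branches include x and another letter. By [cuts_star] a cut inside a star
    detaches a piece that can match neither branch, so only the cuts between stars survive. *)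
Lemma rpair_star_node g l r : all good (verts g) ->
  all good (leaf_labels l) -> all good (leaf_labels r) ->
  P (rbind star g) (Node (tbind left_normed l) (tbind left_normed r))
  = \sum_(c <- cuts g)
     (P (rbind star c.1) (tbind left_normed l) * P (rbind star c.2) (tbind left_normed r)
      - P (rbind star c.2) (tbind left_normed l) * P (rbind star c.1) (tbind left_normed r)).
Proof.
move=> /allP gg gl gr; rewrite /=.
rewrite (sum_cuts_rbind (F := fun c => P c.1 (tbind left_normed l) * P c.2 (tbind left_normed r)
   - P c.2 (tbind left_normed l) * P c.1 (tbind left_normed r))) // => c1 u c /gg gu cu /=.
have [a [b [aT bT ax bx]]] := good_leaves gl.
have [a' [b' [aT' bT' ax' bx']]] := good_leaves gr.
have c2 := cuts_star gu cu.
by rewrite (rpair_mono aT bT ax bx c2) (rpair_mono aT' bT' ax' bx' c2) mulr0 mul0r subrr.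
Qed.

Lemma left_normed_rcons k y s a :
  left_normed (k, y, rcons s a) = Node (left_normed (k, y, s)) (Leaf a).
Proof. by rewrite /left_normed /= -cats1 map_cat catA foldl_cat. Qed.

(** Each bracket with x detaches the last x of the chain; the opposite term would need the component
    of the root y to be a single x. *)
Lemma rpair_core k y : y != x -> P (core k y) (left_normed (k, y, [::])) = 1.
Proof.
move=> yx; rewrite coreE /left_normed cats0 [nseq _ _]/=.
have H m : P (long y (nseq m x)) (foldl (@Node A) (Leaf y) (nseq m (Leaf x))) = 1.
  elim: m => [|m IH]; first by rewrite /= eqxx.
  have -> : nseq m.+1 (Leaf x) = rcons (nseq m (Leaf x)) (Leaf x).
    by elim: (m) => //= n <-.
  rewrite -cats1 foldl_cat; set T := foldl _ _ _ in IH *.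
  rewrite [LHS]/= big_split /= sumrN [X in _ - X]big_seq [X in _ - X]big1 ?subr0; last first.
    move=> c cc; have {}cc : c \in cuts (long y (nseq m.+1 x)) := cc.
    have := cuts_root cc; rewrite root_long.
    by case: (c.1) => [b|? ?] /= => [->|_]; rewrite ?(negbTE yx) mulr0.
  under eq_bigr do rewrite mulrC.
  rewrite (@sum_cuts_long_last K A y (nseq m.+1 x) x (fun h : rooted A => P h T)) /=.
  have -> : last x (nseq m x) = x by elim: (m) => //= n ->.
  have -> : belast x (nseq m x) = nseq m x by elim: (m) => //= n ->.
  by rewrite eqxx mul1r.
exact: H.
Qed.

Lemma good_rcons k y s a : good (k, y, rcons s a) -> good (k, y, s) /\ a != x.
Proof.
rewrite /good /= mem_rcons inE negb_or => /and3P[-> xa ->].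
by split; rewrite // eq_sym.
Qed.

Lemma sum_cuts_star_last k y s b a (G : rooted A -> K) : a != x ->
  \sum_(c <- cuts (star (k, y, rcons s b))) P c.2 (Leaf a) * G c.1
  = (b == a)%:R * G (star (k, y, s)).
Proof.
move=> ax; have [c0 [r0 Er]] : exists c0 r0, rcons s b = c0 :: r0.
  by case: (s) => [|c0 s']; [exists b, [::]|exists c0, (rcons s' b)].
rewrite Er starE cuts_attach big_cons big_cat !big_map.
rewrite [X in _ + (X + _)]big_seq [X in _ + (X + _)]big1 ?add0r; last first.
  move=> c /cuts_core; rewrite /=; case: (c.2) => [e|? ?] /=; last by rewrite mul0r.
  by rewrite andbT => /eqP->; rewrite eq_sym (negbTE ax) mul0r.
rewrite (@sum_cuts_long_last K A c0 r0 a (fun h : rooted A => G (Attach (core k y) h))).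
case: s Er => [|c1 s] [<- <-]; first by rewrite /= addr0.
rewrite (_ : P (_, long c1 (rcons s b)).2 (Leaf a) = 0); last by case: (s).
rewrite mul0r add0r; case Es : (rcons s b) => [|z s']; first by case: (s) Es.
have -> : last z s' = b by have := congr1 (last z) Es; rewrite last_rcons.
have -> : belast z s' = s.
  by have := congr1 (fun l => belast z l) Es; rewrite belast_rcons /= => -[].
by rewrite starE.
Qed.

Definition is_attach X (g : rooted X) := if g is Attach _ _ then true else false.

(** Detaching a single vertex other than x shortens the tail of one star, so stars are left, and no
    fewer of them. *)
Lemma cut_leaf_star g c a : all good (verts g) -> c \in cuts (rbind star g) ->
  c.2 = Vertex a -> a != x ->
  exists g', [/\ all good (verts g'), c.1 = rbind star g' & is_attach g ==> is_attach g'].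
Proof.
elim: g c => [[[k y] s]|g IHg h IHh] c.
  rewrite [verts _]/= all_seq1 [rbind _ _]/= => gi cc c2 ax.
  have notx : all (pred1 x) (verts c.2) -> False.
    by rewrite c2 /= andbT => /eqP ax'; rewrite ax' eqxx in ax.
  case: s gi cc => [|c0 r0] gi; first by rewrite star_nil => /cuts_core/notx.
  rewrite starE cuts_attach inE mem_cat => /or3P[/eqP Ec|/mapP[c' /cuts_core cc Ec]|/mapP[c' cc Ec]].
  - exists (Vertex (k, y, [::])); rewrite Ec; split=> //=; rewrite andbT.
    by move: gi; rewrite /good /= => /andP[->].
  - by case: notx; rewrite Ec.
  - move: cc; rewrite cuts_long => /mapP[i _ Ec']; exists (Vertex (k, y, c0 :: take i r0)).
    rewrite Ec Ec' /= starE; split=> //; rewrite andbT.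
    move: gi; rewrite /good /= !inE !negb_or => /and3P[-> -> /= xs].
    by apply: contra xs; apply: mem_take.
rewrite [verts _]/= all_cat => /andP[gg gh]; rewrite [rbind _ _]/= cuts_attach inE mem_cat.
case/or3P=> [/eqP->|/mapP[c' cc ->]|/mapP[c' cc ->]] /= c2 ax.
- by case: (rbind_star_not_vertex c2).
- by have [g' [gg' -> _]] := IHg _ gg cc c2 ax; exists (Attach g' h); rewrite /= all_cat gg' gh.
- by have [h' [gh' -> _]] := IHh _ gh cc c2 ax; exists (Attach g h'); rewrite /= all_cat gg gh'.
Qed.

Lemma count_star g : all good (verts g) ->
  count (predC1 x) (verts (rbind star g)) = (\sum_(i <- verts g) (size i.2).+1)%N.
Proof.
elim: g => [i|g IHg h IHh] /=.
  rewrite andbT big_seq1 verts_star => /andP[yx xs].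
  have n0 n : count (predC1 x) (nseq n x) = 0%N by rewrite count_nseq /= eqxx.
  have n1 : count (predC1 x) i.2 = size i.2.
    apply/eqP; rewrite -all_count; apply/allP=> a ai /=.
    by apply: contraNneq xs => <-.
  by rewrite -[_ :: _]/([:: i.1.2] ++ nseq i.1.1.+1 x ++ i.2) !count_cat n0 n1 /= yx.
by rewrite all_cat big_cat count_cat => /andP[/IHg-> /IHh->].
Qed.

(** Induction on the tail of u from its end: the outermost bracket, with a letter other than x, must
    detach the end of the tail of a star. When u has no tail, only one letter differs from x, so [g]
    is one star without tail, determined by its letters. *)
Lemma rpair_star_leaf g u : all good (verts g) -> good u ->
  P (rbind star g) (left_normed u) = if g is Vertex i then (i == u)%:R else 0.
Proof.
case: u => [[k y] s]; elim/last_ind: s g => [|s a IH] g gg gu.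
  have /andP[/= yx _] := gu; set u := (k, y, [::]).
  (* If the pairing vanishes, [g] cannot be the single letter [u], which pairs to 1 by
     [rpair_core]. *)
  have [z|/perm_eq_rpair pe] := eqVneq (P (rbind star g) (left_normed u)) 0.
    rewrite z; case: g gg z => //= i gi; case: (i =P u) => // -> z.
    by move: (rpair_core k yx); rewrite -star_nil z => /esym/eqP; rewrite oner_eq0.
  suff -> : g = Vertex u by rewrite eqxx; apply: rpair_core.
  have := seq.permP pe (predC1 x); rewrite leaves_left_normed -(verts_star u).
  rewrite (count_star gg) (count_star (g := Vertex u)) ?big_seq1; last by rewrite /= gu.
  case: g gg pe => [i|g h] gg pe.
    rewrite [verts _]/= big_seq1; case: i gg pe => [[k' y'] [|? ?]] gg pe; last by [].
    move=> _; have {}pe : perm_eq (verts (star (k', y', [::]))) (leaf_labels (left_normed u)) := pe.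
    rewrite leaves_left_normed verts_star !cats0 in pe.
    have Ek : k' = k by have := perm_size pe; rewrite /= !size_nseq => -[].
    have := perm_mem pe y; rewrite /= !inE eqxx !mem_nseq (negbTE yx) !andbF !orbF.
    by move/eqP <-; rewrite Ek.
  rewrite [verts _]/= big_cat /=.
  have pos (h' : rooted letter) : (0 < \sum_(i <- verts h') (size i.2).+1)%N.
    elim: h' => [i|h1 IH1 h2 _] /=; first by rewrite big_seq1.
    by rewrite big_cat addn_gt0 IH1.
  by have := pos g; have := pos h; lia.
have [gu' ax] := good_rcons gu; rewrite left_normed_rcons.
set L := left_normed (k, y, s) in IH *; have /andP[yx _] : (y != x) && (x \notin rcons s a) := gu.
have yL : y \in leaf_labels L by rewrite leaves_left_normed mem_head.
have PN h : P h (Node L (Leaf a)) = \sum_(c <- cuts h) P c.1 L * P c.2 (Leaf a)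
    - \sum_(c <- cuts h) P c.2 L * P c.1 (Leaf a) by rewrite [LHS]/= sumrB.
rewrite PN {PN}.
case: g gg => [[[k' y'] s']|g h] gg; last first.
  rewrite big_seq big1 => [|c cc].
    rewrite sub0r big_seq big1 ?oppr0 // => c.
    rewrite [rbind _ _]/= cuts_attach inE mem_cat => /or3P[/eqP->|/mapP[c' _ ->]|/mapP[c' _ ->]] /=;
      rewrite ?mulr0 //.
    by case E : (rbind star g) => [b|? ?]; rewrite ?mulr0 //; case: (rbind_star_not_vertex E).
  have [[b c2]|nv] : (exists b, c.2 = Vertex b) \/ P c.2 (Leaf a) = 0.
    by case: (c.2) => [b|? ?]; [left; exists b|right].
    have [bx|bx] := eqVneq b x.
      by rewrite c2 /= bx eq_sym (negbTE ax) mulr0.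
    have [g' [gg' -> ia]] := cut_leaf_star gg cc c2 bx.
    by rewrite IH //; case: g' ia {gg'} => //=; rewrite mul0r.
  by rewrite nv mulr0.
rewrite [verts _]/= all_seq1 in gg; rewrite [rbind _ _]/=.
under eq_bigr do rewrite mulrC.
case/lastP: s' gg => [|s' b] gg.
  have c0 c : c \in cuts (core k' y') -> P c.2 (Leaf a) = 0 /\ P c.2 L = 0.
    move/cuts_core=> cx; split.
      by case: (c.2) cx => [e|? ?] //=; rewrite andbT => /eqP->; rewrite eq_sym (negbTE ax).
    apply/eqP/negPn/negP=> /perm_eq_rpair/perm_mem pc.
    by move: yx; rewrite (eqP (allP cx y _)) ?eqxx // pc.
  rewrite star_nil big_seq big1 => [|c /c0[-> _]]; last by rewrite mul0r.
  rewrite big_seq big1 => [|c /c0[_ ->]]; last by rewrite mul0r.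
  by rewrite subrr xpair_eqE; case: (s) => [|? ?] /=; rewrite andbF.
have [gi bx] := good_rcons gg.
rewrite (sum_cuts_star_last _ _ _ _ (fun h : rooted A => P h L)) //.
have := IH (Vertex (k', y', s')); rewrite [rbind _ _]/= => -> //; last by rewrite /= gi.
rewrite [X in _ - X]big_seq [X in _ - X]big1 => [|c].
  rewrite subr0 !xpair_eqE eqseq_rcons -natrM mulnb; congr (_ %:R); congr nat_of_bool.
  by rewrite andbC -!andbA.
have [c0 [r0 Er]] : exists c0 r0, rcons s' b = c0 :: r0.
  by case: (s') => [|c0 s'']; [exists b, [::]|exists c0, (rcons s'' b)].
rewrite Er starE cuts_attach inE mem_cat => /or3P[/eqP->|/mapP[c' _ ->]|/mapP[c' _ ->]] /=;
  by rewrite mulr0.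
Qed.
End Stars.

Lemma rpair_star (K : comNzRingType) (A : eqType) (x : A) g T :
  all (good x) (verts g) -> all (good x) (leaf_labels T) ->
  rpair (fun a b => (a == b)%:R : K) (rbind (star x) g) (tbind (left_normed x) T)
  = rpair (fun i u => (i == u)%:R) g T.
Proof.
elim: T g => [u|l IHl r IHr] g gg gT.
  by rewrite rpair_star_leaf //; move: gT; rewrite /= andbT.
move: gT; rewrite /= all_cat => /andP[gl gr].
rewrite [LHS](rpair_star_node K gg gl gr) !big_seq; apply: eq_bigr => c /cuts_verts/perm_all pc.
have [g1 g2] : all (good x) (verts c.1) /\ all (good x) (verts c.2).
  by move: gg; rewrite pc all_cat => /andP[].
by rewrite !IHl // !IHr.
Qed.

(** * Graphs and trees of words, labelled by letters *)

Section WordGraphs.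
Variable d : nat.
Implicit Types (zs : seq (word d)) (u w z : word d).

(** Labels are words instead of vectors, so that words of any level can be labels and one level can
    be substituted into another. *)
Fixpoint word_rooted_rec m w : rooted (word d) :=
  match m with
  | 0 => Vertex w
  | m'.+1 =>
      let: (x, k, ys) := decomposition m' w in
      if map (word_rooted_rec m') ys is g :: gs
      then achain (achain g (nseq k (word_rooted_rec m' x))) gs
      else Vertex [::]
  end.

Fixpoint word_tree_rec m w : tree (word d) :=
  match m with
  | 0 => Leaf w
  | m'.+1 =>
      let: (x, k, ys) := decomposition m' w in
      if map (word_tree_rec m') ys is t :: ts
      then foldl (@Node (word d)) t (nseq k (word_tree_rec m' x) ++ ts)
      else Leaf [::]
  end.

Definition word_rooted w := word_rooted_rec (level w) w.
Definition word_tree w := word_tree_rec (level w) w.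

Lemma graph_recE (W : nmodType) (v : 'I_d -> W) m w :
  graph_rec v m w = pg (rmap (letter_label v) (word_rooted_rec m w)).
Proof.
elim: m w => [//|m IH] w /=; case: (decomposition m w) => [[x k] [|y ys]] //=.
rewrite !rmap_achain !pg_achain !map_nseq -!map_comp !IH.
by congr chain; apply: eq_map => u /=; rewrite IH.
Qed.

Lemma lie_recE (V : nmodType) (v : 'I_d -> V) m w :
  lie_rec v m w = tmap (letter_label v) (word_tree_rec m w).
Proof.
have tmap_foldl (T : tree (word d)) Ts : tmap (letter_label v) (foldl (@Node _) T Ts)
    = foldl (@Node V) (tmap (letter_label v) T) (map (tmap (letter_label v)) Ts).
  by elim: Ts T => //= U Ts IH T; rewrite IH.
elim: m w => [//|m IH] w /=; case: (decomposition m w) => [[x k] [|y ys]] //=.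
rewrite tmap_foldl map_cat map_nseq -map_comp !IH.
by congr (foldl _ _ (_ ++ _)); apply: eq_map => u /=; rewrite IH.
Qed.

Lemma word_rooted1 w : lam [::] w -> word_rooted w = Vertex w.
Proof. by move=> /(lam_alpha (zs := [::]))/level_alpha lw; rewrite /word_rooted lw. Qed.

Lemma word_tree1 w : lam [::] w -> word_tree w = Leaf w.
Proof. by move=> /(lam_alpha (zs := [::]))/level_alpha lw; rewrite /word_tree lw. Qed.

(* The letter of [star] and [left_normed] for w = x ^ k y_1 ... y_l. *)
Definition letter_of m w : nat * word d * seq (word d) :=
  let: (x, k, ys) := decomposition m w in (k.-1, head [::] ys, behead ys).

Lemma letter_ofP zs z w : lam (z :: zs) w -> exists k y s,
  [/\ letter_of (size zs) w = (k, y, s), w = flatten (nseq k.+1 z ++ y :: s),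
      lam zs z /\ over (lam zs) (y :: s),
      good z (k, y, s) /\ (forall v, v \in y :: s -> lexlt (@ord_lt d) z v)
    & simple_in (alpha zs) z k.+1 (y :: s) w].
Proof.
case=> k [ys [[k0 y0 zy Cu Ew] zlt]]; case: ys y0 zy Cu Ew zlt => // y s _ zy Cu Ew zlt.
case: k k0 Ew => // k _ Ew; exists k, y, s.
have sw : simple_in (alpha zs) z k.+1 (y :: s) w.
  by split=> // u /Cu; apply: lam_alpha.
split=> //.
- by rewrite /letter_of (decomposition_alpha sw).
- split; first by apply: Cu; rewrite mem_head.
  by move=> u us; apply: Cu; rewrite inE us orbT.
- by split=> //; move: zy; rewrite /good inE negb_or eq_sym.
Qed.

Lemma word_rooted_star zs z w : lam (z :: zs) w ->
  word_rooted w = rbind word_rooted (star z (letter_of (size zs) w)).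
Proof.
move=> lw; have [k [y [s [-> _ [lz lys] _ sw]]]] := letter_ofP lw.
rewrite /word_rooted (level_alpha (lam_alpha lw)) [size _]/= [LHS]/= (decomposition_alpha sw).
rewrite [map _ (y :: s)]/= /star /core !rbind_achain -map_comp map_nseq.
have rE u : lam zs u -> word_rooted_rec (size zs) u = word_rooted_rec (level u) u.
  by move=> lu; rewrite (level_alpha (lam_alpha lu)).
rewrite !rE //; last by apply: lys; rewrite mem_head.
congr achain; apply/eq_in_map=> u us /=; apply: rE.
by apply: lys; rewrite inE us orbT.
Qed.

Lemma word_tree_left_normed zs z w : lam (z :: zs) w ->
  word_tree w = tbind word_tree (left_normed z (letter_of (size zs) w)).
Proof.
move=> lw; have [k [y [s [-> _ [lz lys] _ sw]]]] := letter_ofP lw.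
rewrite /word_tree (level_alpha (lam_alpha lw)) [size _]/= [LHS]/= (decomposition_alpha sw).
rewrite [map _ (y :: s)]/= /left_normed tbind_foldl map_cat map_nseq -map_comp.
have rE u : lam zs u -> word_tree_rec (size zs) u = word_tree_rec (level u) u.
  by move=> lu; rewrite (level_alpha (lam_alpha lu)).
rewrite !rE //; last by apply: lys; rewrite mem_head.
congr (foldl _ _ (_ ++ _)); apply/eq_in_map=> u us /=; apply: rE.
by apply: lys; rewrite inE us orbT.
Qed.

Lemma letter_of_inj zs z w w' : lam (z :: zs) w -> lam (z :: zs) w' ->
  letter_of (size zs) w = letter_of (size zs) w' -> w = w'.
Proof.
move=> /letter_ofP[k [y [s [-> Ew _ _ _]]]] /letter_ofP[k' [y' [s' [-> Ew' _ _ _]]]] [Ek Ey Es].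
by rewrite Ew Ew' Ek Ey Es.
Qed.

Variable K : comNzRingType.
Local Notation P := (rpair (fun a b : word d => (a == b)%:R : K)).

(** One level is unfolded at a time: [rpair_star] preserves the pairing, and a word of the alphabet
    is determined by its decomposition. *)
Lemma rpair_substitution zs g T :
  over (lam zs) (verts g) -> over (lam zs) (leaf_labels T) ->
  P (rbind word_rooted g) (tbind word_tree T) = P g T.
Proof.
elim: zs g T => [|z zs IH] g T og oT.
  rewrite (@eq_in_rbind _ _ _ (@Vertex _)) => [|w /og]; last exact: word_rooted1.
  rewrite (@eq_in_tbind _ _ _ (@Leaf _)) => [|w /oT]; last exact: word_tree1.
  have -> : rbind (@Vertex _) g = g by elim: (g) => //= ? -> ? ->.
  by have -> : tbind (@Leaf _) T = T by elim: (T) => //= ? -> ? ->.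
set f := letter_of (size zs).
have -> : rbind word_rooted g = rbind word_rooted (rbind (star z) (rmap f g)).
  rewrite rbind_rbind rbind_rmap; apply: eq_in_rbind => w /og; exact: word_rooted_star.
have -> : tbind word_tree T = tbind word_tree (tbind (left_normed z) (tmap f T)).
  rewrite tbind_tbind tbind_tmap; apply: eq_in_tbind => w /oT; exact: word_tree_left_normed.
have mem_star w u : lam (z :: zs) w -> u \in (f w).1.2 :: nseq (f w).1.1.+1 z ++ (f w).2 -> lam zs u.
  case/letter_ofP=> k [y [s [E _ [lz lys] _ _]]].
  rewrite /f E inE mem_cat mem_nseq => /or3P[/eqP->|/andP[_ /eqP->]|us] //; apply: lys; rewrite inE ?eqxx //.
  by rewrite us orbT.
rewrite IH; first 1 last.
- move=> u; rewrite mem_verts_rbind verts_rmap has_map => /hasP[w /og lw] /=.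
  by rewrite verts_star; apply: mem_star.
- move=> u; rewrite mem_leaves_tbind leaf_labels_tmap has_map => /hasP[w /oT lw] /=.
  by rewrite leaves_left_normed; apply: mem_star.
rewrite rpair_star ?verts_rmap ?leaf_labels_tmap ?all_map; first 1 last.
- by apply/allP=> w /og /letter_ofP[k [y [s [E _ _ [gd _] _]]]]; rewrite -[preim _ _ _]/(good z (f w)) /f E.
- by apply/allP=> w /oT /letter_ofP[k [y [s [E _ _ [gd _] _]]]]; rewrite -[preim _ _ _]/(good z (f w)) /f E.
rewrite rpair_map; apply: eq_in_rpair => w u /og lw /oT lu; congr (nat_of_bool _)%:R.
by apply/eqP/eqP=> [|->//]; apply: letter_of_inj lw lu.
Qed.
End WordGraphs.

(** * Duality of Lyndon words *)

Section WordDuality.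
Variable d : nat.
Implicit Types (zs : seq (word d)) (u w z : word d).
Local Notation wlt := (lexlt (@ord_lt d)).

(** What is remembered of a word spelled over [lam zs] when z is the next entry of its list: z is
    the least letter, and it is not the only one. *)
Definition expands zs z (s : seq (word d)) : Prop :=
  [/\ over (lam zs) s, z \in s, exists2 y, y \in s & y != z &
      forall y, y \in s -> y = z \/ wlt z y].

Lemma expands_letter zs z w : lam (z :: zs) w -> forall k y s,
  letter_of (size zs) w = (k, y, s) -> expands zs z (y :: nseq k.+1 z ++ s).
Proof.
move=> lw; have [k [y [s [-> _ [lz lys] [/andP[yz _] zlt] _]]]] := letter_ofP lw.
move=> _ _ _ [<- <- <-]; split.
- move=> u; rewrite inE mem_cat mem_nseq => /or3P[/eqP->|/andP[_ /eqP->]|us] //; apply: lys;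
    by rewrite inE ?eqxx ?us ?orbT.
- by rewrite inE mem_cat inE eqxx orbT.
- by exists y; rewrite ?mem_head.
- move=> u; rewrite inE mem_cat mem_nseq => /or3P[/eqP->|/andP[_ /eqP->]|us];
    [right|by left|right]; by apply: zlt; rewrite inE ?eqxx ?us ?orbT.
Qed.

Lemma expands_flatten zs z z1 (s s' : seq (word d)) (h : word d -> seq (word d)) :
  expands (z :: zs) z1 s -> (forall w, lam (z :: zs) w -> expands zs z (h w)) ->
  s' =i flatten (map h s) -> expands zs z s'.
Proof.
move=> [os z1s _ _] eh es'.
have e1 w : w \in s -> expands zs z (h w) by move/os/eh.
have ms w y : w \in s -> y \in h w -> y \in s'.
  by move=> ws yw; rewrite es'; apply/flattenP; exists (h w) => //; apply: map_f.
have [_ zh [y yh yz] _] := e1 _ z1s; split.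
- move=> u; rewrite es' => /flattenP[_ /mapP[w ws ->] uw].
  by have [ow _ _ _] := e1 _ ws; apply: ow.
- exact: ms zh.
- by exists y => //; apply: ms yh.
- move=> u; rewrite es' => /flattenP[_ /mapP[w ws ->] uw].
  by have [_ _ _ ow] := e1 _ ws; apply: ow.
Qed.

Lemma verts_rbind (X Y : Type) (f : X -> rooted Y) g :
  verts (rbind f g) = flatten (map (fun x => verts (f x)) (verts g)).
Proof. by elim: g => /= [x|g -> h ->]; rewrite ?cats0 // map_cat flatten_cat. Qed.

Lemma leaf_labels_tbind (X Y : Type) (f : X -> tree Y) T :
  leaf_labels (tbind f T) = flatten (map (fun x => leaf_labels (f x)) (leaf_labels T)).
Proof. by elim: T => /= [x|l -> r ->]; rewrite ?cats0 // map_cat flatten_cat. Qed.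

Lemma word_expand zs1 z zs w : lam (zs1 ++ z :: zs) w ->
  exists g T, [/\ word_rooted w = rbind (@word_rooted d) g, word_tree w = tbind (@word_tree d) T,
    expands zs z (verts g) & expands zs z (leaf_labels T)].
Proof.
elim/last_ind: zs1 z zs w => [|zs1 z1 IH] z zs w lw.
  exists (star z (letter_of (size zs) w)), (left_normed z (letter_of (size zs) w)).
  rewrite -word_rooted_star // -word_tree_left_normed // verts_star leaves_left_normed.
  case E : (letter_of _ _) => [[k y] s].
  by split=> //; apply: (expands_letter lw E).
rewrite -cats1 -catA in lw; have [g [T [-> -> eg eT]]] := IH _ _ _ lw.
pose f := @letter_of d (size zs).
have ef w' : lam (z :: zs) w' -> expands zs z ((f w').1.2 :: nseq (f w').1.1.+1 z ++ (f w').2).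
  by move=> lw'; case E : (f w') => [[k y] s]; apply: (expands_letter lw' E).
have [og _ _ _] := eg; have [oT _ _ _] := eT.
exists (rbind (fun w' => star z (f w')) g), (tbind (fun w' => left_normed z (f w')) T); split.
- by rewrite rbind_rbind; apply: eq_in_rbind => w' /og; apply: word_rooted_star.
- by rewrite tbind_tbind; apply: eq_in_tbind => w' /oT; apply: word_tree_left_normed.
- apply: (expands_flatten (h := fun w' => (f w').1.2 :: nseq (f w').1.1.+1 z ++ (f w').2)) eg ef _.
  by move=> y; rewrite verts_rbind; congr (_ \in flatten _); apply: eq_map => i; rewrite verts_star.
- apply: (expands_flatten (h := fun w' => (f w').1.2 :: nseq (f w').1.1.+1 z ++ (f w').2)) eT ef _.
  by move=> y; rewrite leaf_labels_tbind; congr (_ \in flatten _); apply: eq_map => i;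
    rewrite leaves_left_normed.
Qed.

(** Lists of initial letters grow at the front, with the deepest alphabet at the end, so they are
    compared from the end. *)
Lemma common_suffix (X : eqType) (s t : seq X) : s != t ->
  exists s0, [\/ exists t1 (z : X), s = s0 /\ t = t1 ++ z :: s0,
                 exists s1 (z : X), t = s0 /\ s = s1 ++ z :: s0 |
                 exists s1 (z : X) t1 (z' : X), [/\ s = s1 ++ z :: s0, t = t1 ++ z' :: s0 & z != z']].
Proof.
elim/last_ind: s t => [|s a IH] t; case/lastP: t => [|t b] //.
- move=> _; exists [::]; apply: Or31; exists t, b; by split; rewrite ?cats1.
- move=> _; exists [::]; apply: Or32; exists s, a; by split; rewrite ?cats1.
rewrite eqseq_rcons negb_and; have [<-|ab _] := eqVneq a b; last first.
  by exists [::]; apply: Or33; exists s, a, t, b; rewrite !cats1.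
rewrite orbF => /IH[s0 H]; exists (rcons s0 a).
case: H => [[t1 [z [-> ->]]]|[s1 [z [-> ->]]]|[s1 [z [t1 [z' [-> -> zz']]]]]].
- by apply: Or31; exists t1, z; rewrite rcons_cat.
- by apply: Or32; exists s1, z; rewrite rcons_cat.
- by apply: Or33; exists s1, z, t1, z'; rewrite !rcons_cat.
Qed.

Lemma expands_letters zs z (s t : seq (word d)) u : perm_eq s t -> expands zs z s -> t = [:: u] -> False.
Proof.
move=> /perm_mem pst [_ zs' [y ys yz] _] Et; move: yz ys zs'.
rewrite !pst Et !inE => yz /eqP Ey /eqP Ez.
by rewrite Ey Ez eqxx in yz.
Qed.

Variable K : comNzRingType.

(** With equal lists both words are letters of one alphabet. Otherwise they are unfolded to the
    alphabet of the common end. If one list is this end, its word is a single letter while the other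
    word spells at least two distinct ones; if not, the least letters z and z' differ. In both cases
    the letters do not match. *)
Lemma rpair_lyndon w u : suffix_lyndon (@ord_lt d) w -> suffix_lyndon (@ord_lt d) u ->
  rpair (fun a b : word d => (a == b)%:R : K) (word_rooted w) (word_tree u) = (w == u)%:R.
Proof.
move=> /lam_exists[zs lw] /lam_exists[zs' lu].
have ov1 zs0 v : lam zs0 v -> over (lam zs0) [:: v] by move=> lv x; rewrite inE => /eqP->.
have [Ez|nz] := eqVneq zs zs'.
  by subst zs'; have := @rpair_substitution d K zs (Vertex w) (Leaf u) (ov1 _ _ lw) (ov1 _ _ lu).
have wu : (w == u) = false.
  by apply: contraNF nz => /eqP E; rewrite E in lw; rewrite (alpha_inj (lam_alpha lw) (lam_alpha lu)).
rewrite wu; apply/eqP/negPn/negP.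
have [zs0 [[t1 [z [Es Et]]]|[s1 [z [Et Es]]]|[s1 [z [t1 [z' [Es Et zz']]]]]]] := common_suffix nz.
- rewrite Et in lu; have [_ [T [_ -> _ eT]]] := word_expand lu.
  have [oT _ _ _] := eT; rewrite Es in lw.
  have -> := @rpair_substitution d K zs0 (Vertex w) T (ov1 _ _ lw) oT.
  by move=> /perm_eq_rpair; rewrite perm_sym => p; apply: (expands_letters p eT erefl).
- rewrite Es in lw; have [g [_ [-> _ eg _]]] := word_expand lw.
  have [og _ _ _] := eg; rewrite Et in lu.
  have -> := @rpair_substitution d K zs0 g (Leaf u) og (ov1 _ _ lu).
  by move=> /perm_eq_rpair p; apply: (expands_letters p eg erefl).
rewrite Es in lw; have [g [_ [-> _ eg _]]] := word_expand lw.
rewrite Et in lu; have [_ [T [_ -> _ eT]]] := word_expand lu.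
have [og zg _ zlt] := eg; have [oT zT _ zlt'] := eT.
rewrite (rpair_substitution K og oT) => /perm_eq_rpair/perm_mem p.
have := zlt z'; rewrite p => /(_ zT) [E|zz2]; first by rewrite E eqxx in zz'.
have := zlt' z; rewrite -p => /(_ zg) [E|z2z]; first by rewrite E eqxx in zz'.
by have := wlt_trans zz2 z2z; rewrite wlt_irr.
Qed.
End WordDuality.

(** * Spanning the free Lie algebra *)

Section Bracket.
Variables (K : fieldType) (V : vectType K).
Notation L := (free_lie V).
Implicit Types (s t : tree V) (x y z : L).

Lemma lie_ind (P : L -> Prop) :
  P 0 -> (forall c t x, P x -> P (c *: tree_class t + x)) -> forall x, P x.
Proof.
move=> P0 PD; elim/quotW; apply: freeg_span => [|c t u IH].
  have -> : \pi_(quotmod (@tree_rel K V))%qT 0 = 0 :> L.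
    exact: linear0 (quotmod_pi (@tree_rel K V)).
  exact: P0.
by have -> := quotmod_pi_linear (@tree_rel K V) c << t >> u; apply: PD.
Qed.

Lemma tree_classE t : tree_class t = quotmod_pi (@tree_rel K V) (tree_gen t).
Proof. by []. Qed.

Lemma class_multilinear C (a : K) (u v : V) :
  tree_class (plug C (Leaf (a *: u + v)))
  = a *: tree_class (plug C (Leaf u)) + tree_class (plug C (Leaf v)) :> L.
Proof.
apply/eqP; rewrite -subr_eq0 opprD addrA !tree_classE -linearZ -!linearB.
exact/eqP/quotmod_pi_rel/tree_multilinear.
Qed.

Lemma class_antisym C s t :
  tree_class (plug C (Node s t)) + tree_class (plug C (Node t s)) = 0 :> L.
Proof. by rewrite !tree_classE -linearD; apply/quotmod_pi_rel/tree_antisym. Qed.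

Lemma class_jacobi C r s t :
  tree_class (plug C (Node (Node r s) t)) + tree_class (plug C (Node (Node s t) r))
  + tree_class (plug C (Node (Node t r) s)) = 0 :> L.
Proof. by rewrite !tree_classE -!linearD; apply/quotmod_pi_rel/tree_jacobi. Qed.

(** The bracket of L is lifted in one argument at a time: here the left one, the right one being a
    fixed tree, and then the right one in [free_bracket]. *)
Definition free_ad t : {linear {freeg (tree V) / K} -> L} :=
  freeg_lift (fun s => tree_class (Node s t) : L).

Lemma free_ad_rel t u : tree_rel u -> free_ad t u = 0.
Proof.
have U s : free_ad t (tree_gen s) = tree_class (Node s t).
  exact: (freeg_liftU (fun s => tree_class (Node s t) : L)).
case=> [C a v w|C s s'|C r s s'].
- rewrite !linearB linearZ !U (class_multilinear (CtxL C t)).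
  by rewrite addrAC addrK subrr.
- by rewrite linearD !U (class_antisym (CtxL C t)).
- by rewrite !linearD !U (class_jacobi (CtxL C t)).
Qed.

Definition ad t : {linear L -> L} := quot_lift (@free_ad_rel t).

Lemma ad_class t s : ad t (tree_class s) = tree_class (Node s t).
Proof. by rewrite /ad quot_liftE; exact: (freeg_liftU (fun s => tree_class (Node s t) : L)). Qed.

Definition free_bracket x : {linear {freeg (tree V) / K} -> L} :=
  freeg_lift (fun t => ad t x).

Lemma free_bracket_linear u : linear (fun x => free_bracket x u).
Proof.
move=> c x y; rewrite ![free_bracket _ u]fglift_dom scaler_sumr -big_split.
by apply: eq_bigr => t _; rewrite linearP scalerDr !scalerA mulrC.
Qed.

Lemma free_bracket_rel x u : tree_rel u -> free_bracket x u = 0.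
Proof.
move=> ru; elim/lie_ind: x => [|c s x IH].
  by rewrite [LHS]fglift_dom big1 // => t _; rewrite linear0 scaler0.
rewrite (free_bracket_linear u) IH addr0.
suff -> : free_bracket (tree_class s) u = 0 by rewrite scaler0.
have U t : free_bracket (tree_class s) (tree_gen t) = tree_class (Node s t).
  by rewrite -ad_class; exact: (freeg_liftU (fun t => ad t (tree_class s))).
case: ru => [C a v w|C r r'|C r r' r''].
- rewrite !linearB linearZ !U (class_multilinear (CtxR s C)).
  by rewrite addrAC addrK subrr.
- by rewrite linearD !U (class_antisym (CtxR s C)).
- by rewrite !linearD !U (class_jacobi (CtxR s C)).
Qed.

Definition bracket x y : L := quot_lift (@free_bracket_rel x) y.

Lemma bracket_class s t : bracket (tree_class s) (tree_class t) = tree_class (Node s t).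
Proof.
rewrite /bracket quot_liftE -ad_class.
exact: (freeg_liftU (fun t => ad t (tree_class s))).
Qed.

Lemma bracketPr x : linear (bracket x).
Proof. by move=> c y z; rewrite /bracket linearP. Qed.

Lemma bracketPl y : linear (bracket^~ y).
Proof. by move=> c x z; exact: (free_bracket_linear (repr y) c x z). Qed.

Lemma bracket0l y : bracket 0 y = 0.
Proof. by have := bracketPl y (-1) 0 0; rewrite scaleN1r oppr0 add0r scaleN1r addNr. Qed.

Lemma bracket0r x : bracket x 0 = 0.
Proof. by rewrite /bracket linear0. Qed.

Lemma bracketDl x y z : bracket (x + y) z = bracket x z + bracket y z.
Proof. by have := bracketPl z 1 x y; rewrite !scale1r. Qed.

Lemma bracketC x y : bracket x y = - bracket y x.
Proof.
apply/eqP; rewrite -addr_eq0; apply/eqP.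
elim/lie_ind: x => [|c s x IH]; first by rewrite bracket0l bracket0r addr0.
rewrite bracketPl bracketPr addrACA IH addr0 -scalerDr.
suff -> : bracket (tree_class s) y + bracket y (tree_class s) = 0 by rewrite scaler0.
elim/lie_ind: y {IH} => [|a t y IH]; first by rewrite bracket0l bracket0r addr0.
rewrite bracketPl bracketPr addrACA IH addr0 -scalerDr !bracket_class.
by rewrite (class_antisym (Hole V)) scaler0.
Qed.

Lemma bracketNl x y : bracket (- x) y = - bracket x y.
Proof. by apply/eqP; rewrite -addr_eq0 -bracketDl addNr bracket0l. Qed.

Lemma bracket_jacobi x y z :
  bracket (bracket x y) z + bracket (bracket y z) x + bracket (bracket z x) y = 0.
Proof.
have lin (a : K) (p q r p' q' r' : L) : p + q + r = 0 -> p' + q' + r' = 0 ->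
    (a *: p + p') + (a *: q + q') + (a *: r + r') = 0.
  move=> e e'; rewrite (addrACA (a *: p)) (addrACA (a *: p + a *: q)) -!scalerDr e.
  by rewrite e' scaler0 addr0.
elim/lie_ind: x => [|c r x IH].
  by rewrite !(bracket0l, bracket0r) !addr0.
rewrite !(bracketPl, bracketPr); apply: (lin) => // {IH}.
elim/lie_ind: y => [|a s y IH].
  by rewrite !(bracket0l, bracket0r) !addr0.
rewrite !(bracketPl, bracketPr); apply: (lin) => // {IH}.
elim/lie_ind: z => [|b t z IH].
  by rewrite !(bracket0l, bracket0r) !addr0.
rewrite !(bracketPl, bracketPr); apply: (lin) => // {IH}.
by rewrite !bracket_class (class_jacobi (Hole V)).
Qed.

Lemma bracket_leibniz x y z :
  bracket (bracket x y) z = bracket (bracket x z) y + bracket x (bracket y z).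
Proof.
have /eqP := bracket_jacobi x y z; rewrite -addrA addr_eq0 opprD => /eqP ->.
by rewrite -bracketC addrC -bracketNl -bracketC.
Qed.
End Bracket.

(** * Elimination of the least letter *)

Section Elimination.
Variables (K : fieldType) (V : vectType K) (d : nat) (v : 'I_d -> V).
Hypothesis char2 : (2%:R : K) != 0.
Notation L := (free_lie V).
Notation br := (@bracket K V).
Local Notation wlt := (lexlt (@ord_lt d)).
Implicit Types (zs : seq (word d)) (u w z : word d) (T : tree (word d)) (a b : L).

(** Antisymmetry alone says that twice the bracket is 0. *)
Lemma bracketxx a : br a a = 0.
Proof.
have : br a a + br a a = 0 by rewrite [X in X + _]bracketC addNr.
rewrite -mulr2n -scaler_nat => /eqP; rewrite scaler_eq0 (negbTE char2) /=.
by move/eqP.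
Qed.

Definition lie_word w : L := tree_class (tmap (letter_label v) (word_tree w)).

Fixpoint lie_tree T : L :=
  match T with Leaf w => lie_word w | Node l r => br (lie_tree l) (lie_tree r) end.

Definition weight T := sumn (map size (leaf_labels T)).

(** The weight, the number of letters of V, is recorded because elimination keeps it while [zs]
    grows. *)
Definition lie_span zs n : L -> Prop :=
  in_span (fun a => exists T, [/\ over (lam zs) (leaf_labels T), weight T = n & a = lie_tree T]).

Lemma in_span_bracket (S1 S2 S3 : L -> Prop) a b :
  (forall x y, S1 x -> S2 y -> in_span S3 (br x y)) ->
  in_span S1 a -> in_span S2 b -> in_span S3 (br a b).
Proof.
move=> S12; elim=> [|c x a' S1x _ IH] S2b; first by rewrite bracket0l; apply: in_span0.
rewrite bracketPl; apply: in_spanD; last exact: IH.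
apply: in_spanZ; elim: S2b => [|e y b' S2y _ IH']; first by rewrite bracket0r; apply: in_span0.
by rewrite bracketPr; apply: in_spanD => //; apply: in_spanZ; apply: S12.
Qed.

Lemma lie_span_tree zs T : over (lam zs) (leaf_labels T) -> lie_span zs (weight T) (lie_tree T).
Proof. by move=> oT; apply: in_span_rel; exists T. Qed.

Lemma weight_node l r : weight (Node l r) = (weight l + weight r)%N.
Proof. by rewrite /weight /= map_cat sumn_cat. Qed.

Lemma lie_span_bracket zs m n a b : lie_span zs m a -> lie_span zs n b ->
  lie_span zs (m + n) (br a b).
Proof.
apply: in_span_bracket => _ _ [T [oT <- ->]] [T' [oT' <- ->]].
rewrite -weight_node; apply: (lie_span_tree (T := Node T T')) => u.
by rewrite mem_cat => /orP[/oT|/oT'].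
Qed.

Section Step.
Variables (zs : seq (word d)) (z : word d).
Hypothesis lz : lam zs z.
Let X := lie_word z.
Let M := lie_span (z :: zs).
Let Y y := lam zs y /\ wlt z y.

Let letter k y s : L := foldl br (lie_word y) (nseq k X ++ map lie_word s).
Let lword k y (s : seq (word d)) : word d := flatten (nseq k z ++ y :: s).

Lemma lam_letter k y s : over Y (y :: s) -> lam (z :: zs) (lword k.+1 y s).
Proof.
move=> oY; apply: lam_of_word; split.
  move=> u; rewrite mem_cat mem_nseq => /orP[/andP[_ /eqP->]//|/oY[]//].
exists k.+1, (y :: s); split=> // [|u /oY[]//].
by apply/negP=> /oY[_]; rewrite wlt_irr.
Qed.

Lemma lie_word_letter k y s : over Y (y :: s) -> lie_word (lword k.+1 y s) = letter k.+1 y s.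
Proof.
move=> oY; have sw : simple_in (alpha zs) z k.+1 (y :: s) (lword k.+1 y s).
  split=> //.
    by apply/negP=> /oY[_]; rewrite wlt_irr.
  by move=> u; rewrite inE => /predU1P[->|/oY[ly _]]; apply: lam_alpha.
have lw : alpha (z :: zs) (lword k.+1 y s) by exists k.+1, (y :: s).
rewrite /lie_word /word_tree (level_alpha lw) [size _]/= [word_tree_rec _.+1 _]/= (decomposition_alpha sw).
rewrite [map _ (y :: s)]/=.
have tE u : lam zs u -> tree_class (tmap (letter_label v) (word_tree_rec (size zs) u)) = lie_word u.
  by move=> lu; rewrite /lie_word /word_tree (level_alpha (lam_alpha lu)).
have cl T Ts : tree_class (tmap (letter_label v) (foldl (@Node _) T Ts)) =
    foldl br (tree_class (tmap (letter_label v) T))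
      (map (fun T => tree_class (tmap (letter_label v) T)) Ts).
  by elim: Ts T => //= U Ts IH T; rewrite IH bracket_class.
rewrite cl map_cat map_nseq -map_comp !tE //; last by case: (oY y (mem_head _ _)).
rewrite /letter; congr (foldl _ _ (_ ++ _)); apply/eq_in_map=> u us /=; apply: tE.
by case: (oY u); rewrite // inE us orbT.
Qed.

Lemma size_lword k y s : size (lword k y s) = (k * size z + size y + sumn (map size s))%N.
Proof.
rewrite /lword flatten_cat size_cat /= size_cat addnA; congr (_ + _ + _)%N.
  by elim: k => //= k IH; rewrite size_cat IH mulSn.
by rewrite size_flatten.
Qed.

Lemma M_letter k y s : over Y (y :: s) -> M (k.+1 * size z + size y + sumn (map size s)) (letter k.+1 y s).
Proof.
move=> oY; rewrite -size_lword -lie_word_letter //.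
have -> : size (lword k.+1 y s) = weight (Leaf (lword k.+1 y s)) by rewrite /weight /= addn0.
by apply: (lie_span_tree (T := Leaf _)) => u; rewrite inE => /eqP->; apply: lam_letter.
Qed.

Lemma letter_rcons k y s x : letter k y (rcons s x) = br (letter k y s) (lie_word x).
Proof. by rewrite /letter map_rcons -cats1 catA foldl_cat. Qed.

(* By the Leibniz rule, only the letters need to be bracketed with b. *)
Lemma M_derivation m b n a :
  (forall w, lam (z :: zs) w -> M (size w + m) (br (lie_word w) b)) ->
  M n a -> M (n + m) (br a b).
Proof.
move=> Hb; elim=> [|c x a' [T [oT <- ->]] _ IH]; first by rewrite bracket0l; apply: in_span0.
rewrite bracketPl; apply: in_spanD => //; apply: in_spanZ.
elim: T oT {c x a' IH} => [w|l IHl r IHr] oT.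
  by rewrite /weight /= addn0; apply: (Hb); apply: oT; rewrite inE.
have /over_cat[ol or] := oT; rewrite weight_node /= bracket_leibniz.
apply: in_spanD; first by rewrite addnAC; apply: lie_span_bracket (IHl ol) (lie_span_tree or).
by rewrite -addnA; apply: lie_span_bracket (lie_span_tree ol) (IHr or).
Qed.

Lemma lam_split w : lam (z :: zs) w ->
  exists k y s, over Y (y :: s) /\ w = lword k.+1 y s.
Proof.
case=> -[|k] [[|y s] [[// k0 // y0 zy Cu ->] zlt]].
by exists k, y, s; split=> // u us; split; [apply: Cu; rewrite inE us orbT|apply: zlt].
Qed.

(** By [M_derivation] only words of the new alphabet matter, and bracketing one of them with y
    appends y to its tail. *)
Lemma M_word n a y : Y y -> M n a -> M (n + size y) (br a (lie_word y)).
Proof.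
move=> Yy; apply: M_derivation => w /lam_split[k [x [s [os ->]]]].
rewrite lie_word_letter // -letter_rcons size_lword.
have -> : (k.+1 * size z + size x + sumn (map size s) + size y =
  k.+1 * size z + size x + sumn (map size (rcons s y)))%N.
  by rewrite map_rcons -cats1 sumn_cat /= addn0 addnA.
by apply: M_letter => u; rewrite inE mem_rcons inE orbCA => /orP[/eqP->|/os].
Qed.

Lemma M_word_z y : Y y -> M (size y + size z) (br (lie_word y) X).
Proof.
move=> Yy; have := @M_letter 0 y [::]; rewrite /= addn0 mul1n addnC; apply.
by move=> u; rewrite inE => /eqP->.
Qed.

(** For a word with a one-letter tail, z raises the exponent. Otherwise the Leibniz rule moves z
    inwards past the last letter y, and the extra bracket [y, z] is itself in the new alphabet. *)
Lemma M_z n a : M n a -> M (n + size z) (br a X).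
Proof.
apply: M_derivation => w /lam_split[k [x [s [os ->]]]].
rewrite lie_word_letter //; elim/last_ind: s os => [|s y IH] os.
  have -> : br (letter k.+1 x [::]) X = letter k.+2 x [::].
    rewrite /letter !cats0 -[nseq k.+2 X]/(nseq (1 + k.+1) X) addnC nseqD foldl_cat.
    by [].
  have -> : (size (lword k.+1 x [::]) + size z = k.+2 * size z + size x + 0)%N.
    by rewrite size_lword [sumn _]/= !addn0 mulSn addnC addnA mulSn.
  exact: (@M_letter k.+1 x [::] os).
have os' : over Y (x :: s).
  by move=> u; rewrite inE => ux; apply: os; rewrite inE mem_rcons inE orbCA ux orbT.
have Yy : Y y by apply: os; rewrite inE mem_rcons mem_head orbT.
have -> : (size (lword k.+1 x (rcons s y)) = size (lword k.+1 x s) + size y)%N.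
  by rewrite !size_lword map_rcons -cats1 sumn_cat /= addn0 addnA.
rewrite letter_rcons bracket_leibniz; apply: in_spanD.
  by rewrite addnAC; apply: M_word => //; apply: IH.
rewrite -addnA; apply: lie_span_bracket; last exact: M_word_z.
by rewrite size_lword; apply: M_letter.
Qed.

Lemma bracket_nodeE a b c : br a (br b c) = br (br a b) c - br (br a c) b.
Proof. by rewrite (bracket_leibniz a b) addrAC subrr add0r. Qed.

Lemma M_tree n a T : over Y (leaf_labels T) -> M n a -> M (n + weight T) (br a (lie_tree T)).
Proof.
elim: T n a => [y|l IHl r IHr] n a oT Ma.
  by rewrite /weight /= addn0; apply: M_word Ma; apply: oT; rewrite inE.
have /over_cat[ol or] := oT; rewrite weight_node /= bracket_nodeE -scaleN1r.
apply: in_spanD; first by rewrite addnA; apply: (IHr _ _ or); apply: IHl.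
by apply: in_spanZ; rewrite [(weight l + _)%N]addnC addnA; apply: (IHl _ _ ol); apply: IHr.
Qed.

(** Letters above z are not in the new alphabet, where the exponent of z is positive; they enter it
    through the bracket with z. *)
Lemma M_tree_z T : over Y (leaf_labels T) -> M (weight T + size z) (br (lie_tree T) X).
Proof.
elim: T => [y|l IHl r IHr] oT.
  by rewrite /weight /= addn0; apply: M_word_z; apply: oT; rewrite inE.
have /over_cat[ol or] := oT; rewrite weight_node /= bracket_leibniz.
apply: in_spanD; first by rewrite addnAC; apply: M_tree or (IHl ol).
rewrite bracketC -scaleN1r; apply: in_spanZ.
by rewrite -addnA addnC; apply: M_tree ol (IHr or).
Qed.

Lemma M_bracketC n a b : M n (br a b) -> M n (br b a).
Proof. by move=> Mab; rewrite bracketC -scaleN1r; apply: in_spanZ. Qed.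

(** The new words contain z and another letter, so trees without z and the single letter z are
    exceptions that the induction has to carry. *)
Lemma elimination T : over (fun u => u = z \/ Y u) (leaf_labels T) ->
  [\/ over Y (leaf_labels T), T = Leaf z | M (weight T) (lie_tree T)].
Proof.
have wz : weight (Leaf z) = size z by rewrite /weight /= addn0.
elim: T => [u|l IHl r IHr] oT.
  have [->|Yu] := oT u (mem_head _ _); first by constructor 2.
  by constructor 1 => w; rewrite inE => /eqP->.
have /over_cat[ol or] := oT; rewrite weight_node.
case: (IHl ol) (IHr or) => [Yl|->|Ml] [Yr|->|Mr];
    first by constructor 1; apply/over_cat.
all: constructor 3; rewrite /= ?wz.
- exact: M_tree_z.
- by apply: M_bracketC; rewrite addnC; apply: M_tree.
- by apply: M_bracketC; rewrite addnC; apply: M_tree_z.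
- by rewrite bracketxx; apply: in_span0.
- by apply: M_bracketC; rewrite addnC; apply: M_z.
- exact: M_tree.
- exact: M_z.
- exact: lie_span_bracket.
Qed.
End Step.

Lemma lam_size zs u : lam zs u -> (size zs < size u)%N.
Proof.
elim: zs u => [|z zs IH] u /=; first by move->.
case=> -[|k] [[|y s] [[// k0 // y0 zy Cu ->] zlt]].
have := IH z (Cu z (mem_head _ _)).
have := IH y (Cu y _); rewrite !inE eqxx orbT => /(_ isT).
by rewrite flatten_cat /= !size_cat; lia.
Qed.

Lemma least_word (s : seq (word d)) : s != [::] ->
  exists2 z, z \in s & forall u, u \in s -> u = z \/ wlt z u.
Proof.
elim: s => // a [|b s] IH _; first by exists a => [|u]; rewrite inE // => /eqP->; left.
have [z zs zmin] := IH isT; have [az|az] := boolP (wlt a z).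
  exists a => [|u]; rewrite inE ?eqxx // => /predU1P[->|/zmin[->|zu]]; [by left|by right|].
  by right; apply: wlt_trans zu.
exists z => [|u]; rewrite inE ?zs ?orbT // => /predU1P[->|/zmin//].
by have := wlt_total a z; rewrite (negbTE az) => /= /orP[/eqP->|]; [left|right].
Qed.

Lemma leaf_labels_nonempty (W : Type) (T : tree W) : (0 < size (leaf_labels T))%N.
Proof. by elim: T => //= l IHl r IHr; rewrite size_cat addn_gt0 IHl. Qed.

(** Elimination of the least letter keeps the weight and lengthens [zs], while a word of [lam zs]
    has more than [size zs] letters; the bound n on the difference therefore decreases. A tree
    reduced to its least letter is already a Lyndon word. *)
Lemma tree_span zs T : over (lam zs) (leaf_labels T) ->
  in_span (fun a => exists2 u, suffix_lyndon (@ord_lt d) u & a = lie_word u) (lie_tree T).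
Proof.
suff H n : (weight T < size zs + n)%N -> over (lam zs) (leaf_labels T) ->
    in_span (fun a => exists2 u, suffix_lyndon (@ord_lt d) u & a = lie_word u) (lie_tree T).
  by apply: (H (weight T).+1); lia.
elim: n zs T => [|n IH] zs T wT oT.
  have := leaf_labels_nonempty T; case E : (leaf_labels T) oT wT => [|u s] // oT wT _.
  have := lam_size (oT u (mem_head _ _)); move: wT; rewrite /weight E /=; lia.
have [|z zT zmin] := @least_word (leaf_labels T).
  by rewrite -size_eq0 -lt0n leaf_labels_nonempty.
have lz := oT z zT.
have [|oY|TE|MT] := @elimination zs z lz T.
- by move=> u uT; case: (zmin u uT) => [->|zu]; [left|right; split=> //; apply: oT].
- by have [_] := oY z zT; rewrite wlt_irr.
- by apply: in_span_rel; exists z; rewrite ?TE //; apply: lam_lyndon lz.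
elim: MT => [|c x y [U [oU wU ->]] _ IHy]; first exact: in_span0.
apply: in_spanD => //; apply: in_spanZ; apply: (IH (z :: zs)) => //.
by rewrite wU /= addSnnS.
Qed.
End Elimination.

(** * The bases *)

Lemma family_basis (K : nzRingType) (M : lmodType K) (I : choiceType) (b : I -> M)
    (D : I -> M -> K) :
  (forall i, linear (D i : M -> K^o)) -> (forall i j, D i (b j) = (j == i)%:R) ->
  (forall x, in_span (fun y => exists i, y = b i) x) -> is_family_basis b.
Proof.
move=> linD Db spanb; split=> [s c us sb0 i si|x].
  have D0 : D i 0 = 0.
    by have := linD i (-1) 0 0; rewrite scaler0 add0r scaleN1r addNr.
  rewrite -D0 -sb0; transitivity (\sum_(j <- s) c j * D i (b j)).
    rewrite (bigD1_seq i) //= Db eqxx mulr1 big1 ?addr0 // => j /negbTE ji.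
    by rewrite Db ji mulr0.
  elim: (s) => [|j s' IH]; first by rewrite !big_nil D0.
  by rewrite !big_cons IH; rewrite [RHS]linD.
(* Indices are kept free of repetitions, so that a new term can be added to the coefficient of its
   index. *)
suff [s [c [_ ->]]] : exists s c, uniq s /\ x = \sum_(i <- s) c i *: b i by exists s, c.
elim: (spanb x) => [|a _ y [i ->] _ [s [c [us ->]]]].
  by exists [::], (fun=> 0); rewrite big_nil.
have [si|si] := boolP (i \in s).
  exists s, (fun j => if j == i then a + c i else c j); split=> //.
  rewrite (bigD1_seq i) //= (bigD1_seq i si us) //= eqxx addrA -scalerDl; congr (_ + _).
  by apply: eq_bigr => j /negbTE->.
exists (i :: s), (fun j => if j == i then a else c j); split; first by rewrite /= si.
rewrite big_cons eqxx; congr (_ + _); rewrite !big_seq; apply: eq_bigr => j sj.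
by case: eqP => // ji; move: si; rewrite -ji sj.
Qed.

Lemma map_preimage (A : Type) (B : eqType) (p : A -> B) (s : seq B) :
  (forall x, x \in s -> exists a, x = p a) -> exists t, s = map p t.
Proof.
elim: s => [|x s IH] sp; first by exists [::].
have [a ->] := sp x (mem_head _ _).
have [|t ->] := IH; last by exists (a :: t).
by move=> y ys; apply: sp; rewrite inE ys orbT.
Qed.

Section WordLetters.
Variable d : nat.
Implicit Types (zs : seq (word d)) (w : word d).

Lemma perm_letters zs (h : word d -> seq (word d)) k y z s :
  (forall u, lam zs u -> perm_eq (h u) [seq [:: a] | a <- u]) ->
  lam zs z -> over (lam zs) (y :: s) ->
  perm_eq (flatten (map h (y :: nseq k z ++ s))) [seq [:: a] | a <- flatten (nseq k z ++ y :: s)].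
Proof.
move=> hu lz lys; rewrite map_flatten.
apply: perm_trans (_ : perm_eq (flatten (map h (nseq k z ++ y :: s))) _).
  by apply/perm_flatten/perm_map; rewrite perm_sym (perm_catCA _ [:: y]).
have : over (lam zs) (nseq k z ++ y :: s).
  by apply/over_cat; split=> // u; rewrite mem_nseq => /andP[_ /eqP->].
elim: (nseq _ _ ++ _) => //= u r IHr our; apply: perm_cat.
  by apply/hu/our/mem_head.
by apply: IHr => x xr; apply: our; rewrite inE xr orbT.
Qed.

Lemma verts_word_rooted zs w : lam zs w ->
  perm_eq (verts (word_rooted w)) [seq [:: a] | a <- w].
Proof.
elim: zs w => [|z zs IH] w lw.
  by rewrite word_rooted1 //; case: w lw => [|a [|]].
have [k [y [s [E Ew [lz lys] _ _]]]] := letter_ofP lw.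
rewrite (word_rooted_star lw) verts_rbind verts_star E Ew.
exact: perm_letters IH lz lys.
Qed.

Lemma leaves_word_tree zs w : lam zs w ->
  perm_eq (leaf_labels (word_tree w)) [seq [:: a] | a <- w].
Proof.
elim: zs w => [|z zs IH] w lw.
  by rewrite word_tree1 //; case: w lw => [|a [|]].
have [k [y [s [E Ew [lz lys] _ _]]]] := letter_ofP lw.
rewrite (word_tree_left_normed lw) leaf_labels_tbind leaves_left_normed E Ew.
exact: perm_letters IH lz lys.
Qed.
End WordLetters.

Lemma pair_tree_delta (K : fieldType) (V : vectType K) (A : eqType)
    (p : A -> dual_space V) (q : A -> V) g T :
  (forall x y, x \in verts g -> y \in leaf_labels T -> p x (q y) = (x == y)%:R) ->
  pair_tree (tmap q T) (rclass (rmap p g)) = rpair (fun x y : A => (x == y)%:R : K) g T.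
Proof. by move=> pq; rewrite pair_tree_rclass rpair_map; apply: eq_in_rpair. Qed.

Section Bases.
Variables (K : fieldType) (V : vectType K) (d : nat) (v : d.-tuple V).
Hypothesis basis_v : basis_of fullv v.
Notation W := (dual_space V).
Notation f := (dual_basis v).
Notation E := (cofree_lie W).
Notation L := (free_lie V).
Implicit Types (w u : word d).

Lemma dual_basisE i j : f i (tnth v j) = (i == j)%:R.
Proof.
rewrite /dual_basis lfunE /= (tnth_nth 0) coord_free; last exact: basis_free basis_v.
by rewrite eq_sym.
Qed.

Lemma basis_expand (x : V) : x = \sum_i coord v i x *: tnth v i.
Proof.
rewrite {1}(coord_basis basis_v (memvf x)); apply: eq_bigr => i _.
by rewrite -tnth_nth.
Qed.

Lemma dual_expand (g : W) : g = \sum_i (g (tnth v i) : K) *: f i.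
Proof.
apply/lfunP => x; rewrite {1}(basis_expand x) linear_sum sum_lfunE; apply: eq_bigr => i _.
by rewrite linearZ scale_lfunE /dual_basis lfunE /= [RHS]mulrC.
Qed.

Lemma letter_dualE w u : size w = 1%N -> size u = 1%N ->
  letter_label f w (letter_label (tnth v) u) = (w == u)%:R.
Proof.
case: w u => [|i [|]] // [|j [|]] // _ _ /=.
by rewrite dual_basisE eqseq_cons andbT.
Qed.

Lemma Lyndon_graphE w : Lyndon_graph v w = rclass (rmap (letter_label f) (word_rooted w)).
Proof. by rewrite /Lyndon_graph /graph_of_word graph_recE. Qed.

Lemma Lyndon_treeE w : Lyndon_tree v w = lie_word (tnth v) w.
Proof. by rewrite /Lyndon_tree /lie_of_word lie_recE. Qed.

Lemma size_letters (s : seq (word d)) w x :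
  perm_eq s [seq [:: a] | a <- w] -> x \in s -> size x = 1%N.
Proof. by move=> /perm_mem-> /mapP[a _ ->]. Qed.

Lemma Lyndon_duality w u : lyndon w -> lyndon u ->
  conf_pairing (Lyndon_graph v w) (Lyndon_tree v u) = (w == u)%:R.
Proof.
move=> /lyndonP lw /lyndonP lu; rewrite Lyndon_graphE Lyndon_treeE conf_pairing_tree.
have [zs lz] := lam_exists lw; have [zs' lz'] := lam_exists lu.
rewrite pair_tree_delta ?rpair_lyndon // => x y.
move=> /(size_letters (verts_word_rooted lz)) sx /(size_letters (leaves_word_tree lz')) sy.
exact: letter_dualE.
Qed.

(** Only equal multisets of letters pair. This confines the expansion of a word to Lyndon words of
    its own length. *)
Lemma conf_pairing_size w u : w != [::] -> lyndon u -> size w != size u ->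
  conf_pairing (wclass (map f w) : E) (Lyndon_tree v u) = 0.
Proof.
case: w => // a s _ /lyndonP lu swu; rewrite Lyndon_treeE conf_pairing_tree.
have [zs lz] := lam_exists lu.
have -> : wclass (map f (a :: s)) = rclass (rmap (letter_label f) (long [:: a] [seq [:: b] | b <- s])).
  by rewrite rmap_long -map_comp.
have sv x : x \in verts (long [:: a] [seq [:: b] | b <- s]) -> size x = 1%N.
  by rewrite verts_long -(map_cons (fun b => [:: b])) => /mapP[b _ ->].
rewrite pair_tree_delta => [|x y /sv sx /(size_letters (leaves_word_tree lz)) sy]; last first.
  exact: letter_dualE.
apply: contraNeq swu => /perm_eq_rpair/perm_size.
rewrite (perm_size (leaves_word_tree lz)) verts_long size_map => <- /=.
by rewrite size_map.
Qed.

Lemma lie_letters_span (x : L) :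
  in_span (fun a => exists T, over (lam [::]) (leaf_labels T) /\ a = lie_tree (tnth v) T) x.
Proof.
set S := fun a => _; apply: lie_ind x => [|c t x Sx]; first exact: in_span0.
apply: in_spanD => //; apply: in_spanZ; elim: t {c x Sx} => [x|l IHl r IHr]; last first.
  rewrite -bracket_class; apply: in_span_bracket IHl IHr => _ _ [T [oT ->]] [T' [oT' ->]].
  by apply: in_span_rel; exists (Node T T'); split=> //; apply/over_cat.
have lin := class_multilinear (Hole V); rewrite /= in lin.
have leaf0 : tree_class (Leaf 0) = 0 :> L.
  by have := lin (-1) 0 0; rewrite scaler0 addr0 scaleN1r addNr.
rewrite (basis_expand x); elim/big_rec: _ => [|i y _ Sy]; first by rewrite leaf0; apply: in_span0.
rewrite lin; apply: in_spanD => //; apply: in_spanZ; apply: in_span_rel.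
exists (Leaf [:: i]); split=> [u|]; first by rewrite inE => /eqP->.
by rewrite /= /lie_word word_tree1.
Qed.

Lemma Lyndon_tree_span (x : L) : (2%:R : K) != 0 ->
  in_span (fun a => exists w, lyndon w /\ a = Lyndon_tree v w) x.
Proof.
move=> char2; apply: in_span_sub (lie_letters_span x) => _ [T [oT ->]].
apply: in_span_sub (tree_span (tnth v) char2 oT) => _ [u lu ->].
by apply: in_span_rel; exists u; rewrite Lyndon_treeE; split=> //; apply/lyndonP.
Qed.
End Bases.

(** * Spanning the Lie coalgebra *)

Section Cospan.
Variables (K : fieldType) (V : vectType K) (d : nat) (v : d.-tuple V).
Hypotheses (basis_v : basis_of fullv v) (charK : [pchar K] =i pred0).
Notation W := (dual_space V).
Notation f := (dual_basis v).
Notation E := (cofree_lie W).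
Implicit Types (w u : word d) (x : E).

(** Multilinearity is applied at one vertex at a time; the list [enum 'I_n] is generalized to the
    vertices whose label may not yet be a dual basis vector. *)
Lemma class_letters n (G : graph n) (l : {ffun 'I_n -> W}) :
  in_span (fun y => exists m : 'I_n -> 'I_d, y = graph_class (LGraph G [ffun i => f (m i)]))
    (graph_class (LGraph G l) : E).
Proof.
have : forall i, i \notin enum 'I_n -> exists j, l i = f j by move=> i; rewrite mem_enum.
elim: (enum 'I_n) l => [|i r IH] l lr.
  have [i|m lm] := @fin_all_exists _ _ (fun i j => l i = f j); first exact: lr.
  by apply: in_span_rel; exists m; congr (graph_class (LGraph G _)); apply/ffunP=> i; rewrite ffunE.
have lE : l = relabel l i (l i) by apply/ffunP=> j; rewrite ffunE; case: eqP => [->|].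
have lin c y z : graph_class (LGraph G (relabel l i (c *: y + z)))
    = c *: graph_class (LGraph G (relabel l i y)) + graph_class (LGraph G (relabel l i z)) :> E.
  apply/eqP; rewrite -subr_eq0 opprD addrA !graph_classE -linearZ -!linearB.
  exact/eqP/quotmod_pi_rel/graph_multilinear.
rewrite lE (dual_expand basis_v (l i)); elim/big_rec: _ => [|j y _ Sy].
  have := lin (-1) 0 0; rewrite scaler0 addr0 scaleN1r addNr => ->.
  exact: in_span0.
rewrite lin; apply: in_spanD => //; apply/in_spanZ/IH => k kr; rewrite ffunE.
case: eqP => [_|/eqP ki]; first by exists j.
by apply: lr; rewrite inE negb_or ki.
Qed.

Lemma rclass_letters_span (g : rooted W) :
  (forall y, y \in verts g -> exists i, y = f i) ->
  in_span (fun y => exists t, size t = size (verts g) /\ y = wclass (map f t)) (rclass g : E).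
Proof.
move=> gf; apply: in_span_sub (rclass_in_span_long RHole g) => _ [a [s [ps ->]]].
have [y yas|t Et] := @map_preimage _ _ f (a :: s).
  by apply: gf; rewrite -(perm_mem ps).
by apply: in_span_rel; exists t; rewrite -(perm_size ps) Et size_map -Et.
Qed.

Lemma cofree_letters_span x :
  in_span (fun y => exists t, t != [::] /\ y = wclass (map f t)) x.
Proof.
apply: in_span_sub (cofree_span_class x) => _ [n [G [l ->]]].
apply: in_span_sub (class_letters G l) => _ [m ->].
have [k [e ->]] := class_rooted G [ffun i => f (m i)]; apply: in_spanZ.
apply: in_span_sub (rclass_letters_span _) => [_ [t [st ->]]|y]; last first.
  by rewrite verts_rmap => /mapP[i _ ->]; exists (m i); rewrite ffunE.
apply: in_span_rel; exists t; split=> //.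
by rewrite -size_eq0 st -size_arcs.
Qed.

Definition right_normed_tree (t : word d) : tree V :=
  if t is b :: t' then tmap (tnth v) (right_normed b t') else Leaf 0.

Let words n : E -> Prop := in_span (fun y => exists t, size t = n /\ y = wclass (map f t)).

(** Extends [cofree_dynkin] from words by linearity. The coefficients are pairings with trees, so n
    times x is recovered from these. *)
Lemma word_dynkin n x : (0 < n)%N -> words n x ->
  word_sum n (fun t => (pair_tree (right_normed_tree t) x : K) *: (wclass (map f t) : E)) = n%:R *: x.
Proof.
move=> + wx; elim: wx => [|c _ y [w [<- ->]] _ IH] n0.
  rewrite scaler0 -[RHS](word_sum0 'I_d _ n); apply: eq_word_sum => t _.
  by rewrite linear0 scale0r.
pose F z t := (pair_tree (right_normed_tree t) z : K) *: (wclass (map f t) : E).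
rewrite -/(F (c *: _ + y)) scalerDr -IH // -/(F y) scalerA [_ * c]mulrC -scalerA.
have -> : word_sum (size w) (F (c *: wclass (map f w) + y))
    = word_sum (size w) (fun t => c *: F (wclass (map f w)) t + F y t).
  by apply: eq_word_sum => t _; rewrite /F linearP scalerDl scalerA.
rewrite word_sumD word_sumZ; congr (c *: _ + word_sum _ (F y)).
case: w n0 {IH} => // a s _; rewrite -(cofree_dynkin _ a); apply: eq_word_sum => t st.
congr (_ *: _); case: t st => [|b t] // _; rewrite /= -rmap_long.
apply: pair_tree_delta => i j _ _.
exact: dual_basisE.
Qed.

(** The sum in [word_dynkin] is 0, and the length n is nonzero in K by the assumption on the
    characteristic. *)
Lemma cofree_nondegenerate n x : (0 < n)%N -> words n x ->
  (forall T, pair_tree T x = 0) -> x = 0.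
Proof.
move=> n0 wx pT; have := word_dynkin n0 wx.
have -> : word_sum n (fun t => (pair_tree (right_normed_tree t) x : K) *: (wclass (map f t) : E)) = 0.
  by rewrite -[RHS](word_sum0 'I_d _ n); apply: eq_word_sum => t _; rewrite pT scale0r.
move/esym/eqP; rewrite scaler_eq0; move/pcharf0P: charK => ->.
by rewrite eqn0Ngt n0 => /eqP.
Qed.

Lemma Lyndon_tree_ext x : (forall w, lyndon w -> conf_pairing x (Lyndon_tree v w) = 0) ->
  forall T, pair_tree T x = 0.
Proof.
move=> xL T; rewrite -conf_pairing_tree.
have char2 : (2%:R : K) != 0 by move/pcharf0P: charK => ->.
have lin := conf_pairing_linearr x.
elim: (Lyndon_tree_span basis_v (tree_class T) char2) => [|c _ y [w [lw ->]] _ IH].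
  by have := lin (-1) 0 0; rewrite scaler0 add0r scaleN1r addNr.
by rewrite lin xL // scaler0 add0r.
Qed.

Lemma Lyndon_graph_words w : lyndon w -> words (size w) (Lyndon_graph v w).
Proof.
move=> /lyndonP/lam_exists[zs lz]; have pw := verts_word_rooted lz.
rewrite Lyndon_graphE.
have -> : size w = size (verts (rmap (letter_label f) (word_rooted w))).
  by rewrite verts_rmap size_map (perm_size pw) size_map.
apply: rclass_letters_span => y; rewrite verts_rmap => /mapP[u].
by rewrite (perm_mem pw) => /mapP[a _ ->] ->; exists a.
Qed.

Lemma Lyndon_graph_span x :
  in_span (fun y => exists w, lyndon w /\ y = Lyndon_graph v w) x.
Proof.
apply: in_span_sub (cofree_letters_span x) => _ [w [w0 ->]].
set n := size w; set y := wclass _.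
have n0 : (0 < n)%N by rewrite lt0n size_eq0.
(* Only the Lyndon words of length n can pair with [y], and they are finitely many. *)
pose R : seq (word d) := [seq u : word d <- map val (enum {: n.-tuple 'I_d}) | lyndon u].
have mR u : (u \in R) = lyndon u && (size u == n).
  rewrite mem_filter; congr (_ && _); apply/mapP/eqP => [[t _ ->]|su]; first exact: size_tuple.
  by exists (tcast su (in_tuple u)); rewrite ?mem_enum //= val_tcast.
have uR : uniq R by rewrite filter_uniq // map_inj_uniq ?enum_uniq //; apply: val_inj.
pose z : E := \sum_(u <- R) (conf_pairing y (Lyndon_tree v u) : K) *: Lyndon_graph v u.
have Sz : in_span (fun y => exists w, lyndon w /\ y = Lyndon_graph v w) z.
  rewrite /z big_seq; apply: in_span_sum => u; rewrite mR => /andP[lu _].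
  by apply/in_spanZ/in_span_rel; exists u.
suff /eqP : y - z = 0 by rewrite subr_eq0 => /eqP->.
apply: (cofree_nondegenerate n0).
  apply: in_spanD; first by apply: in_span_rel; exists w.
  rewrite -scaleN1r; apply: in_spanZ; rewrite /z big_seq; apply: in_span_sum => u.
  by rewrite mR => /andP[lu /eqP <-]; apply/in_spanZ/Lyndon_graph_words.
apply: Lyndon_tree_ext => u lu; have lin := conf_pairing_linearl (Lyndon_tree v u).
have lin0 : conf_pairing (0 : E) (Lyndon_tree v u) = 0.
  by have := lin (-1) 0 0; rewrite scaler0 add0r scaleN1r addNr.
rewrite -scaleN1r addrC lin scaleN1r.
have -> : conf_pairing z (Lyndon_tree v u)
    = \sum_(t <- R) conf_pairing y (Lyndon_tree v t) * (t == u)%:R.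
  rewrite /z big_seq [RHS]big_seq; elim/big_ind2: _ => [|a b a' b' Ea Eb|t].
  - exact: lin0.
  - by have := lin 1 b b'; rewrite !scale1r => ->; rewrite Ea Eb.
  rewrite mR => /andP[lt _]; rewrite -[_ *: _]addr0 lin lin0 addr0.
  by rewrite Lyndon_duality.
(* For a word [u] of another length, [y] pairs to 0 by the number of letters and [z] pairs to 0 term
   by term. *)
have [su|su] := eqVneq n (size u); last first.
  rewrite conf_pairing_size // addr0 big_seq big1 ?oppr0 // => t; rewrite mR => /andP[_ /eqP st].
  by case: eqP => [tu|]; rewrite ?mulr0 //; move: su; rewrite -st tu eqxx.
have uRu : u \in R by rewrite mR lu su /=.
rewrite (bigD1_seq u) //= eqxx mulr1 big1 ?addr0 ?addNr // => t /negbTE->.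
by rewrite mulr0.
Qed.
End Cospan.

Theorem theorem4p2 (K : fieldType) (charK : [pchar K] =i pred0)
    (V : vectType K) (d : nat) (v : d.-tuple V) (basis_v : basis_of fullv v) :
  [/\ is_family_basis (fun w : lyndon_word d => Lyndon_tree v (val w)),
      is_family_basis (fun w : lyndon_word d => Lyndon_graph v (val w)) &
      forall w u : lyndon_word d,
        conf_pairing (Lyndon_graph v (val w)) (Lyndon_tree v (val u))
        = (w == u)%:R].
Proof.
have dual (w u : lyndon_word d) :
    conf_pairing (Lyndon_graph v (val w)) (Lyndon_tree v (val u)) = (w == u)%:R.
  by rewrite Lyndon_duality ?(valP w) ?(valP u).
have char2 : (2%:R : K) != 0 by move/pcharf0P: charK => ->.
split=> //.
- apply: (family_basis (D := fun w => conf_pairing (Lyndon_graph v (val w)))) => [w|w u|x].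
  + exact: conf_pairing_linearr.
  + by rewrite dual eq_sym.
  apply: in_span_sub (Lyndon_tree_span basis_v x char2) => _ [w [lw ->]].
  by apply: in_span_rel; exists (Sub w lw).
apply: (family_basis (D := fun u x => conf_pairing x (Lyndon_tree v (val u)))) => [u|u w|x].
- exact: conf_pairing_linearl.
- exact: dual.
apply: in_span_sub (Lyndon_graph_span basis_v charK x) => _ [w [lw ->]].
by apply: in_span_rel; exists (Sub w lw).
Qed.
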